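(* Suppose that $T=\{t_1,\dots,t_M\}$ is a finite set and that the Gaussian random field $f$ on $T$ has a nonsingular covariance matrix over $T\times T$. Then the Monte Carlo procedure $\mathcal{A}_{\mathrm{fin}}$ described in the context (with a suitable number $n$ of replications, depending on the required accuracy) is a fully polynomial randomized approximation scheme (FPRAS) for $w(b)=P(\max_{t\in T}f(t)>b)$ with $q=0$.
   Context: Computational model. Cost is measured in function evaluations, each costing at most a fixed amount of computer time: a single addition, multiplication or comparison; generation of one uniform random variable on $T$; generation of one standard Gaussian random variable; evaluation of the standard normal distribution function $\Phi(x)$ at a fixed $x\ge0$; evaluation of $E f(t)$ and of $\mathrm{Cov}(f(s),f(t))$ for given $s,t\in T$. FPRAS. For events $\{B_b: b\ge b_0\}$ with $0<P(B_b)\to0$ as $b\to\infty$ (here $B_b=\{\max_{t\in T}f(t)>b\}$), a Monte Carlo procedure is a fully polynomial randomized approximation scheme for $P(B_b)$ if, for some $q,q_1,q_2\in[0,\infty)$, it outputs an averaged estimator (an average of i.i.d. replications) guaranteed to have at most $\varepsilon>0$ relative error with confidence at least $1-\delta\in(0,1)$ in $\Theta(\varepsilon^{-q_1}\delta^{-q_2}|\log P(B_b)|^{q})$ function evaluations. Procedure $\mathcal{A}_{\mathrm{fin}}$. Let $X_i=f(t_i)$ and $X=(X_1,\dots,X_M)$. (1) Simulate $n$ i.i.d. copies $X^{(1)},\dots,X^{(n)}$ of $X$ from the distribution $$\mathcal{Q}(X\in B)=\sum_{i=1}^M p(i,b)\,P[X\in B\mid X_i>b],\qquad p(i,b)=\frac{P(X_i>b)}{\sum_{j=1}^M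 P(X_j>b)}.$$ (2) Output $\frac1n\sum_{i=1}^n L_b^{(i)}$, where $L_b^{(i)}=\sum_{j=1}^M P(X_j>b)\big/\sum_{j=1}^M\mathbf{1}(X_j^{(i)}>b)$. *)

(* Defs.v *)
From HB Require Import structures.
From mathcomp Require Import all_boot all_order all_algebra.
From mathcomp Require Import all_classical all_reals all_analysis.

Set Implicit Arguments.
Unset Strict Implicit.
Unset Printing Implicit Defensive.

Import Order.TTheory GRing.Theory Num.Theory.
Import numFieldNormedType.Exports.

Local Open Scope classical_set_scope.
Local Open Scope ring_scope.

(* Expectation of [F] under [n] independent draws from [mu], as an iterated
   integral (by Tonelli, the integral against the n-fold product measure). The
   draws are handed to [F] as a sequence of length [n]. *)
Fixpoint iid_expect {d} {T : measurableType d} {R : realType}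
    (mu : set T -> \bar R) (n : nat) (F : seq T -> \bar R) : \bar R :=
  if n is n'.+1
  then (\int[mu]_x iid_expect mu n' (fun xs => F (x :: xs)))%E
  else F [::].

Section GaussianField.
Context {d : measure_display} {Omega : measurableType d} {R : realType}.
Context (P : probability Omega R) {m : nat} (f : 'I_m.+1 -> {RV P >-> R}).

Definition field_vector (omega : Omega) : m.+1.-tuple (measurableTypeR R) :=
  [tuple f i omega | i < m.+1].

(* The law of the vector is that of [mu + A Z], [Z] a vector of [k] independent
   standard Gaussian variables; degenerate laws are included. *)
Definition gaussian_field : Prop :=
  exists (k : nat) (A : 'M[R]_(m.+1, k)) (mu : 'I_m.+1 -> R),
  forall B : set (m.+1.-tuple (measurableTypeR R)), measurable B ->
    P (field_vector @^-1` B) =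
    iid_expect (normal_prob 0 1 : set (measurableTypeR R) -> \bar R) k
      (fun z : seq R =>
         (\1_B ([tuple mu i + \sum_(j < k) A i j * z`_j | i < m.+1]
                : m.+1.-tuple (measurableTypeR R)))%:E).

Definition mean_fun (i : 'I_m.+1) : R := fine ('E_P[f i])%E.

Definition cov_mx : 'M[R]_m.+1 :=
  \matrix_(i, j) fine (covariance P (f i) (f j)).

Definition field_max (omega : Omega) : R :=
  \big[Num.max/f ord0 omega]_(i < m.+1) f i omega.

Definition excursion_prob (b : R) : R :=
  fine (P [set omega | b < field_max omega]).

Definition tail_prob (i : 'I_m.+1) (b : R) : R :=
  fine (P [set omega | b < f i omega]).

Definition mix_weight (i : 'I_m.+1) (b : R) : R :=
  tail_prob i b / \sum_(j < m.+1) tail_prob j b.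

(* The factor multiplying [mix_weight i b] is the conditional probability of
   [X \in B] given [X_i > b]. *)
Definition proposal (b : R) (B : set (m.+1.-tuple (measurableTypeR R))) :
    \bar R :=
  (\sum_(i < m.+1) mix_weight i b *
     (fine (P (field_vector @^-1` B `&` [set omega | (b < f i omega)%R])) /
      tail_prob i b))%:E.

Definition weight (b : R) (x : m.+1.-tuple (measurableTypeR R)) : R :=
  (\sum_(j < m.+1) tail_prob j b) / (\sum_(j < m.+1) (b < tnth x j)%R)%N%:R.

Definition averaged_estimator (b : R) (n : nat)
    (xs : seq (m.+1.-tuple (measurableTypeR R))) : R :=
  n%:R^-1 * \sum_(x <- xs) weight b x.

Definition Afin_law (b : R) (n : nat) (B : set R) : \bar R :=
  iid_expect (proposal b) n (fun xs => (\1_B (averaged_estimator b n xs))%:E).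

End GaussianField.

(* The computational model: real-number programs acting on registers holding
   reals and registers holding points of the index set T = 'I_M. Subtraction,
   division and square root, needed for the quotients in [mix_weight] and
   [weight] and for standard deviations, count as arithmetic operations. *)

Inductive point (M : nat) :=
| PReg of nat
| PLit of 'I_M.

Inductive expr (M : nat) :=
| Reg of nat
| Lit of nat
| Add of expr M & expr M
| Sub of expr M & expr M
| Mul of expr M & expr M
| Div of expr M & expr M
| Sqrt of expr M
| Phi of expr M
| Mean of point M
| Cov of point M & point M.

Inductive cmd (M : nat) :=
| Skip
| Assign of nat & expr M
| AssignPt of nat & point M
| Gauss of nat
| Unif of nat
| Seq of cmd M & cmd M
| IfLe of expr M & expr M & cmd M & cmd M
| WhileLe of expr M & expr M & cmd M.

Arguments Reg {M}.
Arguments Lit {M}.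
Arguments PReg {M}.
Arguments Skip {M}.
Arguments AssignPt {M}.
Arguments Gauss {M}.
Arguments Unif {M}.

(* Number of function evaluations made when evaluating an expression; reading
   a register or an integer literal is not one. *)
Fixpoint ops {M} (e : expr M) : nat :=
  match e with
  | Reg _ | Lit _ => 0
  | Add e1 e2 | Sub e1 e2 | Mul e1 e2 | Div e1 e2 => (ops e1 + ops e2).+1
  | Sqrt e1 | Phi e1 => (ops e1).+1
  | Mean _ | Cov _ _ => 1
  end%N.

Section Semantics.
Context {R : realType} {m : nat}.
Local Notation M := m.+1.

Record state := State { reals : nat -> R ; pts : nat -> 'I_M ; cost : nat }.

Definition set_real (s : state) (k : nat) (v : R) : state :=
  State (fun j => if j == k then v else reals s j) (pts s) (cost s).

Definition set_pt (s : state) (k : nat) (t : 'I_M) : state :=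
  State (reals s) (fun j => if j == k then t else pts s j) (cost s).

Definition tick (k : nat) (s : state) : state :=
  State (reals s) (pts s) (cost s + k).

Definition normal_cdf (x : R) : R := fine (normal_prob 0 1 [set y : R | y <= x]).

Variables (mu : 'I_M -> R) (C : 'M[R]_M).

Definition eval_pt (s : state) (p : point M) : 'I_M :=
  match p with PReg k => pts s k | PLit t => t end.

(* The normal distribution function is only available on nonnegative
   arguments: a negative one is replaced by 0. *)
Fixpoint eval (s : state) (e : expr M) : R :=
  match e with
  | Reg k => reals s k
  | Lit n => n%:R
  | Add e1 e2 => eval s e1 + eval s e2
  | Sub e1 e2 => eval s e1 - eval s e2
  | Mul e1 e2 => eval s e1 * eval s e2
  | Div e1 e2 => eval s e1 / eval s e2
  | Sqrt e1 => Num.sqrt (eval s e1)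
  | Phi e1 => normal_cdf (Num.max (eval s e1) 0)
  | Mean p => mu (eval_pt s p)
  | Cov p q => C (eval_pt s p) (eval_pt s q)
  end.

(* [expect c g s] is the expectation of [g] at the final state of [c] started
   from [s], runs that do not terminate contributing 0. Each random draw is
   fresh. A loop is the supremum of its finite unfoldings. *)
Fixpoint expect (c : cmd M) (g : state -> \bar R) (s : state) : \bar R :=
  match c with
  | Skip => g s
  | Assign k e => g (tick (ops e) (set_real s k (eval s e)))
  | AssignPt k p => g (set_pt s k (eval_pt s p))
  | Gauss k => (\int[normal_prob 0 1]_z g (tick 1 (set_real s k z)))%E
  | Unif k => (\sum_(t < M) (M%:R^-1)%:E * g (tick 1 (set_pt s k t)))%E
  | Seq c1 c2 => expect c1 (expect c2 g) s
  | IfLe e1 e2 c1 c2 =>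
      let s' := tick (ops e1 + ops e2).+1 s in
      if eval s e1 <= eval s e2 then expect c1 g s' else expect c2 g s'
  | WhileLe e1 e2 c1 =>
      let unfold h s0 :=
        let s' := tick (ops e1 + ops e2).+1 s0 in
        if eval s0 e1 <= eval s0 e2 then expect c1 h s' else g s' in
      ereal_sup (range (fun k => iter k unfold (fun=> 0%E) s))
  end.

(* Inputs: the level in register 0 and the number of replications in register
   1. Output: the final content of register 0. *)
Definition init_state (b : R) (n : nat) : state :=
  State (fun k => if k == 0%N then b else if k == 1%N then n%:R else 0)
        (fun=> ord0) 0.

Definition output_law (c : cmd M) (b : R) (n : nat) (B : set R) : \bar R :=
  expect c (fun s => (\1_B (reals s 0%N))%:E) (init_state b n).

Definition expected_cost (c : cmd M) (b : R) (n : nat) : \bar R :=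
  expect c (fun s => (cost s)%:R%:E) (init_state b n).

End Semantics.

(* [c], run with any number [n] of replications at any level [b >= b0],
   terminates almost surely with an output distributed as that of the
   procedure: both sides have mass 1 for [B = setT]. *)
Definition implements_Afin {d : measure_display} {Omega : measurableType d}
    {R : realType} (P : probability Omega R) {m : nat}
    (f : 'I_m.+1 -> {RV P >-> R}) (b0 : R) (c : cmd m.+1) : Prop :=
  forall (b : R) (n : nat) (B : set R), b0 <= b -> (0 < n)%N -> measurable B ->
    output_law (mean_fun f) (cov_mx f) c b n B = Afin_law f b n B.

(* [out b eps delta] and [cst b eps delta] are the law of the output and the
   expected number of function evaluations when relative accuracy [eps] is
   requested with confidence [1 - delta]. The two-sided bound is required
   uniformly over [eps] in any bounded range ]0, eps1]: no bound from above by
   a multiple of [eps `^ (- q1)] with [q1 > 0] can hold as [eps] grows, since a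
   run costs at least one evaluation. *)
Definition is_fpras {R : realType} (q b0 : R) (w : R -> R)
    (out : R -> R -> R -> set R -> \bar R) (cst : R -> R -> R -> \bar R) :
    Prop :=
  [/\ 0 <= q,
      (forall b : R, b0 <= b -> 0 < w b),
      w b @[b --> +oo] --> 0 &
      exists q1 q2 : R, [/\ 0 <= q1, 0 <= q2,
        (forall b eps delta : R, b0 <= b -> 0 < eps -> 0 < delta < 1 ->
           ((1 - delta)%:E <=
            out b eps delta [set y | `|y - w b| <= eps * w b]%R)%E) &
        (forall eps1 : R, 0 < eps1 -> exists k K : R, [/\ 0 < k, 0 < K &
           forall b eps delta : R, b0 <= b -> 0 < eps <= eps1 -> 0 < delta < 1 ->
             let rate := eps `^ (- q1) * delta `^ (- q2) * `|ln (w b)| `^ q in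
             ((k * rate)%:E <= cst b eps delta <= (K * rate)%:E)%E])]].

(* Main.v *)
(* Only the number of coordinates above b enters the weight L_b, so the procedure
   outputs an average of i.i.d. variables with finitely many values, of mean w(b)
   and bounded by the sum of the M tail probabilities, hence by M w(b). By
   Chebyshev, n of order M^2 eps^-2 delta^-1 replications suffice, uniformly in b.

   The conditional law of X given X_i > b is sampled from a triangular factor of
   the covariance whose first row is that of i: X_i then depends on one Gaussian
   variable only, which is drawn from its tail by Marsaglia's rejection method, at
   a cost bounded in b. The factor exists for any coefficient matrix of the field,
   by Givens rotations, under which the Gaussian measure is invariant, and since
   the covariance is nonsingular its entries are computed from the covariance by
   the Cholesky recursion. *)

Require Import Defs.
From HB Require Import structures.
From mathcomp Require Import all_boot all_order all_algebra.
From mathcomp Require Import all_classical all_reals all_analysis.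
From mathcomp Require Import measurable_realfun ring lra.

Set Implicit Arguments.
Unset Strict Implicit.
Unset Printing Implicit Defensive.

Import Order.TTheory GRing.Theory Num.Theory.
Import numFieldNormedType.Exports.

Local Open Scope classical_set_scope.
Local Open Scope ring_scope.

(** The field is only known as [mu + A Z] with an abstract [A], while a program can read nothing but
    means and covariances. The law is therefore moved to a triangular factor by operations that keep
    both the law and the Gram matrix, and this factor is determined by the covariance. That the Gram
    matrix is the covariance has itself to be derived from the law, through the second moment of the
    normal distribution. Planar changes of variable are reduced to one-dimensional ones: rotations
    to shears, polar coordinates to the slope of a ray and a signed radius. The normalising constant
    of the rejection method is never computed; it is enough that it is positive and finite. The
    semantics integrates functions that are not known to be measurable. Inequalities rest on
    monotonicity of the integral alone. Exact values are available because a replication is felt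
    only through its number of exceedances, which takes finitely many values. *)

Local Notation mR R := (measurableTypeR R).

(** * Integration *)

Section IntegralUtils.
Context {d : measure_display} {T : measurableType d} {R : realType}.
Local Open Scope ereal_scope.

(* No measurability is assumed: the lower integral is monotone. *)
Lemma le_integral_nomeas (mu : {measure set T -> \bar R}) (f g : T -> \bar R) :
  (forall x, f x <= g x) -> \int[mu]_x f x <= \int[mu]_x g x.
Proof.
have le0 (f1 f2 : T -> \bar R) : (forall x, 0 <= f1 x) ->
    (forall x, f1 x <= f2 x) -> \int[mu]_x f1 x <= \int[mu]_x f2 x.
  move=> f0 f12; rewrite !ge0_integralTE//; last first.
    by move=> x; exact: le_trans (f12 x).
  apply: ereal_sup_le => _ [h hf <-]; exists h => // x.
  exact: le_trans (hf x) (f12 x).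
move=> fg; rewrite [leLHS]integralE [leRHS]integralE.
apply: leeB; apply: le0 => // x.
- by rewrite !funeposE ge_max !le_max fg lexx orbT.
- by rewrite !funenegE ge_max !le_max leeN2 fg lexx orbT.
Qed.

Lemma integral_le_cst (mu : probability T R) (f : T -> \bar R) (c : R) :
  (forall x, f x <= c%:E) -> \int[mu]_x f x <= c%:E.
Proof.
move=> fc; apply: le_trans (le_integral_nomeas _ fc) _.
by rewrite integral_cst//= probability_setT mule1.
Qed.

Lemma integral_prob_cst (mu : probability T R) (c : \bar R) :
  \int[mu]_x c = c.
Proof. by rewrite integral_cst//= probability_setT mule1. Qed.

Lemma integral_gt0 (mu : probability T R) (f : T -> \bar R) :
  measurable_fun setT f -> (forall x, 0 < f x) -> 0 < \int[mu]_x f x.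
Proof.
move=> mf f0; rewrite lt_neqAle integral_ge0 ?andbT; last by move=> x _; exact: ltW.
apply/eqP => If0.
have : ae_eq mu setT f (cst 0).
  apply/(ae_eq_integral_abs _ measurableT mf).1; rewrite If0.
  by apply: eq_integral => x _; rewrite gee0_abs// ltW.
move=> [N [mN N0 sub]].
have NT : N = setT.
  by apply/seteqP; split => // x _; apply: sub => /= /(_ I) fx0; have := f0 x; rewrite fx0 ltxx.
by have /eqP := @probability_setT _ _ _ mu; rewrite -NT N0 eq_sym onee_eq0.
Qed.

End IntegralUtils.

Section NormalIntegral.
Context {R : realType}.
Local Open Scope ereal_scope.
Local Notation mu := (@lebesgue_measure R).
Import HBNNSimple.

(** The normal law is given by its density on sets; simple functions and monotone convergence carry
    the formula over to nonnegative measurable functions. *)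
Lemma ge0_integral_normal (m s : R) (f : mR R -> \bar R) :
  measurable_fun setT f -> (forall x, 0 <= f x) ->
  \int[normal_prob m s]_x f x = \int[mu]_x (f x * (normal_pdf m s x)%:E).
Proof.
move=> mf f0; pose f_ := nnsfun_approx measurableT mf.
have mphi : measurable_fun setT (fun x : mR R => (normal_pdf m s x)%:E).
  by apply/measurable_EFinP; exact: measurable_normal_pdf.
have cf x : (f_ n x)%:E @[n --> \oo] --> f x by exact: cvg_nnsfun_approx.
have step n : \int[normal_prob m s]_x (f_ n x)%:E
    = \int[mu]_x ((f_ n x)%:E * (normal_pdf m s x)%:E).
  rewrite integralT_nnsfun sintegralE; symmetry.
  transitivity (\int[mu]_x (\sum_(r \in range (f_ n))
      ((r * \1_(f_ n @^-1` [set r]) x)%:E * (normal_pdf m s x)%:E))).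
    apply: eq_integral => x _; rewrite fimfunE// -fsumEFin// ge0_mule_fsuml//.
    by move=> r; exact: nnfun_muleindic_ge0.
  rewrite ge0_integral_fsum//; last 2 first.
  - move=> r; apply: emeasurable_funM => //; apply/measurable_EFinP/measurable_funM => //.
  - by move=> r x _; rewrite mule_ge0 ?nnfun_muleindic_ge0// lee_fin normal_pdf_ge0.
  apply: eq_fsbigr => r _.
  have [r0|r0] := leP 0%R r; last first.
    rewrite preimage_nnfun0// measure0 mule0 integral0_eq// => x _ /=.
    by rewrite indicE in_set0 mulr0 mul0e.
  rewrite [X in _ = _ * X](_ : _ =
      \int[mu]_(x in f_ n @^-1` [set r]) (normal_pdf m s x)%:E)//.
  rewrite -[RHS]ge0_integralZl//.
  - rewrite [RHS]integral_mkcond; apply: eq_integral => x _.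
    by rewrite epatch_indic/= EFinM -!muleA; congr *%E; rewrite muleC.
  - exact: measurable_funTS.
  - by move=> x _; rewrite lee_fin normal_pdf_ge0.
transitivity (limn (fun n => \int[normal_prob m s]_x (f_ n x)%:E)).
  rewrite -monotone_convergence//.
  - by apply: eq_integral => x _; apply/esym/cvg_lim.
  - by move=> n; exact/measurable_EFinP/measurable_funTS.
  - by move=> *; rewrite lee_fin.
  - by move=> x _ a b ab; rewrite lee_fin; exact/lefP/nd_nnsfun_approx.
under eq_fun do rewrite step.
rewrite -monotone_convergence//.
- apply: eq_integral => x _; apply/cvg_lim => //.
  by apply: cvgeZr.
- by move=> n; apply: emeasurable_funM => //; exact/measurable_EFinP/measurable_funTS.
- by move=> n x _; rewrite mule_ge0// lee_fin// normal_pdf_ge0.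
- move=> x _ a b ab; apply: lee_wpmul2r; first by rewrite lee_fin normal_pdf_ge0.
  by rewrite lee_fin; exact/lefP/nd_nnsfun_approx.
Qed.

End NormalIntegral.

Section Iid.
Context {d : measure_display} {T : measurableType d} {R : realType}.
Variable mu : probability T R.
Local Open Scope ereal_scope.

Lemma eq_iid_expect n (F G : seq T -> \bar R) :
  (forall xs, size xs = n -> F xs = G xs) ->
  iid_expect mu n F = iid_expect mu n G.
Proof.
elim: n F G => [|n IH] F G FG /=; first exact: FG.
by apply: eq_integral => x _; apply: IH => xs sxs; apply: FG; rewrite /= sxs.
Qed.

Lemma iid_expect_ge0 n (F : seq T -> \bar R) :
  (forall xs, size xs = n -> 0 <= F xs) -> 0 <= iid_expect mu n F.
Proof.
elim: n F => [|n IH] F F0 /=; first exact: F0.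
by apply: integral_ge0 => x _; apply: IH => xs sxs; apply: F0; rewrite /= sxs.
Qed.

Lemma iid_expect_cst n (c : \bar R) : iid_expect mu n (fun=> c) = c.
Proof.
by elim: n => //= n IH; rewrite IH integral_prob_cst.
Qed.

Lemma iid_expect_mono n (F G : seq T -> \bar R) :
  (forall xs, size xs = n -> F xs <= G xs) ->
  iid_expect mu n F <= iid_expect mu n G.
Proof.
elim: n F G => [|n IH] F G FG /=; first exact: FG.
by apply: le_integral_nomeas => x; apply: IH => xs sxs; apply: FG; rewrite /= sxs.
Qed.

(** The parameter space varies in the induction: each draw is absorbed into the parameter before the
    next integral is taken. *)
Lemma measurable_iid_expect n d' (X : measurableType d')
    (F : X -> seq T -> \bar R) :
  (forall x xs, 0 <= F x xs) ->
  measurable_fun setT (fun p : X * n.-tuple T => F p.1 p.2) ->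
  measurable_fun setT (fun x => iid_expect mu n (F x)).
Proof.
elim: n d' X F => [|n IH] d' X F F0 mF /=.
  apply: (@measurableT_comp _ _ _ _ _ _ (fun p : X * 0.-tuple T => F p.1 p.2)
    _ (fun x => (x, [tuple] : 0.-tuple T))) => //.
pose G (p : X * T) (xs : seq T) := F p.1 (p.2 :: xs).
apply: (measurable_fun_fubini_tonelli_F (fun p => iid_expect mu n (G p))).
- apply: IH; first by move=> *; exact: F0.
  apply: (@measurableT_comp _ _ _ _ _ _ (fun p : X * n.+1.-tuple T => F p.1 p.2)
    _ (fun q : (X * T) * n.-tuple T => (q.1.1, [the n.+1.-tuple T of q.1.2 :: q.2]))) => //.
  apply: measurable_fun_pair.
    exact: (measurableT_comp measurable_fst measurable_fst).
  apply: measurable_cons => //.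
  exact: (measurableT_comp measurable_snd measurable_fst).
- by move=> p; apply: iid_expect_ge0 => xs _; exact: F0.
Qed.

Lemma measurable_cons_fix n d' (X : measurableType d') (F : seq T -> \bar R) (g : X -> T) :
  measurable_fun setT g ->
  measurable_fun setT (fun t : n.+1.-tuple T => F t) ->
  measurable_fun setT (fun p : X * n.-tuple T => F (g p.1 :: p.2)).
Proof.
move=> mg mF.
apply: (@measurableT_comp _ _ _ _ _ _ (fun t : n.+1.-tuple T => F t)
    _ (fun q : X * n.-tuple T => [the n.+1.-tuple T of g q.1 :: q.2])) => //.
by apply: measurable_cons => //; exact: (measurableT_comp mg measurable_fst).
Qed.

Lemma measurable_iid_expect_cons n (F : seq T -> \bar R) :
  (forall xs, 0 <= F xs) ->
  measurable_fun setT (fun t : n.+1.-tuple T => F t) ->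
  measurable_fun setT (fun x => iid_expect mu n (fun xs => F (x :: xs))).
Proof.
by move=> F0 mF; apply: measurable_iid_expect => //; exact: (@measurable_cons_fix n _ T F id).
Qed.

Lemma measurable_tail_cons n (F : seq T -> \bar R) (x : T) :
  measurable_fun setT (fun t : n.+1.-tuple T => F t) ->
  measurable_fun setT (fun t : n.-tuple T => F (x :: t)).
Proof.
move=> mF.
apply: (@measurableT_comp _ _ _ _ _ _ (fun t : n.+1.-tuple T => F t)
    _ (fun q : n.-tuple T => [the n.+1.-tuple T of x :: q])) => //.
by apply: measurable_cons.
Qed.

Lemma iid_expectD n (F G : seq T -> \bar R) :
  (forall xs, 0 <= F xs) -> (forall xs, 0 <= G xs) ->
  measurable_fun setT (fun t : n.-tuple T => F t) ->
  measurable_fun setT (fun t : n.-tuple T => G t) ->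
  iid_expect mu n (fun xs => F xs + G xs) = iid_expect mu n F + iid_expect mu n G.
Proof.
elim: n F G => [//|n IH] F G F0 G0 mF mG /=.
rewrite -ge0_integralD//.
- by apply: eq_integral => x _; rewrite IH//; exact: measurable_tail_cons.
- by move=> x _; exact: iid_expect_ge0.
- exact: measurable_iid_expect_cons.
- by move=> x _; exact: iid_expect_ge0.
- exact: measurable_iid_expect_cons.
Qed.

Lemma iid_expectZ n (c : R) (F : seq T -> \bar R) :
  (0 <= c)%R -> (forall xs, 0 <= F xs) ->
  measurable_fun setT (fun t : n.-tuple T => F t) ->
  iid_expect mu n (fun xs => c%:E * F xs) = c%:E * iid_expect mu n F.
Proof.
move=> c0; elim: n F => [//|n IH] F F0 mF /=.
rewrite -ge0_integralZl//.
- by apply: eq_integral => x _; rewrite IH//; exact: measurable_tail_cons.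
- exact: measurable_iid_expect_cons.
- by move=> x _; exact: iid_expect_ge0.
Qed.

Lemma iid_expect_sum n (I : Type) (r : seq I) (c : I -> R) (F : I -> seq T -> \bar R) :
  (forall i, 0 <= c i)%R -> (forall i xs, 0 <= F i xs) ->
  (forall i, measurable_fun setT (fun t : n.-tuple T => F i t)) ->
  iid_expect mu n (fun xs => \sum_(i <- r) (c i)%:E * F i xs)
  = \sum_(i <- r) (c i)%:E * iid_expect mu n (F i).
Proof.
move=> c0 F0 mF; elim: r => [|i r IH].
  by rewrite big_nil (@eq_iid_expect _ _ (fun=> 0)) ?iid_expect_cst// => xs _; rewrite big_nil.
rewrite big_cons -IH -iid_expectZ// -iid_expectD//.
- by apply: eq_iid_expect => xs _; rewrite big_cons.
- by move=> xs; rewrite mule_ge0 ?lee_fin.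
- by move=> xs; rewrite sume_ge0// => j _; rewrite mule_ge0 ?lee_fin.
- by apply: emeasurable_funM.
- by apply: emeasurable_sum => j; apply: emeasurable_funM.
Qed.

(** Draws that are never read can be added freely. This allows coefficient matrices to be padded
    with zero columns. *)
Lemma iid_expect_take n m (F : seq T -> \bar R) :
  iid_expect mu (n + m) (fun xs => F (take n xs)) = iid_expect mu n F.
Proof.
elim: n F => [|n IH] F.
  rewrite add0n (@eq_iid_expect _ _ (fun=> F [::])) ?iid_expect_cst// => xs _.
  by rewrite take0.
by rewrite addSn /=; apply: eq_integral => x _; rewrite -(IH (fun xs => F (x :: xs))).
Qed.

End Iid.

(** * Rotation invariance of the Gaussian measure *)

Section Sections.
Context d1 d2 d (T1 : measurableType d1) (T2 : measurableType d2) (T : measurableType d).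
Variables (K : T1 * T2 -> T) (mK : measurable_fun setT K).

Lemma measurable_section (x : T1) : measurable_fun setT (fun y => K (x, y)).
Proof. exact: (measurableT_comp mK (pair1_measurable x)). Qed.

Lemma measurable_ysection_fun (y : T2) : measurable_fun setT (fun x => K (x, y)).
Proof. exact: (measurableT_comp mK (pair2_measurable y)). Qed.

End Sections.

Section Lebesgue.
Context {R : realType}.
Local Notation mu := (@lebesgue_measure R).
Local Open Scope ereal_scope.

Lemma measurable_affine (c a : R) : measurable_fun setT (fun x : mR R => (c * x + a : mR R)%R).
Proof. by apply: measurable_funD => //; apply: measurable_funM. Qed.

(** The image of Lebesgue measure under [c * x + a], multiplied by [c], gives half-open intervals
    their length, and Lebesgue measure is unique with this property. *)
Lemma lebesgue_affine (c a : R) (f : mR R -> \bar R) : (0 < c)%R ->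
  measurable_fun setT f -> (forall x, 0 <= f x) ->
  \int[mu]_x f x = c%:E * \int[mu]_x f (c * x + a)%R.
Proof.
move=> c0 mf f0.
pose phi0 := fun x : mR R => (c * x + a : mR R)%R.
have mphi : measurable_fun setT phi0 := measurable_affine c a.
pose m := measure_function_mscale__canonical__measure_function_Measure (NngNum (ltW c0))
  (measure_function_pushforward__canonical__measure_function_Measure mu mphi).
have mE A : measurable A -> mu A = m A.
  apply: lebesgue_measure_unique => _ [[x y]] _ <-.
  transitivity (c%:E * mu (phi0 @^-1` `]x, y])) => //.
  rewrite [X in _ = _ * _ X](_ : _ = `](c^-1 * (x - a))%R, (c^-1 * (y - a))%R]%classic); last first.
    apply/seteqP; split => t /=; rewrite !in_itv/= /phi0.
      by rewrite ltr_pdivrMl// ler_pdivlMl// ltrBlDr lerBrDr.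
    by rewrite ltr_pdivrMl// ler_pdivlMl// ltrBlDr lerBrDr.
  rewrite !lebesgue_measure_itv/= !lte_fin ltr_pM2l ?invr_gt0// ltrD2r.
  case: ifPn => _; last by rewrite mule0.
  by rewrite -!EFinB -EFinM; congr EFin; field; rewrite gt_eqF.
transitivity (\int[m]_x f x); first by apply: eq_measure_integral => A mA _; exact: mE.
rewrite ge0_integral_mscale//; congr *%E.
by rewrite ge0_integral_pushforward.
Qed.

Lemma lebesgue_shift (a : R) (f : mR R -> \bar R) :
  measurable_fun setT f -> (forall x, 0 <= f x) ->
  \int[mu]_x f (x + a)%R = \int[mu]_x f x.
Proof.
move=> mf f0; rewrite (lebesgue_affine a ltr01 mf f0) mul1e.
by apply: eq_integral => x _; rewrite mul1r.
Qed.

Section Rotation.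
Variable K : mR R * mR R -> \bar R.
Hypotheses (mK : measurable_fun setT K) (K0 : forall p, 0 <= K p).

Lemma measurable_lin2 (a b a' b' : R) :
  measurable_fun setT (fun p : mR R * mR R =>
    ((a * p.1 + b * p.2, a' * p.1 + b' * p.2) : mR R * mR R)%R).
Proof.
by apply: measurable_fun_pair; apply: measurable_funD; apply: measurable_funM.
Qed.

Lemma measurable_lin2_comp (a b a' b' : R) :
  measurable_fun setT (fun p : mR R * mR R =>
    K ((a * p.1 + b * p.2, a' * p.1 + b' * p.2) : mR R * mR R)%R).
Proof. exact: (measurableT_comp mK (measurable_lin2 a b a' b')). Qed.

Lemma lebesgue_shear_y (a : R) :
  \int[mu]_x \int[mu]_y K (x, y + a * x)%R = \int[mu]_x \int[mu]_y K (x, y).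
Proof.
apply: eq_integral => x _.
rewrite (lebesgue_shift (a * x) (f := fun y => K (x, y)))//.
exact: measurable_section.
Qed.

Lemma lebesgue_shear_x (a : R) :
  \int[mu]_x \int[mu]_y K (x + a * y, y)%R = \int[mu]_x \int[mu]_y K (x, y).
Proof.
rewrite (fubini_tonelli K)// (fubini_tonelli (fun p : mR R * mR R => K (p.1 + a * p.2, p.2)%R))//=; last first.
  have := measurable_lin2_comp 1 a 0 1.
  by apply: eq_measurable_fun => p _; rewrite mul1r mul0r add0r mul1r.
apply: eq_integral => y _.
rewrite (lebesgue_shift (a * y) (f := fun x => K (x, y)))//.
exact: measurable_ysection_fun.
Qed.
End Rotation.

(* A rotation by an angle that is not a multiple of pi is a product of three shears. *)
Lemma lebesgue_rotation (c s : R) (K : mR R * mR R -> \bar R) :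
  measurable_fun setT K -> (forall p, 0 <= K p) ->
  (c ^+ 2 + s ^+ 2 = 1)%R -> s != 0%R ->
  \int[mu]_x \int[mu]_y K (c * x - s * y, s * x + c * y)%R
  = \int[mu]_x \int[mu]_y K (x, y).
Proof.
(* For a rotation by an angle with cosine [c] and sine [s], this is minus the tangent of the half
   angle. The three shears are by [t] along x, by [s] along y, and by [t] along x again. *)
move=> mK K0 cs s0; pose t := ((c - 1) / s)%R.
pose K1 (p : mR R * mR R) := K (p.1 + t * p.2, p.2)%R.
pose K2 (p : mR R * mR R) := K1 (p.1, p.2 + s * p.1)%R.
have mK1 : measurable_fun setT K1.
  have := measurable_lin2_comp mK 1 t 0 1.
  by apply: eq_measurable_fun => p _; rewrite mul1r mul0r add0r mul1r.
have mK2 : measurable_fun setT K2.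
  have := measurable_lin2_comp mK1 1 0 s 1.
  by apply: eq_measurable_fun => p _; rewrite mul1r mul0r addr0 mul1r addrC.
have K10 p : 0 <= K1 p by exact: K0.
have K20 p : 0 <= K2 p by exact: K0.
apply: etrans (lebesgue_shear_x mK K0 t).
apply: etrans (lebesgue_shear_y mK1 K10 s).
apply: etrans (lebesgue_shear_x mK2 K20 t).
apply: eq_integral => x _; apply: eq_integral => y _.
have c2 : (c ^+ 2 = 1 - s ^+ 2)%R by rewrite -cs; ring.
rewrite /K2 /K1 /=; congr (K (_, _)); rewrite /t.
  have -> : (c * x - s * y = c * x + (c ^+ 2 - 1) / s * y)%R by rewrite c2; field.
  by field.
by field.
Qed.

End Lebesgue.

Section Gauss2.
Context {R : realType}.
Local Open Scope ereal_scope.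
Local Notation N01 := (normal_prob 0 1 : set (mR R) -> \bar R).
Local Notation mu := (@lebesgue_measure R).

Lemma normal_pdf01E (x : R) :
  normal_pdf 0 1 x = (normal_peak 1 * expR (- (x ^+ 2 / 2)))%R.
Proof.
by rewrite normal_pdfE ?oner_neq0//= /normal_fun subr0 expr1n mulNr -mulr_natl mulr1.
Qed.

Lemma measurable_pdf01 : measurable_fun setT (fun x : mR R => (normal_pdf 0 1 x)%:E).
Proof. by apply/measurable_EFinP; exact: measurable_normal_pdf. Qed.

Lemma integral_gauss2 (K : mR R * mR R -> \bar R) :
  measurable_fun setT K -> (forall p, 0 <= K p) ->
  \int[N01]_x \int[N01]_y K (x, y) =
  \int[mu]_x \int[mu]_y (K (x, y) * ((normal_peak 1) ^+ 2 * expR (- ((x ^+ 2 + y ^+ 2) / 2)))%:E).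
Proof.
move=> mK K0.
rewrite ge0_integral_normal//; last 2 first.
- exact: (measurable_fun_fubini_tonelli_F K).
- by move=> x; exact: integral_ge0.
apply: eq_integral => x _.
have mKx := measurable_section mK x.
rewrite ge0_integral_normal// -ge0_integralZr//.
- apply: eq_integral => y _; rewrite -muleA; congr *%E.
  rewrite -EFinM !normal_pdf01E; congr EFin.
  by rewrite mulrDl opprD expRD; ring.
- by apply: emeasurable_funM => //; exact: measurable_pdf01.
- by move=> y _; rewrite mule_ge0// lee_fin normal_pdf_ge0.
- by rewrite lee_fin normal_pdf_ge0.
Qed.

Lemma measurable_gauss2 : measurable_fun setT (fun p : mR R * mR R =>
  ((normal_peak 1) ^+ 2 * expR (- ((p.1 ^+ 2 + p.2 ^+ 2) / 2)))%:E).
Proof.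
apply/measurable_EFinP; apply: measurable_funM => //.
apply: measurableT_comp => //; apply: measurableT_comp => //; apply: measurable_funM => //.
by apply: measurable_funD; apply: measurable_funX.
Qed.

(** The joint density of two independent standard Gaussians is a function of [x ^+ 2 + y ^+ 2],
    which a rotation preserves together with planar Lebesgue measure. *)
Lemma gauss_rotation (c s : R) (K : mR R * mR R -> \bar R) :
  measurable_fun setT K -> (forall p, 0 <= K p) ->
  (c ^+ 2 + s ^+ 2 = 1)%R ->
  \int[N01]_x \int[N01]_y K (c * x - s * y, s * x + c * y)%R
  = \int[N01]_x \int[N01]_y K (x, y).
Proof.
have rot (c' s' : R) (H : mR R * mR R -> \bar R) : measurable_fun setT H ->
    (forall p, 0 <= H p) -> (c' ^+ 2 + s' ^+ 2 = 1)%R -> s' != 0%R ->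
    \int[N01]_x \int[N01]_y H (c' * x - s' * y, s' * x + c' * y)%R
    = \int[N01]_x \int[N01]_y H (x, y).
  move=> mH H0 cs s0.
  pose H' (p : mR R * mR R) := H (c' * p.1 - s' * p.2, s' * p.1 + c' * p.2)%R.
  have mH' : measurable_fun setT H'.
    have := measurable_lin2_comp mH c' (- s') s' c'.
    by apply: eq_measurable_fun => p _; rewrite mulNr.
  pose G (p : mR R * mR R) := H p *
    ((normal_peak 1) ^+ 2 * expR (- ((p.1 ^+ 2 + p.2 ^+ 2) / 2)))%:E.
  have mG : measurable_fun setT G by apply: emeasurable_funM => //; exact: measurable_gauss2.
  have G0 p : 0 <= G p.
    by rewrite mule_ge0// lee_fin mulr_ge0 ?expR_ge0// exprn_ge0// normal_peak_ge0.
  apply: etrans (integral_gauss2 mH' (fun p => H0 _)) _.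
  apply: etrans (esym (integral_gauss2 mH H0)).
  apply: etrans (lebesgue_rotation mG G0 cs s0).
  apply: eq_integral => x _; apply: eq_integral => y _; rewrite /G /H' /=.
  congr (_ * (_ * expR _)%:E); congr (- (_ / _))%R.
  transitivity ((c' ^+ 2 + s' ^+ 2) * (x ^+ 2 + y ^+ 2))%R; last by ring.
  by rewrite cs mul1r.
move=> mK K0 cs; have [s0|s0] := eqVneq s 0%R; last exact: rot.
have [c1|c1] : (c = 1 \/ c = -1)%R.
  by apply/pred2P; rewrite -sqrf_eq1 -cs s0 expr0n addr0.
- by apply: eq_integral => x _; apply: eq_integral => y _; rewrite c1 s0 !mul1r !mul0r subr0 add0r.
(* The shears divide by the sine. The half turn, whose sine is 0, is done as two quarter turns. *)
have q1 : (0 ^+ 2 + 1 ^+ 2 = 1 :> R)%R by rewrite expr0n expr1n add0r.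
pose K' (p : mR R * mR R) := K (0 * p.1 - 1 * p.2, 1 * p.1 + 0 * p.2)%R.
have mK' : measurable_fun setT K'.
  have := measurable_lin2_comp mK 0 (- 1) 1 0.
  by apply: eq_measurable_fun => p _; rewrite !mulNr.
apply: etrans (rot 0%R 1%R K mK K0 q1 (oner_neq0 _)).
apply: etrans (rot 0%R 1%R K' mK' (fun p => K0 _) q1 (oner_neq0 _)).
apply: eq_integral => x _; apply: eq_integral => y _; rewrite c1 s0 /K' /=.
by congr (K (_, _)); ring.
Qed.

End Gauss2.

(** * The standard normal distribution function *)

Section NormalFacts.
Context {R : realType}.
Local Notation N01 := (normal_prob 0 1 : set (mR R) -> \bar R).
Local Notation lam := (@lebesgue_measure R).
Local Notation Phi := (@normal_cdf R).

Lemma normal_pdf01_gt0 (x : R) : 0 < normal_pdf 0 1 x.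
Proof. by rewrite normal_pdf01E mulr_gt0 ?expR_gt0// normal_peak_gt0// oner_neq0. Qed.

(** The density vanishes nowhere, so Lebesgue measure is dominated by the normal law. Strict
    monotonicity of the distribution function rests on this. *)
Lemma normal_null (A : set (mR R)) : measurable A -> N01 A = 0%E -> lam A = 0%E.
Proof.
move=> mA NA0.
have mpdf : measurable_fun A (fun x : mR R => (normal_pdf 0 1 x)%:E).
  by apply: measurable_funTS; exact: measurable_pdf01.
have : ae_eq lam A (fun x : mR R => (normal_pdf 0 1 x)%:E) (cst 0%E).
  apply/(ae_eq_integral_abs lam mA mpdf).1; rewrite -[RHS]NA0.
  by apply: eq_integral => x _; rewrite gee0_abs// lee_fin normal_pdf_ge0.
move=> [B [mB B0 sub]]; apply: (subset_measure0 mA mB _ B0) => x Ax.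
apply: sub => /= /(_ Ax) [] h; have := normal_pdf01_gt0 x.
by rewrite h ltxx.
Qed.

Lemma normal_set1 (x : R) : N01 [set x] = 0%E.
Proof.
have /null_content_dominatesP := normal_prob_dominates 0 (1:R).
by apply => //; exact: lebesgue_measure_set1.
Qed.

Lemma measurable_EFin_indic d (T : measurableType d) (A : set T) : measurable A ->
  measurable_fun setT (fun x => (\1_A x)%:E : \bar R).
Proof. by move=> mA; apply/measurable_EFinP; exact: measurable_indic. Qed.

(** Reflection is what a half turn of the plane does to the first coordinate, so the symmetry is a
    case of [gauss_rotation]. *)
Lemma normalN (A : set (mR R)) : measurable A -> N01 [set x | A (- x)] = N01 A.
Proof.
move=> mA; pose K (p : mR R * mR R) := ((\1_A p.1)%:E : \bar R).
have mK : measurable_fun setT K.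
  apply: (@measurableT_comp _ _ _ _ _ _ (fun x : mR R => (\1_A x)%:E : \bar R) _ fst) => //.
  exact: measurable_EFin_indic.
have cs : (-1) ^+ 2 + 0 ^+ 2 = 1 :> R by rewrite sqrrN expr1n expr0n addr0.
have K0 p : (0 <= K p)%E by rewrite lee_fin.
have := gauss_rotation mK K0 cs.
have mNA : measurable [set x : mR R | A (- x)].
  have := measurable_affine (-1) 0 measurableT mA; rewrite setTI.
  by congr measurable; apply/seteqP; split => x /=; rewrite mulN1r addr0.
have indicE' B : measurable B -> (\int[N01]_x (\1_B x)%:E = N01 B)%E.
  by move=> mB; rewrite integral_indic// setIT.
rewrite -(indicE' _ mA) -(indicE' _ mNA) => /esym h.
transitivity (\int[N01]_x \int[N01]_y K (x, y))%E; last first.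
  by apply: eq_integral => x _; rewrite (eq_integral (fun=> (\1_A x)%:E)) ?integral_prob_cst.
rewrite h; apply: eq_integral => x _.
rewrite /K/= (eq_integral (fun=> (\1_A (- x))%:E)) ?integral_prob_cst//.
by move=> y _; rewrite mul0r subr0 mulN1r.
Qed.

Lemma measurable_le (x : R) : measurable [set y : mR R | y <= x].
Proof. by rewrite -set_itvNyc. Qed.

Lemma measurable_gt (x : R) : measurable [set y : mR R | x < y].
Proof. by rewrite -set_itvoy. Qed.

Lemma normal_cdfE (x : R) : (Phi x)%:E = N01 [set y | y <= x].
Proof. by rewrite /normal_cdf fineK// fin_num_measure//; exact: measurable_le. Qed.

Lemma normal_gt (x : R) : N01 [set y | x < y] = (1 - Phi x)%:E.
Proof.
have mx := measurable_le x.
rewrite EFinB normal_cdfE -(probability_setC (normal_prob 0 1) mx); congr (N01 _).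
by apply/seteqP; split => y /=; rewrite ltNge => /negP.
Qed.

Lemma normal_cdfB (x y : R) : x <= y -> (Phi y - Phi x)%:E = N01 `]x, y]%classic.
Proof.
move=> xy; rewrite EFinB normal_cdfE.
have -> : N01 [set z | z <= y] = (N01 [set z | (z <= x)%R] + N01 `]x, y]%classic)%E.
  rewrite (_ : [set z : R | z <= y] = [set z | z <= x] `|` `]x, y]%classic).
    apply: measureU => //; first exact: measurable_le.
    apply/seteqP; split => z //= -[zx]; rewrite in_itv/= => /andP[].
    by rewrite ltNge zx.
  apply/seteqP; split => z /=; rewrite in_itv/=.
    by move=> zy; have [zx|xz] := leP z x; [left|right].
  by case=> [/le_trans->//|/andP[]].
by rewrite -[X in (X + _ - _)%E]normal_cdfE addeAC subee// add0e.
Qed.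

Lemma normal_cdf_lt (x y : R) : x < y -> Phi x < Phi y.
Proof.
move=> xy; rewrite -subr_gt0 -lte_fin normal_cdfB ?ltW// lt_neqAle measure_ge0 andbT.
apply/eqP => /esym/normal_null; rewrite lebesgue_measure_itv/= lte_fin xy.
by move=> /(_ (measurable_itv _)) /eqP; rewrite -EFinB eqe subr_eq0 gt_eqF.
Qed.

Lemma normal_cdf_le (x y : R) : (Phi x <= Phi y) = (x <= y).
Proof. by apply: le_mono; exact: normal_cdf_lt. Qed.

Lemma normal_cdf_ge0 (x : R) : 0 <= Phi x.
Proof. by rewrite -lee_fin normal_cdfE. Qed.

Lemma normal_cdf_le1 (x : R) : Phi x <= 1.
Proof. by rewrite -lee_fin normal_cdfE probability_le1//; exact: measurable_le. Qed.

Lemma normal_cdf_lt1 (x : R) : Phi x < 1.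
Proof.
apply: lt_le_trans (normal_cdf_le1 (x + 1)).
by apply: normal_cdf_lt; rewrite ltrDl.
Qed.

Lemma normal_cdfN (x : R) : Phi (- x) = 1 - Phi x.
Proof.
apply: EFin_inj; rewrite -normal_gt normal_cdfE.
rewrite -[LHS](normalN (measurable_le (- x))).
transitivity (N01 [set x] + N01 [set y | (x < y)%R])%E; last by rewrite normal_set1 add0e.
rewrite -[RHS]measureU//; [congr (N01 _)|exact: measurable_gt|]; apply/seteqP; split => y /=.
- by rewrite lerN2 le_eqVlt => /predU1P[->|]; [left|right].
- by rewrite lerN2 => -[->//|/ltW].
- by case=> ->; rewrite ltxx.
- by [].
Qed.

Lemma normal_cdf0 : Phi 0 = 2^-1.
Proof. by have := normal_cdfN 0; rewrite oppr0 => h; lra. Qed.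

(** Programs evaluate the distribution function at nonnegative arguments only. At least one of the
    two maxima is 0, where the function is 1/2, and [normal_cdfN] accounts for the other sign. *)
Lemma normal_cdf_signed (x : R) :
  2^-1 + Phi (Num.max x 0) - Phi (Num.max (- x) 0) = Phi x.
Proof.
have [x0|x0] := lerP 0 x.
  have -> : Num.max (- x) 0 = 0 by apply/max_idPr; rewrite oppr_le0.
  by rewrite normal_cdf0; lra.
have -> : Num.max (- x) 0 = - x by apply/max_idPl; rewrite oppr_ge0 ltW.
by rewrite normal_cdf0 normal_cdfN; lra.
Qed.

Lemma normal_cdf_continuous : continuous Phi.
Proof.
have peak0 : 0 < normal_peak (1 : R) by rewrite normal_peak_gt0// oner_neq0.
(* The density is bounded by its peak, so the distribution function is Lipschitz. *)
have lip x y : x <= y -> Phi y - Phi x <= normal_peak 1 * (y - x).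
  move=> xy; rewrite -lee_fin normal_cdfB//.
  apply: le_trans (_ : (\int[lam]_(z in `]x, y]) (normal_peak 1)%:E <= _)%E).
    apply: ge0_le_integral => //.
    - by move=> z _; rewrite lee_fin normal_pdf_ge0.
    - by apply: measurable_funTS; exact: measurable_pdf01.
    - by move=> z _; rewrite lee_fin normal_pdf_ub// oner_neq0.
  rewrite integral_cst//= lebesgue_measure_itv/= lte_fin.
  case: ifPn => _; first by rewrite -EFinB -EFinM.
  by rewrite mule0 lee_fin; apply: mulr_ge0; rewrite ?subr_ge0// ltW.
have lip' x y : `|Phi x - Phi y| <= normal_peak 1 * `|x - y|.
  wlog xy : x y / x <= y.
    by move=> H; have [|/ltW] := leP x y => /H //; rewrite distrC [in X in _ <= _ * X]distrC.
  by rewrite distrC [in leRHS]distrC !ger0_norm ?subr_ge0 ?normal_cdf_le//; exact: lip.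
move=> x; apply/cvgrPdist_le => e e0; near=> y.
apply: le_trans (lip' _ _) _; rewrite -ler_pdivlMl//.
near: y; apply/nbhs_ballP; exists ((normal_peak 1)^-1 * e) => /=.
  exact: (mulr_gt0 (R := R) (etrans (invr_gt0 _) peak0) e0).
by move=> y /ltW.
Unshelve. all: by end_near. Qed.

Lemma normal_cdf_cvg1 : Phi x @[x --> +oo] --> (1 : R).
Proof.
have mX : @measurable_fun _ _ (mR R) R setT (fun x => x) := @measurable_id _ (mR R) setT.
pose X : {RV (normal_prob 0 1 : probability (mR R) R) >-> R} :=
  HB.pack (fun x : mR R => (x : R)) (isMeasurableFun.Build _ _ (mR R) R _ mX).
have := @cvg_cdfy1 _ _ _ _ X.
move=> /fine_cvg; apply: cvg_trans; apply: near_eq_cvg; near=> x.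
rewrite /normal_cdf /cdf /distribution /pushforward /=; congr (fine (N01 _)).
Unshelve. all: by end_near. Qed.

Lemma normal_cdf_surj (p : R) : 0 < p < 1 -> exists x, Phi x = p.
Proof.
move=> /andP[p0 p1].
(* By symmetry a single point suffices: if the mass above N is below both [p] and [1 - p], the
   values at [- N] and [N] enclose [p]. *)
have [M hM] : exists M : R, forall x, M <= x -> 1 - Num.min p (1 - p) < Phi x.
  have e0 : 0 < Num.min p (1 - p) by rewrite lt_min p0 subr_gt0.
  have /cvgrPdist_lt /(_ _ e0) [M [_ hM]] := normal_cdf_cvg1.
  exists (M + 1) => x Mx; have Mx' : M < x by apply: lt_le_trans Mx; rewrite ltrDl.
  by have := hM x Mx'; rewrite ger0_norm ?subr_ge0 ?normal_cdf_le1// => h; lra.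
set N := Num.max M 0.
have hN : 1 - Num.min p (1 - p) < Phi N by apply: hM; rewrite /N le_max lexx.
have m1 : Num.min p (1 - p) <= p by rewrite ge_min lexx.
have m2 : Num.min p (1 - p) <= 1 - p by rewrite ge_min lexx orbT.
have pN : Phi (- N) <= p by rewrite normal_cdfN; lra.
have Np : p <= Phi N by lra.
have NN : - N <= N.
  have N0 : 0 <= N by rewrite /N le_max lexx orbT.
  by move: N0; lra.
have [] := @IVT R Phi (- N) N p NN.
- by apply: continuous_subspaceT; exact: normal_cdf_continuous.
- by rewrite ge_min pN le_max Np orbT.
by move=> x _ <-; exists x.
Qed.

(* The probability integral transform, in the form used to toss a biased coin. *)
Lemma normal_bernoulli (p : R) : 0 < p <= 1 -> N01 [set z | Phi z <= p] = p%:E.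
Proof.
move=> /andP[p0]; rewrite le_eqVlt => /predU1P[->|p1].
  rewrite (_ : [set _ | _] = setT); first exact: (@probability_setT _ _ _ (normal_prob 0 (1:R))).
  by apply/seteqP; split => // z _; exact: normal_cdf_le1.
have [x xp] := normal_cdf_surj (introT andP (conj p0 p1)).
rewrite -xp normal_cdfE; congr (N01 _).
by apply/seteqP; split => z /=; rewrite normal_cdf_le.
Qed.

End NormalFacts.

(** * Gaussian tails by rejection *)

Section Polar.
Context {R : realType}.
Local Notation lam := (@lebesgue_measure R).
Local Notation N01 := (normal_prob 0 1 : set (mR R) -> \bar R).
Local Open Scope ereal_scope.

Lemma lebesgue_scale (c : R) (f : mR R -> \bar R) : (0 < c)%R ->
  measurable_fun setT f -> (forall x, 0 <= f x) ->
  \int[lam]_x f x = c%:E * \int[lam]_x f (c * x)%R.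
Proof.
move=> c0 mf f0; rewrite (lebesgue_affine 0 c0 mf f0); congr *%E.
by apply: eq_integral => x _; rewrite addr0.
Qed.

Variable h : mR R -> \bar R.
Hypotheses (mh : measurable_fun setT h) (h0 : forall r, 0 <= h r).

Let K (p : mR R * mR R) := h (p.1 ^+ 2 + p.2 ^+ 2)%R.
Let J (p : mR R * mR R) := `|p.1|%:E * h (p.1 ^+ 2 * (1 + p.2 ^+ 2))%R.

Let mK : measurable_fun setT K.
Proof.
apply: (@measurableT_comp _ _ _ _ _ _ h _ (fun p : mR R * mR R => (p.1 ^+ 2 + p.2 ^+ 2 : mR R)%R)) => //.
by apply: measurable_funD; apply: measurable_funX.
Qed.

Let mJ : measurable_fun setT J.
Proof.
apply: emeasurable_funM.
  by apply/measurable_EFinP; exact: measurableT_comp.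
apply: (@measurableT_comp _ _ _ _ _ _ h _ (fun p : mR R * mR R => (p.1 ^+ 2 * (1 + p.2 ^+ 2) : mR R)%R)) => //.
apply: measurable_funM; first exact: measurable_funX.
by apply: measurable_funD => //; exact: measurable_funX.
Qed.

Let J0 p : 0 <= J p.
Proof. by rewrite mule_ge0// lee_fin. Qed.

(** Polar coordinates without angles: the inner substitution y = |x| t introduces the slope [t], and
    u = x sqrt (1 + t^2) is then a signed radius. The angular factor stays an unevaluated
    integral. *)
Lemma integral_polar :
  \int[lam]_x \int[lam]_y h (x ^+ 2 + y ^+ 2)%R =
  (\int[lam]_t ((1 + t ^+ 2)^-1)%:E) * \int[lam]_u (`|u|%:E * h (u ^+ 2)%R).
Proof.
transitivity (\int[lam]_x \int[lam]_t J (x, t)).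
  apply: ge0_ae_eq_integral => //.
  - exact: (measurable_fun_fubini_tonelli_F K mK (fun _ => h0 _)).
  - exact: (measurable_fun_fubini_tonelli_F J mJ J0).
  - by move=> x _; apply: integral_ge0 => y _; exact: h0.
  - by move=> x _; apply: integral_ge0 => y _; rewrite mule_ge0// lee_fin.
  (* The substitution degenerates on the line x = 0 only, which is negligible. *)
  exists [set 0%R]; split => //; first exact: lebesgue_measure_set1.
  move=> x /= hx; apply: contrapT => /eqP x0; apply: hx => _.
  rewrite (lebesgue_scale (c := `|x|)) ?normr_gt0//; last exact: (measurable_section mK).
  rewrite -ge0_integralZl//.
  - apply: eq_integral => t _; rewrite /J/= exprMn real_normK ?num_real//.
    by rewrite mulrDr mulr1.
  - rewrite (_ : (fun _ => _) = (fun y => K (x, y)) \o ( *%R `|x|)%R)//.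
    apply: measurableT_comp; first exact: (measurable_section mK).
    exact: measurable_funM.
rewrite (fubini_tonelli J)//.
rewrite -ge0_integralZr//; last 3 first.
- apply/measurable_EFinP; apply: continuous_measurable_fun.
  exact: continuous_oneDsqrV.
- by move=> t _; rewrite lee_fin invr_ge0 addr_ge0// sqr_ge0.
- by apply: integral_ge0 => u _; rewrite mule_ge0// lee_fin.
apply: eq_integral => t _.
have t1 : (0 < 1 + t ^+ 2)%R by rewrite ltr_pwDl// sqr_ge0.
pose g (u : mR R) := `|u|%:E * h (u ^+ 2)%R.
have mg : measurable_fun setT g.
  apply: emeasurable_funM; first by apply/measurable_EFinP; first [exact: measurable_normr | exact: normr_measurable].
  apply: (@measurableT_comp _ _ _ _ _ _ h _ (fun u : mR R => (u ^+ 2 : mR R)%R)) => //.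
have g0 u : 0 <= g u by rewrite mule_ge0// lee_fin.
rewrite [in RHS](lebesgue_scale (c := Num.sqrt (1 + t ^+ 2)) (f := g)) ?sqrtr_gt0//.
rewrite muleA -EFinM -ge0_integralZl//; last 2 first.
- apply: (@measurableT_comp _ _ _ _ _ _ g _ (fun u : mR R => Num.sqrt (1 + t ^+ 2) * u : mR R)%R) => //.
  exact: measurable_funM.
- by rewrite lee_fin mulr_ge0// ?sqrtr_ge0// invr_ge0 ltW.
apply: eq_integral => x _; rewrite /J /g /=.
rewrite exprMn sqr_sqrtr ?ltW// muleA -EFinM normrM ger0_norm ?sqrtr_ge0//.
rewrite [(x ^+ 2 * _)%R]mulrC; congr ((_)%:E * _).
have qq : (Num.sqrt (1 + t ^+ 2) * Num.sqrt (1 + t ^+ 2) = 1 + t ^+ 2)%R.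
  by rewrite -expr2 sqr_sqrtr// ltW.
move: qq; set a := Num.sqrt _; set q := (1 + t ^+ 2)%R in t1 *; move=> qq.
transitivity (q^-1 * (a * a) * `|x|)%R; last by ring.
by rewrite qq mulVf ?gt_eqF// mul1r.
Qed.

End Polar.

Section Density.
Context {d : measure_display} {T : measurableType d} {R : realType}.
Local Open Scope ereal_scope.
Import HBNNSimple.

Lemma ge0_integral_density (mu nu : {measure set T -> \bar R}) (w f : T -> \bar R) :
  measurable_fun setT w -> (forall x, 0 <= w x) ->
  (forall x, w x \is a fin_num) ->
  (forall A, measurable A -> nu A = \int[mu]_(x in A) w x) ->
  measurable_fun setT f -> (forall x, 0 <= f x) ->
  \int[nu]_x f x = \int[mu]_x (f x * w x).
Proof.
move=> mw w0 wfin nuE mf f0; pose f_ := nnsfun_approx measurableT mf.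
have cf x : (f_ n x)%:E @[n --> \oo] --> f x by exact: cvg_nnsfun_approx.
have step n : \int[nu]_x (f_ n x)%:E = \int[mu]_x ((f_ n x)%:E * w x).
  rewrite integralT_nnsfun sintegralE; symmetry.
  transitivity (\int[mu]_x (\sum_(r \in range (f_ n))
      ((r * \1_(f_ n @^-1` [set r]) x)%:E * w x))).
    apply: eq_integral => x _; rewrite fimfunE// -fsumEFin// ge0_mule_fsuml//.
    by move=> r; exact: nnfun_muleindic_ge0.
  rewrite ge0_integral_fsum//; last 2 first.
  - move=> r; apply: emeasurable_funM => //; apply/measurable_EFinP/measurable_funM => //.
  - by move=> r x _; rewrite mule_ge0// nnfun_muleindic_ge0.
  apply: eq_fsbigr => r _.
  have [r0|r0] := leP 0%R r; last first.
    rewrite preimage_nnfun0// measure0 mule0 integral0_eq// => x _ /=.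
    by rewrite indicE in_set0 mulr0 mul0e.
  rewrite [X in _ = _ * X]nuE//.
  rewrite -[RHS]ge0_integralZl//.
  - rewrite [RHS]integral_mkcond; apply: eq_integral => x _.
    by rewrite epatch_indic/= EFinM -!muleA; congr *%E; rewrite muleC.
  - exact: measurable_funTS.
transitivity (limn (fun n => \int[nu]_x (f_ n x)%:E)).
  rewrite -monotone_convergence//.
  - by apply: eq_integral => x _; apply/esym/cvg_lim.
  - by move=> n; exact/measurable_EFinP/measurable_funTS.
  - by move=> *; rewrite lee_fin.
  - by move=> x _ a b ab; rewrite lee_fin; exact/lefP/nd_nnsfun_approx.
under eq_fun do rewrite step.
rewrite -monotone_convergence//.
- apply: eq_integral => x _; apply/cvg_lim => //.
  by apply: cvgeZr.
- by move=> n; apply: emeasurable_funM => //; exact/measurable_EFinP/measurable_funTS.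
- by move=> n x _; rewrite mule_ge0// lee_fin.
- move=> x _ a b ab; apply: lee_wpmul2r => //.
  by rewrite lee_fin; exact/lefP/nd_nnsfun_approx.
Qed.

Lemma density_measure (mu : {measure set T -> \bar R}) (w : T -> \bar R) :
  measurable_fun setT w -> (forall x, 0 <= w x) ->
  exists nu : {measure set T -> \bar R}, forall A, nu A = \int[mu]_(x in A) w x.
Proof.
move=> mw w0; pose m A := \int[mu]_(x in A) w x.
have m0 : m set0 = 0 by rewrite /m integral_set0.
have mge0 A : 0 <= m A by apply: integral_ge0.
have msa : semi_sigma_additive m.
  move=> F mF tF mUF; rewrite /m ge0_integral_bigcup//; last exact: measurable_funTS.
  by apply: is_cvg_ereal_nneg_natsum_cond => n _ _; exact: integral_ge0.
exists (HB.pack_for {measure set T -> \bar R} m (isMeasure.Build _ _ _ m m0 mge0 msa)).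
by [].
Qed.

End Density.

Section RayUniqueness.
Context {R : realType}.
Local Open Scope ereal_scope.

(** Open right rays are stable under intersection, cover the line and generate the Borel sets;
    finite mass then makes a measure determined by its values on them. *)
Lemma measure_eq_rays (m1 m2 : {measure set (mR R) -> \bar R}) :
  m1 setT < +oo ->
  (forall y : R, m1 `]y, +oo[%classic = m2 `]y, +oo[%classic) ->
  forall A, measurable A -> m1 A = m2 A.
Proof.
move=> f1 rays.
move=> A mA; apply: (@measure_unique _ R (mR R) (@RGenOInfty.G R)
  (fun n => `](- n%:R)%R, +oo[%classic) _ _ _ _ m1 m2 _ _ A mA).
- exact: RGenOInfty.measurableE.
- move=> _ _ [x ->] [y ->]; exists (Num.max x y).
  by apply/seteqP; split => z /=; rewrite !in_itv/= !andbT gt_max => /andP.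
- by move=> n; exists (- n%:R)%R.
- rewrite -subTset => x _; exists (Num.truncn `|x|).+1 => //=.
  rewrite in_itv/= andbT ltrNl; apply: le_lt_trans (truncnS_gt _).
  by rewrite -normrN ler_norm.
- by move=> _ [x ->]; exact: rays.
- by move=> n; apply: le_lt_trans f1; apply: le_measure; rewrite ?inE.
Qed.

End RayUniqueness.

Section Marsaglia.
Context {R : realType}.
Local Notation lam := (@lebesgue_measure R).
Local Notation N01 := (normal_prob 0 1 : set (mR R) -> \bar R).
Local Notation Phi := (@normal_cdf R).
Variable a : R.
Hypothesis a0 : 0 < a.

Let F (u : R) : R := Num.sqrt (a ^+ 2 + u ^+ 2).

Let rad_gt0 u : 0 < a ^+ 2 + u ^+ 2.
Proof. by rewrite ltr_pwDl ?exprn_gt0// sqr_ge0. Qed.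

Let F_gt0 u : 0 < F u. Proof. by rewrite sqrtr_gt0. Qed.

Let F_sqr u : F u ^+ 2 = a ^+ 2 + u ^+ 2.
Proof. by rewrite sqr_sqrtr// ltW. Qed.

Let F_is_derive (u : R) : is_derive u (1 : R) F (u / F u).
Proof.
have h1 : is_derive u (1 : R) (fun x : R => a ^+ 2 + x ^+ 2) (2 * u).
  have h := is_deriveD (is_derive_cst (a ^+ 2) u (1 : R)) (is_deriveX 2 (is_derive_id u (1 : R))).
  by apply: (is_derive_eq h); rewrite add0r expr1 /= /GRing.scale/= mulr1.
have h2 := is_derive1_sqrt (rad_gt0 u).
have := @is_derive1_comp R Num.sqrt (fun x : R => a ^+ 2 + x ^+ 2) u _ _ h2 h1.
move=> h3; apply: (is_derive_eq h3); rewrite /F; field; exact: lt0r_neq0 (F_gt0 u).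
Qed.

Let F_derive1 : derive1 F = (fun u => u / F u).
Proof. by apply/funext => u; rewrite derive1E; apply: derive_val. Qed.

Let F_continuous : continuous F.
Proof.
by move=> u; apply: differentiable_continuous; apply/derivable1_diffP; have [] := F_is_derive u.
Qed.

Let dF_continuous : continuous (fun u : R => u / F u).
Proof.
move=> u; apply: cvgM; first exact: cvg_id.
by apply: cvgV; [exact: lt0r_neq0 (F_gt0 u)|exact: F_continuous].
Qed.

Let F_cvg : F u @[u --> +oo] --> +oo.
Proof.
apply: (@ger_cvgy _ _ _ _ id); last exact: cvg_id.
near=> u; apply: le_trans (ler_norm u) _.
by rewrite -sqrtr_sqr ler_wsqrtr// lerDr sqr_ge0.
Unshelve. all: by end_near. Qed.

Let dF_cvg : cvg ((fun u : R => u / F u) u @[u --> +oo]).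
Proof.
apply/cvg_ex; exists (Num.sqrt (1 - 0)).
have h : (fun u => Num.sqrt (1 - (a / F u) ^+ 2)) u @[u --> +oo] --> Num.sqrt (1 - 0 ^+ 2).
  apply: (cvg_comp (fun u : R => 1 - (a / F u) ^+ 2) Num.sqrt); last exact: sqrt_continuous.
  apply: cvgB; first exact: cvg_cst.
  apply: (cvg_comp (fun u : R => a / F u) (fun x : R => x ^+ 2)); last exact: exprn_continuous.
  have : a * (F u)^-1 @[u --> +oo] --> a * 0.
    apply: cvgM; first exact: cvg_cst.
    by apply/gtr0_cvgV0; [near=> u; exact: F_gt0|exact: F_cvg].
  by rewrite mulr0.
rewrite expr0n in h; apply: cvg_trans h; apply: near_eq_cvg.
exists 0; split; first exact: num_real.
move=> u /ltW u0.
have -> : 1 - (a / F u) ^+ 2 = (u / F u) ^+ 2.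
  by rewrite !expr_div_n F_sqr; field; exact: lt0r_neq0.
by rewrite sqrtr_sqr ger0_norm// divr_ge0// ltW.
Unshelve. all: by end_near. Qed.

Let X (p : mR R * mR R) : R := Num.sqrt (a ^+ 2 + (p.1 ^+ 2 + p.2 ^+ 2)).

Let rt (r : R) : R := Num.sqrt (a ^+ 2 + r).

Let mrt : measurable_fun setT (rt : mR R -> mR R).
Proof.
apply: (@measurableT_comp _ _ _ _ _ _ (Num.sqrt : mR R -> mR R) _ (fun r : mR R => (a ^+ 2 + r : mR R))).
  by apply: continuous_measurable_fun; exact: sqrt_continuous.
exact: measurable_funD.
Qed.

Let mX : measurable_fun setT (X : mR R * mR R -> mR R).
Proof.
apply: (@measurableT_comp _ _ _ _ _ _ (rt : mR R -> mR R) _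
  (fun p : mR R * mR R => (p.1 ^+ 2 + p.2 ^+ 2 : mR R))) => //.
by apply: measurable_funD; apply: measurable_funX.
Qed.

Let X_ge p : a <= X p.
Proof.
rewrite -[leLHS]gtr0_norm// -sqrtr_sqr ler_wsqrtr// lerDl.
by rewrite addr_ge0// sqr_ge0.
Qed.

Let X_gt0 p : 0 < X p. Proof. exact: lt_le_trans (X_ge p). Qed.

Let measurable_inv_rt : measurable_fun setT (fun r : mR R => a / rt r : mR R).
Proof.
have -> : (fun r => a / rt r) = (fun r => a * rt r `^ (-1)).
  by apply/funext => r; rewrite powR_inv1// sqrtr_ge0.
apply: measurable_funM => //.
apply: (@measurableT_comp _ _ _ _ _ _ (fun x : mR R => x `^ (-1) : mR R) _ (rt : mR R -> mR R)) => //.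
Qed.

(** Substitute w = F u, so that dw = (u / F u) du and u^2 = w^2 - a^2. The acceptance probability a
    / F u supplies the denominator of this Jacobian, and what remains is a multiple of the normal
    density at w. *)
Let tail_integral (y : R) :
  (\int[lam]_(u in `[0%R, +oo[) (`|u| * (expR (- (u ^+ 2 / 2)) * (a / F u) * \1_`]y, +oo[ (F u)))%:E
  = (a * expR (a ^+ 2 / 2) / normal_peak 1)%:E * N01 `](Num.max y a), +oo[%classic)%E.
Proof.
set M := Num.max y a.
have Ma : a <= M by rewrite le_max lexx orbT.
have M0 : 0 < M by exact: lt_le_trans Ma.
(* The point where [F] reaches [M]: since [F] takes values above [a] only, a ray from [y] is cut at
   the larger of [y] and [a]. *)
pose u0 := Num.sqrt (M ^+ 2 - a ^+ 2).
have u00 : 0 <= u0 by exact: sqrtr_ge0.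
have u02 : u0 ^+ 2 = M ^+ 2 - a ^+ 2.
  by rewrite sqr_sqrtr// subr_ge0 ler_sqr ?nnegrE// ltW.
have Fu0 : F u0 = M by rewrite /F u02 addrC subrK sqrtr_sqr gtr0_norm.
have peak0 : 0 < normal_peak (1 : R) by rewrite normal_peak_gt0// oner_neq0.
have F_lt u v : 0 <= u -> u < v -> F u < F v.
  move=> uu uv; rewrite ltr_sqrt// ltrD2l ltr_sqr ?nnegrE//.
  by apply: le_trans uu (ltW uv).
pose g (u : R) : R := u * (expR (- (u ^+ 2 / 2)) * (a / F u)).
have cg : continuous g.
  move=> u; apply: cvgM; first exact: cvg_id.
  apply: cvgM; last by apply: cvgM; [exact: cvg_cst|apply: cvgV; [exact: lt0r_neq0|exact: F_continuous]].
  apply: continuous_comp; last exact: continuous_expR.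
  apply: cvgN; apply: cvgM; last exact: cvg_cst.
  exact: exprn_continuous.
have step1 : (\int[lam]_(u in `[0%R, +oo[) (`|u| * (expR (- (u ^+ 2 / 2)) * (a / F u) * \1_`]y, +oo[ (F u)))%:E
   = \int[lam]_(u in `[u0, +oo[) (g u)%:E)%E.
  have [ya|ay] := ltP y a.
    have u0E : u0 = 0 by rewrite /u0 /M max_r ?ltW// subrr sqrtr0.
    rewrite u0E; apply: eq_integral => u; rewrite inE/= in_itv/= andbT => uu.
    rewrite indicE mem_set ?mulr1 ?ger0_norm//= in_itv/= andbT.
    by apply: lt_le_trans ya _; rewrite -[leLHS]gtr0_norm// -sqrtr_sqr ler_wsqrtr// lerDl sqr_ge0.
  have My : M = y by rewrite /M max_l.
  rewrite -[in RHS]integral_itv_obnd_cbnd; last first.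
    by apply: measurable_funTS; apply/measurable_EFinP; exact: continuous_measurable_fun.
  rewrite [LHS]integral_mkcond [RHS]integral_mkcond; apply: eq_integral => u _.
  rewrite /patch !mem_setE !in_itv/= !andbT.
  have [uu|uu] := leP 0 u; last first.
    by case: ltP => // u0u; move: (lt_trans u0u uu); rewrite ltNge u00.
  rewrite indicE; case: ltP => u0u.
    rewrite mem_set ?mulr1 ?ger0_norm//= in_itv/= andbT -My -Fu0.
    exact: F_lt.
  rewrite memNset ?mulr0//= in_itv/= andbT -My -Fu0; apply/negP; rewrite -leNgt.
  by rewrite ler_wsqrtr// lerD2l ler_sqr ?nnegrE.
rewrite step1.
pose G (w : R) : R := a * expR (a ^+ 2 / 2) / normal_peak 1 * normal_pdf 0 1 w.
have cG : continuous G.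
  by move=> w; apply: cvgM; [exact: cvg_cst|apply: continuous_normal_pdf; exact: oner_neq0].
transitivity (\int[lam]_(w in `[F u0, +oo[) (G w)%:E)%E.
  rewrite (@increasing_ge0_integration_by_substitutiony R F G u0); first last.
  - move=> w _; rewrite /G mulr_ge0 ?normal_pdf_ge0// divr_ge0 ?ltW// mulr_gt0 ?expR_gt0//.
  - exact: continuous_subspaceT.
  - exact: F_cvg.
  - split; first by move=> u _; have [] := F_is_derive u.
    by apply: cvg_at_right_filter; exact: F_continuous.
  - by rewrite F_derive1; exact: dF_cvg.
  - rewrite F_derive1; apply/cvg_ex; exists (u0 / F u0).
    by apply: cvg_at_right_filter; exact: dF_continuous.
  - by rewrite F_derive1 => u _; exact: dF_continuous.
  - move=> u v; rewrite !in_itv/= !andbT => hu hv; apply: F_lt.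
    exact: le_trans hu.
  apply: eq_integral => u _; congr EFin; rewrite F_derive1 /g /G /= !fctE.
  rewrite normal_pdf01E F_sqr mulrDl opprD expRD.
  have e1 : expR (a ^+ 2 / 2) * expR (- (a ^+ 2 / 2)) = 1 by rewrite -expRD subrr expR0.
  transitivity (u * a / F u * expR (- (u ^+ 2 / 2)) * (expR (a ^+ 2 / 2) * expR (- (a ^+ 2 / 2)))).
    by rewrite e1; ring.
  by field; rewrite !gt_eqF.
rewrite Fu0 /G; under eq_integral do rewrite EFinM.
rewrite ge0_integralZl//; last 3 first.
- by apply: measurable_funTS; exact: measurable_pdf01.
- by move=> w _; rewrite lee_fin normal_pdf_ge0.
- by rewrite lee_fin divr_ge0 ?ltW// mulr_gt0 ?expR_gt0.
congr *%E; rewrite -integral_itv_obnd_cbnd//.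
by apply: measurable_funTS; exact: measurable_pdf01.
Qed.

(** The integrand depends on the radius alone, so [integral_polar] splits off the angular factor.
    The factor 2 comes from the two signs of the radius. *)
Let radial_ray (y : R) :
  (\int[N01]_u \int[N01]_v ((a / X (u, v))%:E * (\1_`]y, +oo[ (X (u, v)))%:E) =
   (\int[lam]_t ((1 + t ^+ 2)^-1)%:E) *
   ((normal_peak 1 ^+ 2)%:E * (2%:E *
     ((a * expR (a ^+ 2 / 2) / normal_peak 1)%:E * N01 `](Num.max y a), +oo[%classic))))%E.
Proof.
pose w (r : mR R) : R := expR (- (r / 2)) * (a / rt r) * \1_`]y, +oo[ (rt r).
have mw : measurable_fun setT (w : mR R -> mR R).
  apply: measurable_funM.
    apply: measurable_funM => //.
    apply: measurableT_comp => //; apply: measurableT_comp => //; exact: measurable_funM.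
  apply: (@measurableT_comp _ _ _ _ _ _ (\1_`]y, +oo[ : mR R -> mR R) _ (rt : mR R -> mR R)) => //.
have w0 r : 0 <= w r.
  by rewrite /w !mulr_ge0 ?expR_ge0// ?invr_ge0 ?sqrtr_ge0// ltW.
have mwE : measurable_fun setT (fun r : mR R => (w r)%:E) by exact/measurable_EFinP.
pose K (p : mR R * mR R) := ((a / X p)%:E * (\1_`]y, +oo[ (X p))%:E)%E.
have mK : measurable_fun setT K.
  apply: emeasurable_funM; apply/measurable_EFinP.
    apply: (@measurableT_comp _ _ _ _ _ _ (fun r : mR R => a / rt r : mR R) _
      (fun p : mR R * mR R => (p.1 ^+ 2 + p.2 ^+ 2 : mR R))) => //.
    by apply: measurable_funD; apply: measurable_funX.
  apply: (@measurableT_comp _ _ _ _ _ _ (\1_`]y, +oo[ : mR R -> mR R) _ (X : mR R * mR R -> mR R)) => //.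
have K0 p : (0 <= K p)%E.
  by rewrite mule_ge0// lee_fin// divr_ge0 ?ltW.
apply: etrans (integral_gauss2 mK K0) _.
pose h (r : mR R) := ((normal_peak 1 ^+ 2)%:E * (w r)%:E)%E.
have mh : measurable_fun setT h by apply: emeasurable_funM.
have h0 r : (0 <= h r)%E by rewrite mule_ge0// lee_fin// exprn_ge0// normal_peak_ge0.
transitivity (\int[lam]_u \int[lam]_v h (u ^+ 2 + v ^+ 2)%R)%E.
  apply: eq_integral => u _; apply: eq_integral => v _.
  rewrite /K /h /w -!EFinM -[rt _]/(X (u, v)) /=; congr EFin; ring.
rewrite (integral_polar mh h0); congr (_ * _)%E.
pose f (u : mR R) := (`|u|%:E * (w (u ^+ 2))%:E)%E.
have mf : measurable_fun setT f.
  apply: emeasurable_funM; first by apply/measurable_EFinP; first [exact: measurable_normr | exact: normr_measurable].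
  apply: (@measurableT_comp _ _ _ _ _ _ (fun r : mR R => (w r)%:E) _ (fun u : mR R => (u ^+ 2 : mR R))) => //.
have f0 u : (0 <= f u)%E by rewrite mule_ge0// lee_fin.
transitivity ((normal_peak 1 ^+ 2)%:E * \int[lam]_u f u)%E.
  rewrite -ge0_integralZl//; last by rewrite lee_fin exprn_ge0// normal_peak_ge0.
  by apply: eq_integral => u _; rewrite /h /f muleCA.
congr (_ * _)%E.
have split0 : (\int[lam]_u f u = \int[lam]_(u in `]-oo, 0%R[) f u + \int[lam]_(u in `[0%R, +oo[) f u)%E.
  rewrite -ge0_integral_setU//=.
  - by congr (integral _ _ _); apply/seteqP; split => // u _ /=; rewrite !in_itv/= andbT; case: ltP; [left|right].
  - exact: measurable_funTS.
  - apply/disj_setPS => u /= []; rewrite !in_itv/= andbT => h1 h2.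
    by move: (lt_le_trans h1 h2); rewrite ltxx.
have neg : (\int[lam]_(u in `]-oo, 0%R[) f u = \int[lam]_(u in `[0%R, +oo[) f u)%E.
  rewrite (integral_itv_bndo_bndc (a := -oo%O)); last exact: measurable_funTS.
  rewrite (ge0_integration_by_substitution0 mf f0); apply: eq_integral => u _.
  by rewrite /f normrN sqrrN.
rewrite split0 neg; transitivity ((1 + 1)%:E * \int[lam]_(u in `[0%R, +oo[) f u)%E.
  by rewrite EFinD ge0_muleDl ?lee01// mul1e.
congr (_ * _)%E; rewrite -tail_integral; apply: eq_integral => u _.
by rewrite /f /w -EFinM.
Qed.

Lemma measurable_radius :
  measurable_fun setT (fun p : mR R * mR R => Num.sqrt (a ^+ 2 + (p.1 ^+ 2 + p.2 ^+ 2)) : mR R).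
Proof. exact: mX. Qed.

Lemma measurable_inv_radius :
  measurable_fun setT (fun p : mR R * mR R => a / Num.sqrt (a ^+ 2 + (p.1 ^+ 2 + p.2 ^+ 2)) : mR R).
Proof.
apply: (@measurableT_comp _ _ _ _ _ _ (fun r : mR R => a / rt r : mR R) _
  (fun p : mR R * mR R => (p.1 ^+ 2 + p.2 ^+ 2 : mR R))) => //.
by apply: measurable_funD; apply: measurable_funX.
Qed.

(** By [radial_ray], the law of the radius weighted by its acceptance probability and the normal law
    cut at [a] are proportional on open rays, hence on all Borel sets by [measure_eq_rays]. *)
Lemma marsaglia_rejection : exists2 c : R, 0 < c & forall G : mR R -> \bar R,
  measurable_fun setT G -> (forall x, 0 <= G x)%E ->
  (\int[N01]_u \int[N01]_v ((a / Num.sqrt (a ^+ 2 + (u ^+ 2 + v ^+ 2)))%:E *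
      G (Num.sqrt (a ^+ 2 + (u ^+ 2 + v ^+ 2))))
   = c%:E * \int[N01]_t ((\1_`]a, +oo[ t)%:E * G t))%E.
Proof.
pose NN := ((normal_prob 0 1 : {measure set (mR R) -> \bar R}) \x (normal_prob 0 1 : {sigma_finite_measure set (mR R) -> \bar R}))%E.
pose w (p : mR R * mR R) := (a / X p)%:E.
have mw : measurable_fun setT w.
  by apply/measurable_EFinP; exact: measurable_inv_radius.
have w0 p : (0 < w p)%E by rewrite lte_fin divr_gt0.
have w0' p : (0 <= w p)%E by exact: ltW.
have [nu0 nu0E] := density_measure NN mw w0'.
pose nu := measure_function_pushforward__canonical__measure_function_Measure nu0 mX.
have nuG (G : mR R -> \bar R) : measurable_fun setT G -> (forall x, 0 <= G x)%E ->
    (\int[nu]_t G t = \int[N01]_u \int[N01]_v ((a / X (u, v))%:E * G (X (u, v))))%E.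
  move=> mG G0.
  have mGX : measurable_fun setT (fun p => G (X p)).
    exact: (@measurableT_comp _ _ _ _ _ _ G _ (X : mR R * mR R -> mR R)).
  transitivity (\int[nu0]_p G (X p))%E.
    exact: (ge0_integral_pushforward mX nu0 measurableT mG (fun _ _ => G0 _)).
  rewrite (ge0_integral_density (mu := NN) (w := w))//; last first.
  apply: etrans (fubini_tonelli1 (fun p => G (X p) * w p)%E _ _) _.
  - exact: emeasurable_funM.
  - by move=> p; rewrite mule_ge0.
  by apply: eq_integral => u _; apply: eq_integral => v _; rewrite muleC.
have indicE' (m : {measure set (mR R) -> \bar R}) (B : set (mR R)) : measurable B ->
    (\int[m]_t (\1_B t)%:E = m B)%E by move=> mB; rewrite integral_indic// setIT.
have nuB (B : set (mR R)) : measurable B ->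
    (nu B = \int[N01]_u \int[N01]_v ((a / X (u, v))%:E * (\1_B (X (u, v)))%:E))%E.
  by move=> mB; rewrite -indicE'// nuG//; exact: measurable_EFin_indic.
pose kap := ((\int[lam]_t ((1 + t ^+ 2)^-1)%:E) *
   ((normal_peak 1 ^+ 2)%:E * (2%:E * (a * expR (a ^+ 2 / 2) / normal_peak 1)%:E)))%E.
have kap0 : (0 <= kap)%E.
  rewrite /kap !mule_ge0//.
  - by apply: integral_ge0 => t _; rewrite lee_fin invr_ge0 addr_ge0// sqr_ge0.
  - by rewrite lee_fin exprn_ge0// normal_peak_ge0.
  - by rewrite lee_fin divr_ge0 ?normal_peak_ge0// mulr_ge0 ?expR_ge0// ltW.
have nu_ray (y : R) : (nu `]y, +oo[%classic = kap * N01 `](Num.max y a), +oo[%classic)%E.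
  by rewrite nuB// radial_ray /kap !muleA.
pose q := 1 - Phi a.
have q0 : 0 < q by rewrite subr_gt0 normal_cdf_lt1.
have rayE (y : R) : N01 `]y, +oo[%classic = (1 - Phi y)%:E.
  by rewrite -normal_gt; congr (N01 _); apply/seteqP; split => z /=; rewrite in_itv/= andbT.
(* The radius is at least [a], so the ray from [a - 1] carries the whole mass of [nu]. *)
have nuT : (nu setT = kap * q%:E)%E.
  have mx : Num.max (a - 1) a = a by apply/max_idPr; rewrite gerBl.
  have := nu_ray (a - 1); rewrite mx rayE => <-.
  apply: etrans (nuB _ measurableT) (esym (etrans (nuB _ (measurable_itv _)) _)).
  apply: eq_integral => u _; apply: eq_integral => v _.
  rewrite !indicE !mem_set//= in_itv/= andbT.
  by apply: lt_le_trans (X_ge _); rewrite ltrBlDr ltrDl.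
have nuTE : (nu setT = \int[N01]_u \int[N01]_v w (u, v))%E.
  apply: etrans (nuB _ measurableT) _.
  apply: eq_integral => u _; apply: eq_integral => v _.
  by rewrite indicE mem_set// mule1.
have nuT1 : (nu setT <= 1%:E)%E.
  rewrite nuTE; apply: (integral_le_cst (normal_prob 0 1)) => u.
  apply: (integral_le_cst (normal_prob 0 1)) => v.
  by rewrite lee_fin ler_pdivrMr// mul1r.
have nuT0 : (0 < nu setT)%E.
  rewrite nuTE; apply: (integral_gt0 (normal_prob 0 1)).
    exact: (measurable_fun_fubini_tonelli_F w mw w0').
  move=> u; apply: (integral_gt0 (normal_prob 0 1)) => //.
  exact: (measurable_section mw).
(* [kap] contains the unevaluated angular integral. The total mass of [nu] is positive and at most
   1, which forces [kap] to be a positive real. *)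
have [c c0 kapE] : exists2 c : R, 0 < c & kap = c%:E.
  move: kap0 nuT; case: (kap) => [c|//|//]; last first.
    move=> _ h; move: nuT1; rewrite h gt0_mulye ?lte_fin//.
  move=> c0 h; exists c => //; rewrite -(pmulr_lgt0 _ q0) -lte_fin EFinM -h.
  exact: nuT0.
have mind : measurable_fun setT (fun t : mR R => (c * \1_`]a, +oo[ t)%:E).
  by apply/measurable_EFinP; apply: measurable_funM.
have ind0 (t : mR R) : (0 <= (c * \1_`]a, +oo[ t)%:E)%E by rewrite lee_fin mulr_ge0// ltW.
have [mu2 mu2E] := density_measure (normal_prob 0 1 : {measure set (mR R) -> \bar R}) mind ind0.
have mu2_ray (y : R) : (mu2 `]y, +oo[%classic = c%:E * N01 `](Num.max y a), +oo[%classic)%E.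
  rewrite mu2E integral_mkcond.
  transitivity (\int[N01]_t (c%:E * (\1_`](Num.max y a), +oo[ t)%:E))%E.
    apply: eq_integral => t _; rewrite epatch_indic -!EFinM; congr EFin.
    rewrite !indicE !mem_setE !in_itv/= !andbT gt_max.
    by case: (y < t); case: (a < t); rewrite ?mulr1 ?mulr0.
  by rewrite ge0_integralZl ?indicE' ?lee_fin ?ltW//; exact: measurable_EFin_indic.
have nu_mu2 A : measurable A -> nu A = mu2 A.
  apply: measure_eq_rays; first exact: le_lt_trans nuT1 (ltry _).
  by move=> y; rewrite nu_ray mu2_ray kapE.
exists c => // G mG G0.
rewrite -[LHS](nuG G mG G0).
transitivity (\int[mu2]_t G t)%E; first by apply: eq_measure_integral => A mA _; exact: nu_mu2.
rewrite (ge0_integral_density (mu := (normal_prob 0 1 : {measure set (mR R) -> \bar R})) mind)//.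
rewrite -ge0_integralZl//.
- by apply: eq_integral => t _; rewrite muleC EFinM muleA.
- by apply: emeasurable_funM => //; exact: measurable_EFin_indic.
- by move=> t _; rewrite mule_ge0// lee_fin.
- by rewrite lee_fin ltW.
Qed.

End Marsaglia.

(** For fixed [u] and [v] the acceptance probability increases with [a], so the rate at [a = 1] is a
    lower bound for all larger thresholds. *)
Lemma marsaglia_accept (R : realType) : exists2 p0 : R, 0 < p0 & forall a : R, 1 <= a ->
  (p0%:E <= \int[normal_prob 0 1]_u \int[normal_prob 0 1]_v
    (a / Num.sqrt (a ^+ 2 + (u ^+ 2 + v ^+ 2)))%:E)%E.
Proof.
pose w (p : mR R * mR R) := (1 / Num.sqrt (1 ^+ 2 + (p.1 ^+ 2 + p.2 ^+ 2)))%:E.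
have rad0 (b : R) u v : 1 <= b -> 0 < b ^+ 2 + (u ^+ 2 + v ^+ 2) :> R.
  by move=> b1; rewrite ltr_pwDl ?exprn_gt0 ?addr_ge0 ?sqr_ge0//; exact: lt_le_trans b1.
have mw : measurable_fun setT w by apply/measurable_EFinP; exact: measurable_inv_radius.
have w0 p : (0 < w p)%E by rewrite lte_fin divr_gt0// sqrtr_gt0 rad0.
have I0 : (0 < \int[normal_prob 0 1]_u \int[normal_prob 0 1]_v w (u, v))%E.
  apply: (integral_gt0 (normal_prob 0 1)).
    exact: (measurable_fun_fubini_tonelli_F w mw (fun p => ltW (w0 p))).
  move=> u; apply: (integral_gt0 (normal_prob 0 1)) => //.
  exact: (measurable_section mw).
have I1 : (\int[normal_prob 0 1]_u \int[normal_prob 0 1]_v w (u, v) <= 1%:E)%E.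
  apply: (integral_le_cst (normal_prob 0 1)) => u.
  apply: (integral_le_cst (normal_prob 0 1)) => v.
  rewrite lee_fin ler_pdivrMr ?sqrtr_gt0 ?rad0// mul1r -[leLHS]sqrtr1 ler_wsqrtr//.
  by rewrite expr1n lerDl addr_ge0// sqr_ge0.
have Ifin : (\int[normal_prob 0 1]_u \int[normal_prob 0 1]_v w (u, v))%E \is a fin_num.
  by rewrite ge0_fin_numE ?ltW//; exact: le_lt_trans I1 (ltry _).
exists (fine (\int[normal_prob 0 1]_u \int[normal_prob 0 1]_v w (u, v))%E).
  by rewrite -lte_fin fineK; [exact: I0|exact: Ifin].
move=> a a1; rewrite fineK; last exact: Ifin.
apply: (le_integral_nomeas (normal_prob 0 1)) => u.
apply: (le_integral_nomeas (normal_prob 0 1)) => v.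
have a0 : 0 < a by exact: lt_le_trans a1.
rewrite lee_fin ler_pdivrMr ?sqrtr_gt0 ?rad0// mulrAC ler_pdivlMr ?sqrtr_gt0 ?rad0// mul1r.
rewrite -[X in X * _]gtr0_norm// -sqrtr_sqr -sqrtrM ?sqr_ge0// ler_wsqrtr//.
rewrite mulrDr expr1n mulr1 lerD2l ler_peMl ?addr_ge0 ?sqr_ge0//.
by rewrite exprn_ege1.
Qed.

(** * Sums of discrete variables *)

Section DiscreteIid.
Context {R : realType} {I : finType} (q val : I -> R).

(* [dexp n F a] is the expectation of [F (a + V_1 + ... + V_n)], the [V_i] being
   independent and equal to [val v] with probability [q v]. *)
Fixpoint dexp (n : nat) (F : R -> R) (a : R) : R :=
  if n is n'.+1 then \sum_v q v * dexp n' F (a + val v) else F a.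

Hypotheses (q0 : forall v, 0 <= q v) (q1 : \sum_v q v = 1).

Lemma dexp_mono n (F G : R -> R) a :
  (forall y, F y <= G y) -> dexp n F a <= dexp n G a.
Proof.
move=> FG; elim: n a => [|n IH] a /=; first exact: FG.
by apply: ler_sum => v _; rewrite ler_wpM2l.
Qed.

Lemma dexp_cst n c a : dexp n (fun=> c) a = c.
Proof.
elim: n a => // n IH a /=.
by under eq_bigr do rewrite IH; rewrite -mulr_suml q1 mul1r.
Qed.

Lemma dexp_ge0 n F a : (forall y, 0 <= F y) -> 0 <= dexp n F a.
Proof. by move=> F0; rewrite -[leLHS](dexp_cst n 0 a); exact: dexp_mono. Qed.

Let w := \sum_v q v * val v.
Let V := \sum_v q v * (val v - w) ^+ 2.

(** Mean and variance of the sum, packed into the one family of test functions that Chebyshev's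
    inequality needs: the sum has mean [a + n%:R * w] and variance [n%:R * V]. *)
Lemma dexp_sqr n (c k m a : R) :
  dexp n (fun y => c - k * (y - m) ^+ 2) a
  = c - k * ((a + n%:R * w - m) ^+ 2 + n%:R * V).
Proof.
elim: n a => [|n IH] a /=; first by rewrite !mul0r !addr0.
under eq_bigr do rewrite IH.
set b := a + n.+1%:R * w - m.
transitivity (\sum_v ((c - k * (b ^+ 2 + n%:R * V)) * q v
   - 2 * k * b * (q v * val v - q v * w) - k * (q v * (val v - w) ^+ 2))).
  by apply: eq_bigr => v _; rewrite /b -[n.+1%:R]natr1; ring.
rewrite !big_split/= -mulr_sumr q1 sumrN -mulr_sumr sumrN -mulr_sumr big_split/= sumrN.
rewrite -mulr_suml q1 mul1r subrr mulr0 subr0 mulr1 -/V -[n.+1%:R in RHS]natr1.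
by ring.
Qed.

Lemma variance_le (K : R) : (forall v, 0 <= val v <= K) -> V <= K ^+ 2.
Proof.
move=> vK; have -> : V = \sum_v q v * val v ^+ 2 - w ^+ 2.
  transitivity (\sum_v (q v * val v ^+ 2 - 2 * w * (q v * val v) + w ^+ 2 * q v)).
    by apply: eq_bigr => v _; ring.
  by rewrite !big_split/= sumrN -!mulr_sumr q1 -/w; ring.
rewrite lerBlDr (le_trans (y := \sum_v q v * K ^+ 2))//.
  apply: ler_sum => v _; rewrite ler_wpM2l// ler_sqr ?nnegrE.
  - by have /andP[] := vK v.
  - by have /andP[] := vK v.
  - by have /andP[] := vK v; exact: le_trans.
by rewrite -mulr_suml q1 mul1r lerDl sqr_ge0.
Qed.

(** The downward parabola that is 1 at the mean and 0 at distance [n%:R * (eps * w)] lies below the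
    indicator of the event; [dexp_sqr] gives its expectation. *)
Lemma dexp_chebyshev n (eps : R) : (0 < n)%N -> 0 < eps -> 0 < w ->
  1 - V / (n%:R * (eps * w) ^+ 2) <=
  dexp n (fun y => (`|n%:R^-1 * y - w| <= eps * w)%R%:R) 0.
Proof.
move=> n0 e0 w0; have nR : 0 < n%:R :> R by rewrite ltr0n.
have ew : 0 < eps * w by rewrite mulr_gt0.
pose k := (n%:R * (eps * w)) ^- 2.
have -> : 1 - V / (n%:R * (eps * w) ^+ 2) =
    dexp n (fun y => 1 - k * (y - n%:R * w) ^+ 2) 0.
  rewrite dexp_sqr add0r subrr expr0n add0r /k; field.
  by rewrite !gt_eqF.
apply: dexp_mono => y; case: (leP `|n%:R^-1 * y - w| (eps * w)) => [_|h]/=.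
  by rewrite gerBl mulr_ge0 ?sqr_ge0// invr_ge0 sqr_ge0.
rewrite subr_le0 /k -[leLHS](mulVf (x := (n%:R * (eps * w)) ^+ 2)) ?expf_neq0 ?gt_eqF ?mulr_gt0//.
rewrite ler_pM2l ?invr_gt0 ?exprn_gt0 ?mulr_gt0//.
have -> : y - n%:R * w = n%:R * (n%:R^-1 * y - w) by field; rewrite gt_eqF.
rewrite -[leRHS]real_normK ?num_real// normrM gtr0_norm//.
apply: lerXn2r; rewrite ?nnegrE; [exact/ltW/mulr_gt0|exact: mulr_ge0|].
by rewrite ler_pM2l// ltW.
Qed.

End DiscreteIid.

(** * Triangular factors of the covariance *)

Section Rotat.
Context {R : realType}.

(** A Givens rotation of neighbouring entries only: in [iid_expect] these are two consecutive
    integrals, so the draws never have to be permuted. *)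
Fixpoint rotat (j : nat) (c s : R) (z : seq R) : seq R :=
  match j, z with
  | 0, x :: y :: z' => (c * x - s * y) :: (s * x + c * y) :: z'
  | j'.+1, x :: z' => x :: rotat j' c s z'
  | _, _ => z
  end.

Lemma nth_rotat j c s z l : (j.+1 < size z)%N ->
  (rotat j c s z)`_l =
    if l == j then c * z`_j - s * z`_j.+1
    else if l == j.+1 then s * z`_j + c * z`_j.+1 else z`_l.
Proof.
elim: j z l => [|j IH] [|x z] l //=.
  by case: z => // y z _; case: l => [|[|l]].
by move=> jz; case: l => [|l] //=; rewrite IH.
Qed.

(** The action on coefficients adjoint to [rotat]: by [sum_rotcol], rotating the draws amounts to
    rotating two columns. *)
Definition rotcol {I : Type} (j : nat) (c s : R) (A : I -> nat -> R) (i : I) (l : nat) : R :=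
  if l == j then c * A i j + s * A i j.+1
  else if l == j.+1 then - s * A i j + c * A i j.+1 else A i l.

Lemma sum_split2 (F : nat -> R) k j : (j.+1 < k)%N ->
  \sum_(l < k) F l = F j + F j.+1 + \sum_(l < k | (l != j :> nat) && (l != j.+1 :> nat)) F l.
Proof.
move=> jk; have jk' : (j < k)%N by exact: ltnW.
rewrite (bigD1 (Ordinal jk'))//= (bigD1 (Ordinal jk))/=; last first.
  by rewrite -val_eqE/= gtn_eqF.
by rewrite addrA.
Qed.

Lemma sum_rotcol {I : Type} (A : I -> nat -> R) i k j c s z :
  (j.+1 < k)%N -> size z = k ->
  \sum_(l < k) A i l * (rotat j c s z)`_l = \sum_(l < k) rotcol j c s A i l * z`_l.
Proof.
move=> jk sz; rewrite (sum_split2 (fun l => A i l * (rotat j c s z)`_l) jk).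
rewrite (sum_split2 (fun l => rotcol j c s A i l * z`_l) jk); congr (_ + _).
  rewrite !nth_rotat ?sz// /rotcol !eqxx gtn_eqF//=; ring.
apply: eq_bigr => l /andP[l1 l2].
by rewrite nth_rotat ?sz// /rotcol (negbTE l1) (negbTE l2).
Qed.

Lemma gram_rotcol {I : Type} (A : I -> nat -> R) i i' k j c s :
  (j.+1 < k)%N -> c ^+ 2 + s ^+ 2 = 1 ->
  \sum_(l < k) rotcol j c s A i l * rotcol j c s A i' l = \sum_(l < k) A i l * A i' l.
Proof.
move=> jk cs; rewrite (sum_split2 (fun l => A i l * A i' l) jk).
rewrite (sum_split2 (fun l => rotcol j c s A i l * rotcol j c s A i' l) jk); congr (_ + _).
  rewrite /rotcol !eqxx gtn_eqF//=.
  transitivity ((c ^+ 2 + s ^+ 2) * (A i j * A i' j + A i j.+1 * A i' j.+1)); first by ring.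
  by rewrite cs mul1r.
by apply: eq_bigr => l /andP[l1 l2]; rewrite /rotcol (negbTE l1) (negbTE l2).
Qed.

(* Any property of [A] preserved by adjacent column rotations holds, in
   particular, for some lower triangular form of [A]. *)
Section LQ.
Context {I : Type} (k : nat) (E : (I -> nat -> R) -> Prop).
Hypothesis E_rot : forall A j c s, (j.+1 < k)%N -> c ^+ 2 + s ^+ 2 = 1 ->
  E A -> E (rotcol j c s A).

(** Row [r] is cleared from the right, each entry being rotated into its left neighbour, which
    becomes the norm of the pair and thus nonnegative. Rows treated before vanish in all columns
    involved. Without any rotation ([d = 0]) the sign of the diagonal entry is not controlled. *)
Lemma lq_row (A : I -> nat -> R) (r : I) (p d : nat) (o : nat -> I) :
  E A -> (p + d).+1 = k ->
  (forall a l, (a < p)%N -> (a < l < k)%N -> A (o a) l = 0) ->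
  (forall a, (a < p)%N -> 0 <= A (o a) a) ->
  exists B, [/\ E B,
    (forall a l, (a < p)%N -> (a < l < k)%N -> B (o a) l = 0),
    (forall a, (a < p)%N -> 0 <= B (o a) a),
    (forall l, (p < l < k)%N -> B r l = 0) & ((0 < d)%N -> 0 <= B r p)].
Proof.
move=> EA pdk A0 Ad.
suff H e : (e <= d)%N -> exists B, [/\ E B,
    (forall a l, (a < p)%N -> (a < l < k)%N -> B (o a) l = 0),
    (forall a, (a < p)%N -> 0 <= B (o a) a),
    (forall l, (p + (d - e) < l < k)%N -> B r l = 0) &
    ((0 < e)%N -> 0 <= B r (p + (d - e))%N)].
  have [B [h1 h2 h3]] := H d (leqnn d).
  by rewrite subnn addn0 => h4 h5; exists B.
elim: e => [_|e IH ed].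
  exists A; split => // l; rewrite subn0 -pdk ltnS => /andP[h1 h2].
  by move: (leq_trans h1 h2); rewrite ltnn.
have [B [EB B0 Bd Br Bp]] := IH (ltnW ed).
have dE : (d - e = (d - e.+1).+1)%N by rewrite subnSK.
set j := (p + (d - e.+1))%N.
have jk : (j.+1 < k)%N by rewrite -pdk /j ltnS -addnS -dE leq_add2l leq_subr.
rewrite dE addnS -/j in Br Bp.
(* If both entries are 0 the rotation would divide by 0, but nothing has to be done. *)
have [/eqP|rho0] := eqVneq (B r j ^+ 2 + B r j.+1 ^+ 2) 0.
  rewrite paddr_eq0 ?sqr_ge0// !sqrf_eq0 => /andP[/eqP b1 /eqP b2].
  exists B; split => //; last by rewrite b1.
  move=> l /andP[jl lk]; have [->//|lj] := eqVneq l j.+1.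
  by apply: Br; rewrite lk andbT ltn_neqAle eq_sym lj.
set rho := Num.sqrt (B r j ^+ 2 + B r j.+1 ^+ 2).
have rho2 : rho ^+ 2 = B r j ^+ 2 + B r j.+1 ^+ 2.
  by rewrite sqr_sqrtr// addr_ge0// sqr_ge0.
have rhop : 0 < rho by rewrite sqrtr_gt0 lt_neqAle eq_sym rho0 addr_ge0// sqr_ge0.
have rhon : rho != 0 by rewrite gt_eqF.
have cs : (B r j / rho) ^+ 2 + (B r j.+1 / rho) ^+ 2 = 1.
  by rewrite !expr_div_n -mulrDl rho2 divff.
exists (rotcol j (B r j / rho) (B r j.+1 / rho) B); split.
- exact: E_rot.
- move=> a l ap /andP[al lk]; rewrite /rotcol.
  have aj : (a < j)%N by exact: leq_trans ap (leq_addr _ _).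
  rewrite !(B0 a)// ?mulr0 ?addr0 ?if_same ?al ?aj ?(ltnW jk) ?jk ?(ltnW aj)//.
  by rewrite ltnS ltnW.
- move=> a ap; rewrite /rotcol.
  have aj : (a < j)%N by exact: leq_trans ap (leq_addr _ _).
  by rewrite !ltn_eqF//; [exact: Bd|rewrite ltnS ltnW].
- move=> l /andP[jl lk]; rewrite /rotcol gtn_eqF//.
  have [_|lj] := eqVneq l j.+1; first by rewrite mulNr; ring.
  by apply: Br; rewrite lk andbT ltn_neqAle eq_sym lj.
- move=> _; rewrite /rotcol eqxx.
  have -> : B r j / rho * B r j + B r j.+1 / rho * B r j.+1 = rho ^+ 2 / rho.
    by rewrite rho2; ring.
  by rewrite expr2 mulfK// ltW.
Qed.

(** As [p < k], every treated row has a column to the right of its diagonal, so at least one step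
    makes the diagonal entry nonnegative. *)
Lemma lq (A : I -> nat -> R) (o : nat -> I) (p : nat) :
  E A -> (p < k)%N ->
  exists B, [/\ E B, (forall a l, (a < p)%N -> (a < l < k)%N -> B (o a) l = 0) &
    (forall a, (a < p)%N -> 0 <= B (o a) a)].
Proof.
move=> EA; elim: p => [_|p IH pk]; first by exists A.
have [B [EB B0 Bd]] := IH (ltnW pk).
have pdk : (p + (k - p.+1)).+1 = k by rewrite -addSn subnKC// ltnW.
have [C [EC C0 Cd Cr Cp]] := lq_row (o p) EB pdk B0 Bd.
exists C; split => //.
- move=> a l; rewrite ltnS leq_eqVlt => /orP[/eqP ->|ap]; [exact: Cr|exact: C0].
- move=> a; rewrite ltnS leq_eqVlt => /orP[/eqP ->|ap]; last exact: Cd.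
  by apply: Cp; rewrite subn_gt0.
Qed.

End LQ.
End Rotat.

Section IidRotation.
Context {R : realType}.
Local Open Scope ereal_scope.
Local Notation N01 := (normal_prob 0 1 : set (mR R) -> \bar R).

Lemma measurable_tnth_seq n (l : nat) :
  measurable_fun setT (fun t : n.-tuple (mR R) => (t : seq R)`_l : mR R).
Proof.
have [ln|nl] := ltnP l n.
  rewrite (_ : (fun _ => _) = (fun t : n.-tuple (mR R) => tnth t (Ordinal ln))).
    exact: measurable_tnth.
  by apply/funext => t; rewrite (tnth_nth 0%R).
rewrite (_ : (fun _ => _) = cst 0%R)//.
by apply/funext => t; rewrite nth_default// size_tuple.
Qed.

(** The draws before position [j] are kept fixed; the draws after the rotated pair are integrated
    out first, which leaves a function on the plane for [gauss_rotation]. *)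
Lemma iid_rotation k j (c s : R) (H : seq R -> \bar R) :
  (forall z, 0 <= H z) ->
  measurable_fun setT (fun t : k.-tuple (mR R) => H t) ->
  (j.+1 < k)%N -> (c ^+ 2 + s ^+ 2 = 1)%R ->
  iid_expect N01 k (fun z => H (rotat j c s z)) = iid_expect N01 k H.
Proof.
elim: j k H => [|j IH] [|k] H H0 mH //=; last first.
  move=> jk cs; apply: eq_integral => x _.
  by apply: (IH k (fun z => H (x :: z))) => //; exact: (measurable_tail_cons (T := mR R)).
case: k mH => [//|k] mH _ cs /=.
pose K (p : mR R * mR R) := iid_expect N01 k (fun z => H [:: p.1, p.2 & z]).
have mK : measurable_fun setT K.
  apply: (@measurable_iid_expect _ _ _ _ k _ _ (fun (p : mR R * mR R) z => H [:: p.1, p.2 & z])) => //.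
  apply: (@measurableT_comp _ _ _ _ _ _ (fun t : k.+2.-tuple (mR R) => H t)
    _ (fun q : (mR R * mR R) * k.-tuple (mR R) =>
         [the k.+2.-tuple (mR R) of q.1.1 :: [the k.+1.-tuple (mR R) of q.1.2 :: q.2]])) => //.
  apply: measurable_cons; first exact: (measurableT_comp measurable_fst measurable_fst).
  by apply: measurable_cons => //; exact: (measurableT_comp measurable_snd measurable_fst).
by apply: (gauss_rotation mK _ cs) => p; exact: iid_expect_ge0.
Qed.

Definition lin {I : Type} (A : I -> nat -> R) (k : nat) (z : seq R) (i : I) : R :=
  (\sum_(l < k) A i l * z`_l)%R.

Definition lin_tuple {M : nat} (mu : 'I_M -> R) (A : 'I_M -> nat -> R) (k : nat) (z : seq R) :
  M.-tuple (mR R) := [tuple mu i + lin A k z i | i < M]%R.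

Lemma measurable_lin_tuple M (mu : 'I_M -> R) A k :
  measurable_fun setT (fun t : k.-tuple (mR R) => lin_tuple mu A k t).
Proof.
apply/measurable_fun_tnthP => i /=.
rewrite (_ : _ \o _ = fun t : k.-tuple (mR R) => (mu i + lin A k t i)%R); last first.
  by apply/funext => t /=; rewrite tnth_mktuple.
apply: measurable_funD => //; apply: measurable_sum => l.
by apply: measurable_funM => //; exact: measurable_tnth_seq.
Qed.

Definition same_law {M : nat} (mu : 'I_M -> R) (k : nat) (A B : 'I_M -> nat -> R) : Prop :=
  forall Psi : M.-tuple (mR R) -> \bar R, (forall x, 0 <= Psi x) ->
    measurable_fun setT Psi ->
    iid_expect N01 k (fun z => Psi (lin_tuple mu A k z))
    = iid_expect N01 k (fun z => Psi (lin_tuple mu B k z)).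

Lemma same_law_rotcol M (mu : 'I_M -> R) k j c s (A : 'I_M -> nat -> R) :
  (j.+1 < k)%N -> (c ^+ 2 + s ^+ 2 = 1)%R -> same_law mu k A (rotcol j c s A).
Proof.
move=> jk cs Psi Psi0 mPsi.
rewrite -(iid_rotation (j := j) (c := c) (s := s))//; last first.
  apply: (@measurableT_comp _ _ _ _ _ _ Psi _ (fun t : k.-tuple (mR R) => lin_tuple mu A k t)) => //.
  exact: measurable_lin_tuple.
apply: eq_iid_expect => z sz; congr Psi.
by apply: eq_mktuple => i; rewrite /lin sum_rotcol.
Qed.

Definition gram {I : Type} (k : nat) (A : I -> nat -> R) (i j : I) : R :=
  (\sum_(l < k) A i l * A j l)%R.

(* LQ decomposition: the rows listed by [o] are made triangular in that order. *)
Lemma gaussian_lq M (mu : 'I_M -> R) k (A : 'I_M -> nat -> R) (o : nat -> 'I_M) p :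
  (p < k)%N -> exists B : 'I_M -> nat -> R,
    [/\ same_law mu k A B, (forall i j, gram k B i j = gram k A i j),
      (forall a l, (a < p)%N -> (a < l < k)%N -> B (o a) l = 0%R) &
      (forall a, (a < p)%N -> (0 <= B (o a) a)%R)].
Proof.
move=> pk.
pose E B := same_law mu k A B /\ forall i j, gram k B i j = gram k A i j.
have [|//|B [[h1 h2] h3 h4]] := @lq R 'I_M k E _ A o p _ pk.
- move=> B j c s jk cs [h1 h2]; split.
    by move=> Psi Psi0 mPsi; rewrite h1//; exact: same_law_rotcol.
  by move=> i i'; rewrite -h2 /gram gram_rotcol.
by exists B.
Qed.

End IidRotation.

Section Expressible.
Context {R : realType} {m : nat} (mu : 'I_m.+1 -> R) (C : 'M[R]_m.+1).

(** One expression must produce the value in every state: the factor is then part of the program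
    text, and evaluating an entry costs a constant independent of the level. *)
Definition expressible (v : R) : Prop :=
  exists e : expr m.+1, forall s : state, Defs.eval mu C s e = v.

Lemma expressible_nat n : expressible n%:R.
Proof. by exists (Defs.Lit n). Qed.

Lemma expressible_cov i j : expressible (C i j).
Proof. by exists (Cov (PLit i) (PLit j)). Qed.

Lemma expressibleB x y : expressible x -> expressible y -> expressible (x - y).
Proof. by move=> [e he] [e' he']; exists (Defs.Sub e e') => s /=; rewrite he he'. Qed.

Lemma expressibleM x y : expressible x -> expressible y -> expressible (x * y).
Proof. by move=> [e he] [e' he']; exists (Mul e e') => s /=; rewrite he he'. Qed.

Lemma expressibleV x y : expressible x -> expressible y -> expressible (x / y).
Proof. by move=> [e he] [e' he']; exists (Div e e') => s /=; rewrite he he'. Qed.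

Lemma expressible_sqrt x : expressible x -> expressible (Num.sqrt x).
Proof. by move=> [e he]; exists (Sqrt e) => s /=; rewrite he. Qed.

Lemma expressible_sum n (F : nat -> R) :
  (forall l, (l < n)%N -> expressible (F l)) -> expressible (\sum_(l < n) F l).
Proof.
elim: n => [_|n IH hF]; first by rewrite big_ord0; exact: (expressible_nat 0).
rewrite big_ord_recr /=.
have [e he] := IH (fun l ln => hF l (ltnW ln)); have [e' he'] := hF n (ltnSn n).
by exists (Add e e') => s /=; rewrite he he'.
Qed.

(* A triangular factor with nonnegative diagonal is recovered from its Gram
   matrix by the Cholesky recursion, column by column. *)
Lemma cholesky_expressible k (B : 'I_m.+1 -> nat -> R) (o : nat -> 'I_m.+1) :
  (m.+1 <= k)%N ->
  (forall i, exists2 a, (a < m.+1)%N & o a = i) ->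
  (forall i j, \sum_(l < k) B i l * B j l = C i j) ->
  (forall a l, (a < m.+1)%N -> (a < l < k)%N -> B (o a) l = 0) ->
  (forall a, (a < m.+1)%N -> 0 < B (o a) a) ->
  forall i l, (l < k)%N -> expressible (B i l).
Proof.
move=> mk osurj BC B0 Bd i l lk.
have [a am <-] := osurj i; move: {i}a am.
elim/ltn_ind: l lk => l IH lk.
(* Row [o p] vanishes beyond column [p = l], so the Gram sum stops there; its last term contains the
   entry to be solved for. *)
have trunc p q : (p < m.+1)%N -> p = l ->
    C (o q) (o p) = \sum_(t < l) B (o q) t * B (o p) t + B (o q) l * B (o p) l.
  move=> pm pl; rewrite -BC -(subnKC lk) big_split_ord/= big_ord_recr/=.
  rewrite [X in _ + X]big1 ?addr0// => t _.
  rewrite (B0 p)// ?mulr0// pl ltnS leq_addr/=.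
  by rewrite -[in ltnRHS](subnKC lk) ltn_add2l.
have sums p q : (p < m.+1)%N -> (q < m.+1)%N ->
    expressible (\sum_(t < l) B (o q) t * B (o p) t).
  move=> pm qm; apply: (expressible_sum (F := fun t => B (o q) t * B (o p) t)) => t tl.
  by apply: expressibleM; apply: IH => //; exact: ltn_trans lk.
have diag : (l < m.+1)%N -> expressible (B (o l) l).
  move=> lm; have -> : B (o l) l = Num.sqrt (C (o l) (o l) - \sum_(t < l) B (o l) t * B (o l) t).
    by rewrite (trunc l l lm erefl) addrC addKr -expr2 sqrtr_sqr gtr0_norm// Bd.
  by apply/expressible_sqrt/expressibleB; [exact: expressible_cov|exact: sums].
move=> p pm; have [pl|lp|pl] := ltngtP p l.
- by rewrite B0// ?pl//; exact: (expressible_nat 0).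
- have lm : (l < m.+1)%N by exact: ltn_trans lp pm.
  have -> : B (o p) l = (C (o p) (o l) - \sum_(t < l) B (o p) t * B (o l) t) / B (o l) l.
    by rewrite (trunc l p lm erefl) addrC addKr mulfK// gt_eqF// Bd.
  by apply: expressibleV; [apply: expressibleB; [exact: expressible_cov|exact: sums]|exact: diag].
- by rewrite pl; apply: diag; rewrite -pl.
Qed.

(* If the [a]-th diagonal entry vanished, the first [a + 1] rows would lie in a
   space of dimension [a]. *)
Lemma lq_diag_gt0 k (B : 'I_m.+1 -> nat -> R) (o : nat -> 'I_m.+1) :
  C \in unitmx ->
  {in [pred a | (a < m.+1)%N] &, injective o} ->
  (forall i j, \sum_(l < k) B i l * B j l = C i j) ->
  (forall a l, (a < m.+1)%N -> (a < l < k)%N -> B (o a) l = 0) ->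
  (forall a, (a < m.+1)%N -> 0 <= B (o a) a) ->
  forall a, (a < m.+1)%N -> 0 < B (o a) a.
Proof.
move=> Cu oinj BC B0 Bd a am; rewrite lt_neqAle Bd// andbT eq_sym; apply/eqP => Baa.
pose N : 'M[R]_(a.+1, a) := \matrix_(p, l) B (o p) l.
have /rowV0Pn[u uN u0] : kermx N != 0.
  rewrite kermx_eq0 /row_free neq_ltn (leq_ltn_trans (rank_leq_col N))//.
(* [S] places position [p] at index [o p]. A relation [u] between the truncated rows makes [u *m S]
   a vector killed by [C], hence 0, and injectivity of [o] gives back [u = 0]. *)
pose S : 'M[R]_(a.+1, m.+1) := \matrix_(p, i) (o p == i)%:R.
have uSC : u *m S *m C = 0.
  apply/rowP => j; rewrite -mulmxA !mxE.
  transitivity (\sum_(l < k) (\sum_p u 0 p * B (o p) l) * B j l).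
    under [RHS]eq_bigr do rewrite mulr_suml.
    rewrite exchange_big; apply: eq_bigr => p _ /=.
    rewrite !mxE (bigD1 (o p))//= !mxE eqxx mul1r big1 ?addr0; last first.
      by move=> i ip; rewrite !mxE eq_sym (negbTE ip) mul0r.
    by rewrite -BC mulr_sumr; apply: eq_bigr => l _; rewrite mulrA.
  rewrite big1// => l _; have [la|al] := ltnP l a.
    have /sub_kermxP/rowP/(_ (Ordinal la)) := uN; rewrite !mxE => h.
    rewrite [X in X * _](_ : _ = 0) ?mul0r// -[RHS]h.
    by apply: eq_bigr => p _; rewrite !mxE.
  rewrite big1 ?mul0r// => p _.
  have pm : (p < m.+1)%N by exact: leq_ltn_trans (leq_ord p) am.
  have [pl|lp] := ltnP p l; first by rewrite B0 ?mulr0// pl ltn_ord.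
  have pa : p = a :> nat by apply/eqP; rewrite eqn_leq -ltnS ltn_ord (leq_trans al lp).
  have lE : l = a :> nat by apply/eqP; rewrite eqn_leq al andbT -pa.
  by rewrite lE pa Baa mulr0.
have uS : u *m S = 0 by rewrite -[LHS](mulmxK Cu) uSC mul0mx.
move/eqP: u0; apply; apply/rowP => p.
have := congr1 (fun v : 'rV_m.+1 => v 0 (o p)) uS; rewrite !mxE => <-.
have pm (q : 'I_a.+1) : (q < m.+1)%N by exact: leq_ltn_trans (leq_ord q) am.
rewrite (bigD1 p)//= mxE eqxx mulr1 big1 ?addr0// => q qp; rewrite mxE.
case: eqP => [/oinj oo|]; last by rewrite mulr0.
by case/eqP: qp; apply/val_inj; apply: oo; rewrite inE pm.
Qed.

End Expressible.

(** * Programs *)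

Section ProgramLogic.
Context {R : realType} {m : nat} (mu : 'I_m.+1 -> R) (C : 'M[R]_m.+1).
Local Notation state := (@Defs.state R m).
Local Notation expect := (@Defs.expect R m mu C).
Local Notation eval := (@Defs.eval R m mu C).

(** The invariant is checked at every elementary step, so that it is available at each turn of a
    loop and not only at the end. *)
Fixpoint preserves (I : state -> Prop) (c : cmd m.+1) : Prop :=
  match c with
  | Skip => True
  | Assign k e => forall s, I s -> I (tick (ops e) (set_real s k (eval s e)))
  | AssignPt k p => forall s, I s -> I (set_pt s k (eval_pt s p))
  | Gauss k => forall s z, I s -> I (tick 1 (set_real s k z))
  | Unif k => forall s t, I s -> I (tick 1 (set_pt s k t))
  | Seq c1 c2 => preserves I c1 /\ preserves I c2
  | IfLe e1 e2 c1 c2 =>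
      [/\ forall s, I s -> I (tick (ops e1 + ops e2).+1 s), preserves I c1 & preserves I c2]
  | WhileLe e1 e2 c1 =>
      (forall s, I s -> I (tick (ops e1 + ops e2).+1 s)) /\ preserves I c1
  end.

Lemma expect_mono (I : state -> Prop) c (g h : state -> \bar R) :
  preserves I c -> (forall s, I s -> (g s <= h s)%E) ->
  forall s, I s -> (expect c g s <= expect c h s)%E.
Proof.
elim: c g h => [|k e|k p|k|k|c1 IH1 c2 IH2|e1 e2 c1 IH1 c2 IH2|e1 e2 c1 IH1] g h /=.
- by move=> _ gh s; exact: gh.
- by move=> Ic gh s Is; apply: gh; exact: Ic.
- by move=> Ic gh s Is; apply: gh; exact: Ic.
- by move=> Ic gh s Is; apply: le_integral_nomeas => z; apply: gh; exact: Ic.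
- move=> Ic gh s Is; apply: lee_sum => t _; apply: lee_wpmul2l; last by apply: gh; exact: Ic.
  by rewrite lee_fin invr_ge0.
- by move=> [I1 I2] gh s Is; apply: IH1 => // s1 Is1; exact: IH2.
- move=> [It I1 I2] gh s Is; case: ifP => _; first by apply: IH1 => //; exact: It.
  by apply: IH2 => //; exact: It.
- move=> [It I1] gh s Is; apply: ge_ereal_sup => _ [k _ <-].
  apply: (@le_trans _ _ (iter k (fun (h0 : state -> \bar R) s0 =>
    if eval s0 e1 <= eval s0 e2 then expect c1 h0 (tick (ops e1 + ops e2).+1 s0)
    else h (tick (ops e1 + ops e2).+1 s0)) (fun=> 0%E) s)); last first.
    by apply: ereal_sup_ubound; exists k.
  elim: k s Is => [//|k IHk] s Is /=; case: ifP => _; last by apply: gh; exact: It.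
  by apply: IH1 => //; exact: It.
Qed.

Lemma expect_congr (I : state -> Prop) c (g h : state -> \bar R) :
  preserves I c -> (forall s, I s -> g s = h s) ->
  forall s, I s -> expect c g s = expect c h s.
Proof.
move=> Ic gh s Is; apply/eqP; rewrite eq_le.
by rewrite !(expect_mono Ic)// => s' Is'; rewrite gh.
Qed.

Lemma expect0 c s : expect c (fun=> 0%E) s = 0%E.
Proof.
elim: c s => [|k e|k p|k|k|c1 IH1 c2 IH2|e1 e2 c1 IH1 c2 IH2|e1 e2 c1 IH1] s //=.
- by rewrite integral_prob_cst.
- by rewrite big1// => t _; rewrite mule0.
- by rewrite (_ : expect c2 _ = fun=> 0%E) ?IH1//; apply/funext => s'; exact: IH2.
- by case: ifP.
- apply/eqP; rewrite eq_le; apply/andP; split; last by apply: ereal_sup_ubound; exists 0%N.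
  apply: ge_ereal_sup => _ [k _ <-]; rewrite le_eqVlt; apply/orP; left; apply/eqP.
  elim: k s => [//|k IHk] s /=; case: ifP => // _.
  rewrite (_ : iter k _ _ = fun=> 0%E) ?IH1//; apply/funext => s'; exact: IHk.
Qed.

Definition agree (D : pred nat) (s s' : state) : Prop :=
  forall j, D j -> reals s j = reals s' j.

Definition depends_only (D : pred nat) {T : Type} (g : state -> T) : Prop :=
  forall s s', agree D s s' -> g s = g s'.

(* A loop whose body succeeds with probability [p] (raising register [f]) and
   has success part [a] satisfies [v = a + (1 - p) v]. *)
Lemma expect_reject (D : pred nat) (f : nat) (Bd : cmd m.+1) (g : state -> \bar R) s (a p : R) :
  0 < p <= 1 -> 0 <= a -> ~~ D f ->
  (forall s k, g (tick k s) = g s) ->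
  preserves (agree D s) Bd ->
  (forall r s', 0 <= r -> agree D s s' -> reals s' f <= 0 ->
    expect Bd (fun s2 => if (reals s2 f <= 0)%R then r%:E else g s2) s' = (a + (1 - p) * r)%:E) ->
  reals s f <= 0 ->
  expect (WhileLe (Reg f) (Lit 0) Bd) g s = (a / p)%:E.
Proof.
move=> /andP[p0 p1] a0 Df gt IB HB sf /=.
set U := fun (h : state -> \bar R) s0 => if _ then _ else _.
(* The partial geometric sum: [k.+1] unfoldings leave room for [k] complete rounds, since the last
   one only tests the flag. *)
pose v k : R := a / p * (1 - (1 - p) ^+ k).
have ap0 : 0 <= a / p by rewrite divr_ge0// ltW.
have q0 : 0 <= 1 - p by rewrite subr_ge0.
have q1 : 1 - p <= 1 by rewrite gerBl ltW.
have v0 k : 0 <= v k.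
  by apply: mulr_ge0 => //; rewrite subr_ge0 exprn_ile1.
have UE k s' : agree D s s' -> iter k.+1 U (fun=> 0%E) s' =
    if (reals s' f <= 0)%R then (v k)%:E else g s'.
  elim: k s' => [|k IHk] s' ss'.
    rewrite /= /U /=; case: ifP => _; last by rewrite gt.
    by rewrite expect0 /v expr0 subrr mulr0.
  rewrite iterS; move: (iter k.+1 U (fun=> 0%E)) IHk => W IHk.
  rewrite /U /=; have [sf'|sf'] := leP (reals s' f) 0; last exact: gt.
  rewrite (expect_congr (h := fun s2 => if (reals s2 f <= 0)%R then (v k)%:E else g s2) IB)//.
  rewrite HB//; congr (_%:E); rewrite /v exprS; field; exact: lt0r_neq0.
apply/eqP; rewrite eq_le; apply/andP; split.
  apply: ge_ereal_sup => _ [[|k] _ <-]; first by rewrite /= lee_fin.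
  by rewrite UE// sf lee_fin /v ler_piMr// gerBl exprn_ge0.
have cv : v k @[k --> \oo] --> a / p.
  have : a / p * (1 - (1 - p) ^+ k) @[k --> \oo] --> a / p * (1 - 0).
    apply: cvgM; first exact: cvg_cst.
    apply: cvgB; first exact: cvg_cst.
    by apply: cvg_expr; rewrite ger0_norm// ltrBlDr ltrDl.
  by rewrite subr0 mulr1.
have cve : (v k)%:E @[k --> \oo] --> (a / p)%:E by apply: cvg_EFin => //; near=> k.
rewrite -(cvg_lim _ cve)//; apply: lime_le; first by apply/cvg_ex; exists (a / p)%:E.
near=> k; apply: ereal_sup_ubound; exists k.+1 => //.
by rewrite UE// sf.
Unshelve. all: by end_near. Qed.

End ProgramLogic.

Section Fragments.
Context {R : realType} {m : nat} (mu : 'I_m.+1 -> R) (C : 'M[R]_m.+1).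
Local Notation state := (@Defs.state R m).
Local Notation expect := (@Defs.expect R m mu C).
Local Notation eval := (@Defs.eval R m mu C).
Local Notation N01 := (normal_prob 0 1 : set (mR R) -> \bar R).
Local Notation expr := (Defs.expr m.+1).
Local Notation cmd := (Defs.cmd m.+1).
Local Notation Lit := Defs.Lit.
Local Notation Sub := Defs.Sub.

(* Registers: 0 level, 1 number of replications, 2 sum of the tail probabilities,
   3 sum of the weights, 4 replications done, 5 success flag of the rejection
   loops, 6 number of coordinates above the level, 7 to 9 scratch, [10 + l] the
   Gaussian variable [z_l]. *)
Definition half : expr := Div (Lit 1) (Lit 2).

Definition signed_Phi (e : expr) : expr := Sub (Add half (Phi e)) (Phi (Sub (Lit 0) e)).

Lemma eval_signed_Phi s e : eval s (signed_Phi e) = normal_cdf (eval s e).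
Proof. by rewrite /= sub0r div1r normal_cdf_signed. Qed.

(** A Gaussian draw used as a biased coin. Both branches are required to have a value that does not
    depend on the draw: the integrand then takes two values, and is measurable although
    continuations in general are not. *)
Lemma expect_bernoulli (r : nat) (e : expr) (c1 c2 : cmd) (g : state -> \bar R) s (p x y : R) :
  0 < p <= 1 -> 0 <= x -> 0 <= y ->
  (forall z, eval (tick 1 (set_real s r z)) e = p) ->
  (forall z n, normal_cdf z <= p -> expect c1 g (tick n (tick 1 (set_real s r z))) = x%:E) ->
  (forall z n, expect c2 g (tick n (tick 1 (set_real s r z))) = y%:E) ->
  expect (Seq (Gauss r) (IfLe (signed_Phi (Reg r)) e c1 c2)) g s = (p * x + (1 - p) * y)%:E.
Proof.
move=> p01 x0 y0 ep H1 H2.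
set N := (ops (signed_Phi (Reg r)) + ops e).+1.
transitivity (\int[N01]_z (
    if (eval (tick 1 (set_real s r z)) (signed_Phi (Reg r)) <= eval (tick 1 (set_real s r z)) e)%R
    then expect c1 g (tick N (tick 1 (set_real s r z)))
    else expect c2 g (tick N (tick 1 (set_real s r z)))))%E; first by [].
have mle : measurable [set z : mR R | normal_cdf z <= p].
  have [p1|p1] := eqVneq p 1.
    rewrite (_ : [set _ | _] = setT)//; apply/seteqP; split => // z _ /=.
    by rewrite p1 normal_cdf_le1.
  have [q qp] : exists q, normal_cdf q = p.
    by apply: normal_cdf_surj; case/andP: p01 => -> /=; rewrite lt_neqAle p1.
  rewrite (_ : [set _ | _] = [set z | z <= q]); first exact: measurable_le.
  by apply/seteqP; split => z /=; rewrite -qp normal_cdf_le.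
transitivity (\int[N01]_z (x%:E * (\1_[set z : mR R | normal_cdf z <= p] z)%:E
   + y%:E * (\1_(~` [set z : mR R | normal_cdf z <= p]) z)%:E))%E.
  apply: eq_integral => z _.
  rewrite eval_signed_Phi ep !indicE [eval _ (Reg r)]/= eqxx.
  case: ifPn => h.
    by rewrite H1// mem_set// memNset; [rewrite mule1 mule0 adde0|move=> /(_ h)].
  by rewrite H2 memNset; [rewrite mem_set ?mule1 ?mule0 ?add0e//; exact/negP|exact/negP].
rewrite ge0_integralD//; last 4 first.
- by move=> z _; rewrite mule_ge0// lee_fin.
- by apply: emeasurable_funM => //; exact: measurable_EFin_indic.
- by move=> z _; rewrite mule_ge0// lee_fin.
- by apply: emeasurable_funM => //; apply: measurable_EFin_indic; exact: measurableC.
rewrite !ge0_integralZl//; try by apply: measurable_EFin_indic; try exact: measurableC.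
rewrite !integral_indic ?setIT//; last exact: measurableC.
have NE := normal_bernoulli p01.
have NEC : N01 (~` [set z : mR R | normal_cdf z <= p]) = (1 - p)%:E.
  by rewrite EFinB -NE; exact: (probability_setC (normal_prob 0 1) mle).
transitivity (x%:E * N01 [set z : mR R | (normal_cdf z <= p)%R]
  + y%:E * N01 (~` [set z : mR R | (normal_cdf z <= p)%R]))%E; first by [].
by rewrite NE NEC -!EFinM -EFinD; congr EFin; ring.
Qed.

Fixpoint draws (off n : nat) : cmd :=
  if n is n'.+1 then Seq (Gauss off) (draws off.+1 n') else Skip.

Fixpoint set_seq (off : nat) (zs : seq R) (s : state) : state :=
  if zs is z :: zs' then set_seq off.+1 zs' (tick 1 (set_real s off z)) else s.

Lemma expect_draws off n g s :
  expect (draws off n) g s = iid_expect N01 n (fun zs => g (set_seq off zs s)).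
Proof.
elim: n off s => [//|n IH] off s /=.
by apply: eq_integral => z _; rewrite IH.
Qed.

Lemma reals_set_seq off zs s j :
  reals (set_seq off zs s) j =
  if (off <= j < off + size zs)%N then zs`_(j - off) else reals s j.
Proof.
elim: zs off s => [|z zs IH] off s /=.
  by rewrite addn0; case: ltngtP.
rewrite IH /= addSnnS; have [jo|oj|->] := ltngtP off j => /=.
- by rewrite -[(j - off)%N]subnSK.
- by [].
- by rewrite subnn addnS ltnS leq_addr.
Qed.

Definition sum_expr (es : seq expr) : expr := foldr (fun e e' => Add e e') (Lit 0) es.

Lemma eval_sum_expr s es : eval s (sum_expr es) = \sum_(e <- es) eval s e.
Proof. by elim: es => [|e es IH] /=; rewrite ?big_nil// big_cons IH. Qed.

Variable k' : nat.
Variable a : 'I_m.+1 -> nat -> expr.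
Variable A : 'I_m.+1 -> nat -> R.
Hypothesis aA : forall j l s, (l < k'.+1)%N -> eval s (a j l) = A j l.

Definition coord (j : 'I_m.+1) : expr :=
  Add (Mean (PLit j)) (sum_expr [seq Mul (a j l) (Reg (10 + l)) | l <- iota 0 k'.+1]).

Lemma eval_coord s j z : (forall l, (l < k'.+1)%N -> reals s (10 + l)%N = z`_l) ->
  eval s (coord j) = mu j + lin A k'.+1 z j.
Proof.
move=> sz; rewrite /coord [LHS]/= -/(sum_expr _); congr (_ + _).
rewrite -[LHS]/(eval s (sum_expr [seq Mul (a j l) (Reg (10 + l)) | l <- iota 0 k'.+1])).
rewrite eval_sum_expr big_map /lin -(big_mkord xpredT (fun l => A j l * z`_l)) /index_iota subn0.
rewrite big_seq [RHS]big_seq; apply: eq_bigr => l; rewrite mem_iota add0n => /andP[_ lk].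
by rewrite /= aA// sz.
Qed.

Definition count_step (j : 'I_m.+1) : cmd :=
  IfLe (coord j) (Reg 0) Skip (Assign 6 (Add (Reg 6) (Lit 1))).

Definition count_all (js : seq 'I_m.+1) : cmd := foldr (fun j c => Seq (count_step j) c) Skip js.

Definition exceed (b : R) (x : m.+1.-tuple (mR R)) : nat := (\sum_(j < m.+1) (b < tnth x j)%R)%N.

(** The two outcomes of a test differ in cost. Agreement of real registers ignores the cost, so the
    continuation cannot see this. *)
Lemma expect_count (g : state -> \bar R) js s z :
  (forall l, (l < k'.+1)%N -> reals s (10 + l)%N = z`_l) ->
  (forall s s', agree (fun j => j < 7)%N s s' -> g s = g s') ->
  expect (count_all js) g s =
  g (set_real s 6 (reals s 6 + (\sum_(j <- js) (reals s 0 < mu j + lin A k'.+1 z j)%R)%N%:R)).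
Proof.
move=> sz gD; elim: js s sz => [|j js IH] s sz.
  rewrite /= big_nil addr0; apply: gD => i _ /=.
  by case: eqP => // ->.
pose s1 := tick (ops (coord j) + ops (Reg 0 : expr)).+1 s.
transitivity (if eval s (coord j) <= reals s 0 then expect (count_all js) g s1
  else expect (count_all js) g
    (tick (ops (Add (Reg 6) (Lit 1) : expr)) (set_real s1 6 (reals s 6 + 1)))); first by [].
rewrite (eval_coord j sz) big_cons; case: leP => h.
  by rewrite IH// add0n; apply: gD => i _ /=; case: eqP.
rewrite IH//=; apply: gD => i _ /=; case: eqP => // _.
by rewrite natrD addrA.
Qed.

Definition finish : cmd :=
  Seq (Assign 3 (Add (Reg 3) (Div (Reg 2) (Reg 6)))) (Assign 4 (Add (Reg 4) (Lit 1))).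

(** Register 10 already holds the variable drawn from its tail; the other [k'] variables are
    unconditioned. *)
Definition after_head : cmd :=
  Seq (draws 11 k') (Seq (Assign 6 (Lit 0)) (Seq (count_all (enum 'I_m.+1)) finish)).

(** The net effect of a replication in which [v] coordinates exceed the level. *)
Definition upd (s : state) (v : nat) : state :=
  set_real (set_real s 3 (reals s 3 + reals s 2 / v%:R)) 4 (reals s 4 + 1).

(** The registers carried from one replication to the next; the others are overwritten before they
    are read. *)
Definition live : pred nat := fun j => (j < 5)%N.

Lemma expect_after_head (g : state -> \bar R) s :
  depends_only live g ->
  expect after_head g s = iid_expect N01 k' (fun zs =>
    g (upd s (exceed (reals s 0) (lin_tuple mu A k'.+1 (reals s 10 :: zs))))).
Proof.
move=> gD; rewrite [LHS]/= expect_draws; apply: eq_iid_expect => zs szs.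
set s1 := tick _ _.
have s1E j : (j < 10)%N -> j != 6%N -> reals s1 j = reals s j.
  move=> j10 j6; rewrite /= (negbTE j6) reals_set_seq.
  by rewrite (leqNgt 11) (ltn_trans j10).
rewrite (@expect_count _ _ _ (reals s 10 :: zs)); first last.
- move=> s2 s3 ss; apply: gD => j j5; rewrite /= !ss//.
  exact: ltn_trans j5 _.
- move=> [|l] lk; rewrite /= reals_set_seq ?szs//.
  have -> : (10 + l.+1 = 11 + l)%N by rewrite addnS.
  by rewrite leq_addr ltn_add2l -ltnS lk addKn.
apply: gD => j j5 /=; rewrite -!/(reals _ _).
have jj i : (i < 10)%N -> i != 6%N -> reals (set_seq 11 zs s) i = reals s i.
  by move=> i10 i6; rewrite reals_set_seq (leqNgt 11) (ltn_trans i10).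
have j5' : (j < 5)%N := j5.
have j6 : j != 6%N by rewrite ltn_eqF// (ltn_trans j5').
rewrite (negbTE j6); case: eqP => [_|_]; first by rewrite jj.
case: eqP => [_|_]; last by apply: jj => //; exact: ltn_trans j5' _.
rewrite !jj// add0r; congr (_ + _ / _%:R).
by rewrite big_enum /exceed; apply: eq_bigr => i _; rewrite tnth_mktuple.
Qed.

End Fragments.

Lemma integral_normal_indic (R : realType) (B : set (mR R)) : measurable B ->
  (\int[normal_prob 0 1]_x (\1_B x)%:E = (normal_prob 0 1 : set (mR R) -> \bar R) B)%E.
Proof. by move=> mB; rewrite integral_indic// setIT. Qed.

(** * Sampling a Gaussian variable above a threshold *)

Section Sampler.
Context {R : realType} {m : nat} (mu : 'I_m.+1 -> R) (C : 'M[R]_m.+1).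
Local Notation state := (@Defs.state R m).
Local Notation expect := (@Defs.expect R m mu C).
Local Notation eval := (@Defs.eval R m mu C).
Local Notation N01 := (normal_prob 0 1 : set (mR R) -> \bar R).
Local Notation expr := (Defs.expr m.+1).
Local Notation cmd := (Defs.cmd m.+1).
Local Notation Lit := Defs.Lit.
Local Notation Sub := Defs.Sub.

Variable thr : expr.
Variable th : R -> R.
Hypothesis thrE : forall s, eval s thr = th (reals s 0).

(* Marsaglia's tail method: for Gaussian [u], [v] and a threshold [t], the point
   [x = sqrt (t^2 + u^2 + v^2)] is accepted with probability [t / x]. For
   [t >= 1] the acceptance rate is bounded below, unlike that of [plain_step]. *)
Definition marsaglia_step : cmd :=
  Seq (Gauss 7) (Seq (Gauss 8) (Seq
    (Assign 10 (Sqrt (Add (Mul thr thr) (Add (Mul (Reg 7) (Reg 7)) (Mul (Reg 8) (Reg 8))))))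
    (Seq (Gauss 9) (IfLe (signed_Phi (Reg 9)) (Div thr (Reg 10)) (Assign 5 (Lit 1)) Skip)))).

Definition plain_step : cmd :=
  Seq (Gauss 10) (IfLe (Reg 10) thr Skip (Assign 5 (Lit 1))).

(** Switching at threshold 1 bounds both acceptance rates from below: up to 1, a plain draw exceeds
    the threshold with probability at least that of exceeding 1. *)
Definition sampler : cmd :=
  Seq (Assign 5 (Lit 0)) (IfLe (Lit 1) thr
    (WhileLe (Reg 5) (Lit 0) marsaglia_step) (WhileLe (Reg 5) (Lit 0) plain_step)).

Definition live10 : pred nat := fun j => (j < 5)%N || (j == 10)%N.

Lemma live_neq j i : live j -> (5 <= i)%N -> (j == i) = false.
Proof. by move=> j5 i5; rewrite ltn_eqF// (leq_trans j5). Qed.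

Lemma agree_live_set k v (s s' : state) : (5 <= k)%N ->
  agree live s s' -> agree live s (set_real s' k v).
Proof.
move=> k5 ss j j5 /=; case: eqP => [jk|_]; last exact: ss.
by move: j5; rewrite jk /live ltnNge k5.
Qed.

Lemma preserves_marsaglia s : preserves mu C (agree live s) marsaglia_step.
Proof. by do !split => //; move=> *; exact: agree_live_set. Qed.

Lemma preserves_plain s : preserves mu C (agree live s) plain_step.
Proof. by do !split => //; move=> *; exact: agree_live_set. Qed.

Section Body.
Variables (gr : state -> R) (K : R) (s : state).
Hypotheses (gD : depends_only live10 gr) (g0 : forall s, 0 <= gr s) (gK : forall s, gr s <= K).
Hypothesis mg : measurable_fun setT (fun z : mR R => gr (set_real s 10 z) : mR R).

Let t : R := th (reals s 0).

Definition tail_mean : R := fine (\int[N01]_z ((\1_`]t, +oo[ z)%:E * (gr (set_real s 10 z))%:E)).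

Let mtail : measurable_fun setT (fun z : mR R => ((\1_`]t, +oo[ z)%:E * (gr (set_real s 10 z))%:E)%E).
Proof.
apply: emeasurable_funM; first by apply: measurable_EFin_indic.
exact/measurable_EFinP.
Qed.

Lemma tail_meanE :
  (tail_mean%:E = \int[N01]_z ((\1_`]t, +oo[ z)%:E * (gr (set_real s 10 z))%:E))%E.
Proof.
rewrite /tail_mean fineK// ge0_fin_numE; last first.
  by apply: integral_ge0 => z _; rewrite mule_ge0// lee_fin.
apply: le_lt_trans (ltry K); apply: (integral_le_cst (normal_prob 0 1)) => z.
rewrite -EFinM lee_fin indicE; case: (_ \in _); rewrite ?mul1r ?mul0r//.
exact: le_trans (gK s).
Qed.

Lemma tail_mean_ge0 : 0 <= tail_mean.
Proof.
by rewrite -lee_fin tail_meanE; apply: integral_ge0 => z _; rewrite mule_ge0// lee_fin.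
Qed.

(* States met inside the loop agree with [s] on the live registers. *)
Let grE s' z : agree live s s' -> gr (set_real s' 10 z) = gr (set_real s 10 z).
Proof.
by move=> ss; apply: gD => j /orP[j5|/eqP ->] //=; case: eqP => // _; rewrite ss.
Qed.

Lemma normal_ray : N01 `]t, +oo[%classic = (1 - normal_cdf t)%:E.
Proof.
by rewrite -normal_gt; congr (N01 _); apply/seteqP; split => z /=; rewrite in_itv/= andbT.
Qed.

Lemma expect_plain_step r s' : 0 <= r -> agree live s s' -> reals s' 5 <= 0 ->
  expect plain_step (fun s2 => if (reals s2 5 <= 0)%R then r%:E else (gr s2)%:E)
    s' = (tail_mean + (1 - (1 - normal_cdf t)) * r)%:E.
Proof.
move=> r0 ss s5; rewrite [LHS]/=.
transitivity (\int[N01]_z ((\1_`]t, +oo[ z)%:E * (gr (set_real s 10 z))%:E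
   + r%:E * (\1_[set z : mR R | (z <= t)%R] z)%:E))%E.
  apply: eq_integral => z _; rewrite thrE /=.
  have -> : reals s' 0 = reals s 0 by rewrite ss.
  rewrite -/t !indicE; case: leP => zt /=.
    rewrite s5 memNset; last by rewrite /= in_itv/= andbT; apply/negP; rewrite -leNgt.
    by rewrite mul0e add0e mem_set// mule1.
  rewrite ler10 mem_set; last by rewrite /= in_itv/= zt.
  rewrite memNset; last by apply/negP; rewrite -ltNge.
  rewrite mul1e mule0 adde0 -(grE z ss); congr EFin; apply: gD => j /= /orP[j5|/eqP ->] //=.
  by rewrite !(live_neq j5).
rewrite ge0_integralD//; first last.
- by apply: emeasurable_funM => //; apply: measurable_EFin_indic; exact: measurable_le.
- by move=> z _; rewrite mule_ge0// lee_fin.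
- by move=> z _; rewrite mule_ge0// lee_fin.
rewrite ge0_integralZl//; last by apply: measurable_EFin_indic; exact: measurable_le.
rewrite integral_normal_indic; last exact: measurable_le.
rewrite -tail_meanE EFinD; congr (_ + _)%E.
by rewrite opprB addrC subrK mulrC EFinM normal_cdfE.
Qed.

(** The test function 1 in [marsaglia_rejection] identifies its constant through
    [p = c * (1 - normal_cdf t)], so an accepted point has exactly the tail law. The integral for
    [p] is part of the statement because the cost bound needs it. *)
Lemma expect_marsaglia_step : 0 < t -> exists2 p : R,
  (p%:E = \int[N01]_u \int[N01]_v (t / Num.sqrt (t ^+ 2 + (u ^+ 2 + v ^+ 2)))%:E)%E &
  [/\ 0 < p <= 1 & forall r s', 0 <= r -> agree live s s' -> reals s' 5 <= 0 ->
  expect marsaglia_step (fun s2 => if (reals s2 5 <= 0)%R then r%:E else (gr s2)%:E)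
    s' = (p * (tail_mean / (1 - normal_cdf t)) + (1 - p) * r)%:E].
Proof.
move=> t0; have [c c0 H] := marsaglia_rejection t0.
pose X (u v : R) := Num.sqrt (t ^+ 2 + (u ^+ 2 + v ^+ 2)).
have X_ge u v : t <= X u v.
  rewrite -[leLHS]gtr0_norm// -sqrtr_sqr ler_wsqrtr// lerDl.
  by rewrite addr_ge0// sqr_ge0.
have X_gt0 u v : 0 < X u v by exact: lt_le_trans (X_ge u v).
have w01 u v : 0 < t / X u v <= 1 by rewrite divr_gt0//= ler_pdivrMr// mul1r.
have q0 : 0 < 1 - normal_cdf t by rewrite subr_gt0 normal_cdf_lt1.
pose p := c * (1 - normal_cdf t).
have p0 : 0 < p by exact: mulr_gt0.
have pE : (p%:E = \int[N01]_u \int[N01]_v (t / X u v)%:E)%E.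
  have := H (fun=> 1%E) (@measurable_cst _ _ _ _ _ _) (fun=> lee01).
  under eq_integral do under eq_integral do rewrite mule1.
  move=> ->; under eq_integral do rewrite mule1.
  by rewrite integral_normal_indic// normal_ray -EFinM.
exists p; first exact: pE.
split.
  rewrite p0 -lee_fin pE /=; apply: (integral_le_cst (normal_prob 0 1)) => u.
  apply: (integral_le_cst (normal_prob 0 1)) => v.
  by rewrite lee_fin; case/andP: (w01 u v).
move=> r s' r0 ss s5.
pose g2 (z : R) := gr (set_real s 10 z).
transitivity (\int[N01]_u \int[N01]_v ((t / X u v * g2 (X u v) + (1 - t / X u v) * r)%:E))%E.
  pose e10 : expr := Sqrt (Add (Mul thr thr) (Add (Mul (Reg 7) (Reg 7)) (Mul (Reg 8) (Reg 8)))).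
  pose s8 (u v : R) : state := tick 1 (set_real (tick 1 (set_real s' 7 u)) 8 v).
  pose sg u v : state := tick (ops e10) (set_real (s8 u v) 10 (eval (s8 u v) e10)).
  transitivity (\int[N01]_u \int[N01]_v (expect (Seq (Gauss 9) (IfLe (signed_Phi (Reg 9))
    (Div thr (Reg 10)) (Assign 5 (Lit 1)) Skip))
    (fun s2 => if (reals s2 5 <= 0)%R then r%:E else (gr s2)%:E) (sg u v)))%E; first by [].
  apply: eq_integral => u _; apply: eq_integral => v _.
  have s2E : agree live s (sg u v).
    move=> j j5; rewrite /sg /s8 /=.
    by rewrite !(live_neq j5)// ss.
  have X10 : reals (sg u v) 10 = X u v.
    by rewrite /sg /= thrE /= -ss// -/t.
  have s25 : reals (sg u v) 5 <= 0 by [].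
  move: (sg u v) s2E X10 s25 => s2 s2E X10 s25.
  apply: (expect_bernoulli (p := t / X u v)) => //.
  - exact: g0.
  - move=> z; rewrite /= thrE /= X10; congr (_ / _).
    by rewrite -[reals s2 0]s2E.
  - move=> z n _ /=; rewrite ler10; congr EFin; apply: gD => j /orP[j5|/eqP ->] /=; last first.
      by rewrite X10.
    by rewrite !(live_neq j5)//; exact/esym/s2E.
  - by move=> z n /=; rewrite s25.
pose W (q : mR R * mR R) := (t / X q.1 q.2)%:E.
have mW : measurable_fun setT W by apply/measurable_EFinP; exact: measurable_inv_radius.
pose GX (q : mR R * mR R) := ((t / X q.1 q.2)%:E * (g2 (X q.1 q.2))%:E)%E.
have mGX : measurable_fun setT GX.
  apply: emeasurable_funM => //; apply/measurable_EFinP.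
  apply: (@measurableT_comp _ _ _ _ _ _ (g2 : mR R -> mR R) _ (fun q : mR R * mR R => X q.1 q.2 : mR R)) => //.
  exact: measurable_radius.
pose V (q : mR R * mR R) := ((1 - t / X q.1 q.2) * r)%:E.
have mV : measurable_fun setT V.
  apply/measurable_EFinP; apply: measurable_funM => //; apply: measurable_funB => //.
  exact: measurable_inv_radius.
have GX0 q : (0 <= GX q)%E.
  by rewrite mule_ge0// lee_fin//; [have /andP[/ltW] := w01 q.1 q.2|exact: g0].
have V0 q : (0 <= V q)%E.
  by rewrite lee_fin mulr_ge0// subr_ge0; have /andP[] := w01 q.1 q.2.
have W0 q : (0 <= W q)%E by rewrite lee_fin; have /andP[/ltW] := w01 q.1 q.2.
have rW0 q : (0 <= r%:E * W q)%E.
  by rewrite mule_ge0// lee_fin; have /andP[/ltW] := w01 q.1 q.2.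
have mrW : measurable_fun setT (fun q => (r%:E * W q)%E) by exact: emeasurable_funM.
have prodE (F : mR R * mR R -> \bar R) : measurable_fun setT F -> (forall q, 0 <= F q)%E ->
    (\int[N01]_u \int[N01]_v F (u, v) = \int[(normal_prob 0 1 : {measure set (mR R) -> \bar R}) \x (normal_prob 0 1 : {sigma_finite_measure set (mR R) -> \bar R})]_q F q)%E.
  by move=> mF F0; rewrite fubini_tonelli1.
have GXE : (\int[N01]_u \int[N01]_v GX (u, v) = (c * tail_mean)%:E)%E.
  rewrite /GX (H (fun z => (g2 z)%:E)); first by rewrite -tail_meanE.
  - exact/measurable_EFinP.
  - by move=> z; rewrite lee_fin g0.
have WE : (\int[N01]_u \int[N01]_v (r%:E * W (u, v)) = (r * p)%:E)%E.
  rewrite EFinM pE -ge0_integralZl//.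
  - apply: eq_integral => u _; rewrite ge0_integralZl//.
    exact: (measurable_section mW).
  - exact: (measurable_fun_fubini_tonelli_F W mW W0).
  - by move=> u _; apply: integral_ge0 => v _; rewrite lee_fin; have /andP[/ltW] := w01 u v.
(* The rejected part is obtained by complement: [V] and [r%:E * W] add up to [r] at every point. *)
have VE : (\int[N01]_u \int[N01]_v V (u, v) = ((1 - p) * r)%:E)%E.
  have : (\int[N01]_u \int[N01]_v V (u, v) + (r * p)%:E = r%:E)%E.
    rewrite -WE (prodE V)// (prodE (fun q => r%:E * W q)%E)// -ge0_integralD//.
    rewrite -(prodE (fun q => V q + r%:E * W q)%E).
    + rewrite -[RHS](integral_prob_cst (normal_prob 0 1)); apply: eq_integral => u _.
      rewrite -[RHS](integral_prob_cst (normal_prob 0 1)); apply: eq_integral => v _.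
      by rewrite /V /W -EFinM -EFinD; congr EFin; ring.
    + exact: emeasurable_funD.
    + by move=> q; exact: adde_ge0.
  move=> /(congr1 (fun x => x - (r * p)%:E)%E); rewrite addeK// -EFinB => ->.
  by congr EFin; ring.
transitivity (\int[N01]_u \int[N01]_v (GX (u, v) + V (u, v)))%E.
  by apply: eq_integral => u _; apply: eq_integral => v _; rewrite /GX /V -EFinM -EFinD.
rewrite (prodE (fun q => GX q + V q)%E); first last.
- by move=> q; exact: adde_ge0.
- exact: emeasurable_funD.
rewrite ge0_integralD// -(prodE GX)// -(prodE V)// GXE VE -EFinD; congr (_ + _)%:E.
by rewrite /p; field; exact: lt0r_neq0.
Qed.

End Body.

(** In both loops the acceptance probability cancels and the mean over the tail law is left. *)
Lemma expect_sampler (gr : state -> R) (K : R) s :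
  depends_only live10 gr -> (forall s, 0 <= gr s) -> (forall s, gr s <= K) ->
  measurable_fun setT (fun z : mR R => gr (set_real s 10 z) : mR R) ->
  expect sampler (fun s => (gr s)%:E) s =
  (tail_mean gr s / (1 - normal_cdf (th (reals s 0))))%:E.
Proof.
move=> gD g0 gK mg.
have gt s' k : (gr (tick k s'))%:E = (gr s')%:E by congr EFin; apply: gD.
pose s0 : state := tick 0 (set_real s 5 0).
pose s1 : state := tick (ops (Lit 1 : expr) + ops thr).+1 s0.
transitivity (if 1 <= eval s0 thr
  then expect (WhileLe (Reg 5) (Lit 0) marsaglia_step) (fun s => (gr s)%:E) s1
  else expect (WhileLe (Reg 5) (Lit 0) plain_step) (fun s => (gr s)%:E) s1); first by [].
rewrite thrE.
have s1s : agree live s s1 by move=> j j5 /=; case: eqP => // jj; move: j5; rewrite jj.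
have mg1 : measurable_fun setT (fun z : mR R => gr (set_real s1 10 z) : mR R).
  apply: eq_measurable_fun mg => z _; apply: gD => j /orP[j5|/eqP ->]//=.
  by rewrite !(live_neq j5).
have t1E : th (reals s 0) = th (reals s1 0) by [].
have tmE : tail_mean gr s = tail_mean gr s1.
  rewrite /tail_mean; congr fine; apply: eq_integral => z _.
  congr (_ * _%:E)%E; apply: gD => j /orP[j5|/eqP ->] //=.
  by rewrite !(live_neq j5).
have q0 : 0 < 1 - normal_cdf (th (reals s 0)) by rewrite subr_gt0 normal_cdf_lt1.
have q1 : 1 - normal_cdf (th (reals s 0)) <= 1 by rewrite gerBl normal_cdf_ge0.
case: ifPn => h.
  have t0 : 0 < th (reals s1 0) by exact: lt_le_trans h.
  have [p pE [p01 HB]] := expect_marsaglia_step gD g0 gK mg1 t0.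
  have tm0 : 0 <= tail_mean gr s1 / (1 - normal_cdf (th (reals s1 0))).
    by apply: divr_ge0; [exact: (tail_mean_ge0 (K := K))|exact: ltW].
  rewrite (expect_reject (D := live) (a := p * (tail_mean gr s1 / (1 - normal_cdf (th (reals s1 0))))) (p := p) p01)//.
  - by rewrite tmE; congr EFin; field; rewrite !gt_eqF//; case/andP: p01.
  - by apply: mulr_ge0 => //; case/andP: p01 => /ltW.
  - exact: preserves_marsaglia.
rewrite (expect_reject (D := live) (a := tail_mean gr s1) (p := 1 - normal_cdf (th (reals s 0))))//.
- by rewrite tmE.
- by rewrite q0 q1.
- exact: (tail_mean_ge0 (K := K)).
- exact: preserves_plain.
- by move=> r s' r0 ss s5; exact: (expect_plain_step gD g0 gK mg1).
Qed.

End Sampler.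

Section Exceed.
Context {R : realType} {M : nat}.

Lemma exceed_le (b : R) (x : M.+1.-tuple (mR R)) : (exceed b x < M.+2)%N.
Proof.
rewrite ltnS /exceed -[leqRHS]card_ord -sum1_card.
by apply: leq_sum => j _; case: (_ < _).
Qed.

Lemma measurable_exceed (b : R) (v : nat) :
  measurable [set x : M.+1.-tuple (mR R) | exceed b x = v].
Proof.
have mf : measurable_fun setT (fun x : M.+1.-tuple (mR R) => (exceed b x)%:R : mR R).
  rewrite (_ : (fun x => _) = fun x => \sum_(j < M.+1) \1_[set y : mR R | b < y] (tnth x j)); last first.
    apply/funext => x; rewrite /exceed natr_sum; apply: eq_bigr => j _.
    by rewrite indicE mem_setE.
  apply: measurable_sum => j.
  apply: (@measurableT_comp _ _ _ _ _ _ (\1_[set y : mR R | b < y] : mR R -> mR R) _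
    (fun x : M.+1.-tuple (mR R) => tnth x j : mR R)); last exact: measurable_tnth.
  by apply: measurable_indic; exact: measurable_gt.
have := mf measurableT _ (@measurable_set1 R v%:R); rewrite setTI.
congr measurable; apply/seteqP; split => x /= => [/eqP|->//].
by rewrite eqr_nat => /eqP.
Qed.

End Exceed.

(** * One replication *)

Section Main.
Context {R : realType} {m : nat} (mu : 'I_m.+1 -> R) (C : 'M[R]_m.+1).
Local Notation state := (@Defs.state R m).
Local Notation expect := (@Defs.expect R m mu C).
Local Notation eval := (@Defs.eval R m mu C).
Local Notation N01 := (normal_prob 0 1 : set (mR R) -> \bar R).
Local Notation expr := (Defs.expr m.+1).
Local Notation cmd := (Defs.cmd m.+1).
Local Notation Lit := Defs.Lit.
Local Notation Sub := Defs.Sub.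

Variables (k' : nat) (sg : 'I_m.+1 -> R) (se : 'I_m.+1 -> expr).
Variables (A : 'I_m.+1 -> 'I_m.+1 -> nat -> R) (ae : 'I_m.+1 -> 'I_m.+1 -> nat -> expr).
Hypothesis sgE : forall i s, eval s (se i) = sg i.
Hypothesis aeE : forall i j l s, (l < k'.+1)%N -> eval s (ae i j l) = A i j l.

Definition th (i : 'I_m.+1) (b : R) : R := (b - mu i) / sg i.
Definition tl (i : 'I_m.+1) (b : R) : R := 1 - normal_cdf (th i b).
Definition thr (i : 'I_m.+1) : expr := Div (Sub (Reg 0) (Mean (PLit i))) (se i).
Definition e_tail (i : 'I_m.+1) : expr := signed_Phi (Sub (Lit 0) (thr i)).

Lemma eval_thr i s : eval s (thr i) = th i (reals s 0).
Proof. by rewrite /= sgE. Qed.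

Lemma eval_tail i s : eval s (e_tail i) = tl i (reals s 0).
Proof. by rewrite eval_signed_Phi [eval _ _]/= sgE sub0r normal_cdfN. Qed.

Lemma tl_gt0 i b : 0 < tl i b.
Proof. by rewrite subr_gt0 normal_cdf_lt1. Qed.

Definition branch (i : 'I_m.+1) : cmd := Seq (sampler (thr i)) (after_head k' (ae i)).

(** When row [i] of [A i] is zero beyond its first entry [sg i], the condition on the first draw
    says that X_i > b ([lin_tuple_gt]). *)
Definition hit (i : 'I_m.+1) (b : R) (v : nat) (z : seq R) : \bar R :=
  ((th i b < z`_0)%R && (exceed b (lin_tuple mu (A i) k'.+1 z) == v))%:R%:E.

(* The probability that [X_i > b] and that exactly [v] coordinates exceed [b]. *)
Definition joint (i : 'I_m.+1) (b : R) (v : nat) : R :=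
  fine (iid_expect N01 k'.+1 (hit i b v)).

Lemma measurable_hit i b v :
  measurable_fun setT (fun t : k'.+1.-tuple (mR R) => hit i b v t).
Proof.
rewrite (_ : (fun t => _) = fun t : k'.+1.-tuple (mR R) =>
  ((\1_[set y : mR R | th i b < y] (t : seq R)`_0) *
   (\1_[set x : m.+1.-tuple (mR R) | exceed b x = v] (lin_tuple mu (A i) k'.+1 t)))%:E); last first.
  apply/funext => t; rewrite /hit !indicE !mem_setE /= -mulnb natrM; congr (_ * _)%:E.
  by case: eqP => h; [rewrite mem_set|rewrite memNset].
apply/measurable_EFinP; apply: measurable_funM.
  apply: (@measurableT_comp _ _ _ _ _ _ (\1_[set y : mR R | th i b < y] : mR R -> mR R) _
    (fun t : k'.+1.-tuple (mR R) => (t : seq R)`_0 : mR R)); last exact: measurable_tnth_seq.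
  by apply: measurable_indic; exact: measurable_gt.
apply: (@measurableT_comp _ _ _ _ _ _
  (\1_[set x : m.+1.-tuple (mR R) | exceed b x = v] : m.+1.-tuple (mR R) -> mR R) _
  (fun t : k'.+1.-tuple (mR R) => lin_tuple mu (A i) k'.+1 t)); last exact: measurable_lin_tuple.
by apply: measurable_indic; exact: measurable_exceed.
Qed.

Lemma hit_ge0 i b v z : (0 <= hit i b v z)%E.
Proof. by rewrite lee_fin. Qed.

Lemma joint_fin i b v : (joint i b v)%:E = iid_expect N01 k'.+1 (hit i b v).
Proof.
rewrite /joint fineK// ge0_fin_numE; last by apply: (iid_expect_ge0 (normal_prob 0 1)) => z _; exact: hit_ge0.
apply: (@le_lt_trans _ _ (iid_expect N01 k'.+1 (fun=> 1%E))).
  by apply: (iid_expect_mono (normal_prob 0 1)) => z _; rewrite lee_fin; case: (_ && _).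
by rewrite (iid_expect_cst (normal_prob 0 1)) ltry.
Qed.

Lemma joint_ge0 i b v : 0 <= joint i b v.
Proof.
by rewrite -lee_fin joint_fin; apply: (iid_expect_ge0 (normal_prob 0 1)) => z _; exact: hit_ge0.
Qed.

Lemma sum_hit i b (F : nat -> R) (z : seq R) :
  (\sum_(v < m.+2) (F v)%:E * hit i b v z =
   ((th i b < z`_0)%R%:R * F (exceed b (lin_tuple mu (A i) k'.+1 z)))%:E)%E.
Proof.
set e := exceed _ _.
rewrite (bigD1 (Ordinal (exceed_le b (lin_tuple mu (A i) k'.+1 z))))//= big1 ?adde0.
  by rewrite /hit eqxx andbT -EFinM mulrC.
move=> v ve; rewrite /hit (_ : (exceed _ _ == v :> nat) = false) ?andbF ?mule0//.
by apply/eqP => ev; case/eqP: ve; exact: val_inj.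
Qed.

Lemma sum_joint i b (F : nat -> R) : (forall v, 0 <= F v) ->
  ((\sum_(v < m.+2) F v * joint i b v)%:E =
   iid_expect N01 k'.+1 (fun z => ((th i b < z`_0)%R%:R *
     F (exceed b (lin_tuple mu (A i) k'.+1 z)))%:E))%E.
Proof.
move=> F0; rewrite -sumEFin.
under eq_bigr do rewrite EFinM joint_fin.
rewrite -(@iid_expect_sum _ _ _ (normal_prob 0 1) k'.+1 _ (index_enum _) (fun v : 'I_m.+2 => F v) (fun v : 'I_m.+2 => hit i b v))//.
- by apply: (eq_iid_expect (normal_prob 0 1)) => z _; rewrite sum_hit.
- by move=> v z; exact: hit_ge0.
- by move=> v; exact: measurable_hit.
Qed.

Lemma sum_joint1 i b : \sum_(v < m.+2) joint i b v = tl i b.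
Proof.
apply: EFin_inj; transitivity (\sum_(v < m.+2) 1 * joint i b v)%:E.
  by congr EFin; apply: eq_bigr => v _; rewrite mul1r.
rewrite (sum_joint i b (F := fun=> 1))//=.
transitivity (\int[N01]_x (\1_[set y : mR R | th i b < y] x)%:E)%E.
  apply: eq_integral => x _; rewrite (iid_expect_cst (normal_prob 0 1)) mulr1.
  by rewrite indicE mem_setE.
by rewrite integral_normal_indic ?normal_gt//; exact: measurable_gt.
Qed.

Lemma agree_upd (s s' : state) v : agree live s s' -> agree live (upd s v) (upd s' v).
Proof. by move=> ss j j5 /=; case: eqP => _; [|case: eqP => _]; rewrite ?ss. Qed.

(** The sampler conditions the first draw on its tail and the others remain free, so the branch
    averages over the law of the count given X_i > b. This turns all integrals into a finite sum. *)
Lemma expect_branch (gr : state -> R) (K : R) i s :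
  depends_only live gr -> (forall s, 0 <= gr s) -> (forall s, gr s <= K) ->
  expect (branch i) (fun s => (gr s)%:E) s =
  ((\sum_(v < m.+2) gr (upd s v) * joint i (reals s 0) v) / tl i (reals s 0))%:E.
Proof.
move=> gD g0 gK.
pose Fh s zs := gr (upd s (exceed (reals s 0) (lin_tuple mu (A i) k'.+1 (reals s 10 :: zs)))).
have Fm s0 : measurable_fun setT (fun t : k'.+1.-tuple (mR R) =>
    (gr (upd s0 (exceed (reals s0 0) (lin_tuple mu (A i) k'.+1 t))))%:E).
  apply/measurable_EFinP.
  (* No measurability of [gr] is assumed: only finitely many of its values occur, one for each
     count. *)
  rewrite (_ : (fun t => _) = fun t : k'.+1.-tuple (mR R) => \sum_(v < m.+2) gr (upd s0 v) *
    \1_[set x : m.+1.-tuple (mR R) | exceed (reals s0 0) x = v] (lin_tuple mu (A i) k'.+1 t)); last first.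
    apply/funext => t; rewrite (bigD1 (Ordinal (exceed_le (reals s0 0) (lin_tuple mu (A i) k'.+1 t))))//=.
    rewrite big1 ?addr0 ?indicE ?mem_set ?mulr1// => v ve.
    rewrite indicE memNset ?mulr0//= => ev; case/eqP: ve; exact/val_inj/esym.
  apply: measurable_sum => v; apply: measurable_funM => //.
  apply: (@measurableT_comp _ _ _ _ _ _
    (\1_[set x : m.+1.-tuple (mR R) | exceed (reals s0 0) x = v] : m.+1.-tuple (mR R) -> mR R) _
    (fun t : k'.+1.-tuple (mR R) => lin_tuple mu (A i) k'.+1 t)); last exact: measurable_lin_tuple.
  by apply: measurable_indic; exact: measurable_exceed.
pose hr s := fine (iid_expect N01 k' (fun zs => (Fh s zs)%:E)).
have hE s0 : ((hr s0)%:E = iid_expect N01 k' (fun zs => (Fh s0 zs)%:E))%E.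
  rewrite /hr fineK// ge0_fin_numE; last by apply: (iid_expect_ge0 (normal_prob 0 1)) => z _; rewrite lee_fin /Fh ?g0 ?gK.
  apply: (@le_lt_trans _ _ (iid_expect N01 k' (fun=> K%:E))).
    by apply: (iid_expect_mono (normal_prob 0 1)) => z _; rewrite lee_fin /Fh ?g0 ?gK.
  by rewrite (iid_expect_cst (normal_prob 0 1)) ltry.
have gED : depends_only live (fun s => (gr s)%:E) by move=> s1 s2 ss; congr EFin; exact: gD.
transitivity (expect (sampler (thr i)) (expect (after_head k' (ae i)) (fun s => (gr s)%:E)) s).
  by [].
rewrite (_ : expect (after_head k' (ae i)) _ = fun s => (hr s)%:E); last first.
  by apply/funext => s0; rewrite (expect_after_head (A := A i)) ?hE// => j l s1; exact: aeE.
have Fh10 s0 z zs : Fh (set_real s0 10 z) zs =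
    gr (upd s0 (exceed (reals s0 0) (lin_tuple mu (A i) k'.+1 (z :: zs)))).
  rewrite /Fh /=; apply: gD; apply: agree_upd => j j5 /=.
  by rewrite (live_neq j5).
have hr0 s0 : 0 <= hr s0.
  by rewrite -lee_fin hE; apply: (iid_expect_ge0 (normal_prob 0 1)) => z _; rewrite lee_fin /Fh ?g0 ?gK.
have hrK s0 : hr s0 <= K.
  rewrite -lee_fin hE -[leRHS](iid_expect_cst (normal_prob 0 1) k').
  by apply: (iid_expect_mono (normal_prob 0 1)) => z _; rewrite lee_fin /Fh ?g0 ?gK.
have hrD : depends_only live10 hr.
  move=> s1 s2 ss; congr fine; apply: (eq_iid_expect (normal_prob 0 1)) => zs _.
  rewrite /Fh (ss 0%N)// (ss 10%N)//; congr EFin; apply: gD; apply: agree_upd => j j5.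
  by apply: ss; apply/orP; left.
have mhr : measurable_fun setT (fun z : mR R => hr (set_real s 10 z) : mR R).
  apply/measurable_EFinP.
  apply: eq_measurable_fun (measurable_iid_expect_cons (normal_prob 0 1)
    (fun z => _ : (0 <= (gr (upd s (exceed (reals s 0) (lin_tuple mu (A i) k'.+1 z))))%:E)%E)
    (Fm s)) => [z _|z]; last by rewrite lee_fin.
  by rewrite /= hE; apply: (eq_iid_expect (normal_prob 0 1)) => zs _; rewrite Fh10.
rewrite (expect_sampler (eval_thr i) hrD hr0 hrK mhr).
congr (_ / _)%:E; apply: EFin_inj; rewrite (tail_meanE (th i) s hr0 hrK).
rewrite (sum_joint i (reals s 0) (F := fun v => gr (upd s v)))//=.
apply: eq_integral => z _; rewrite hE indicE mem_setE in_itv/= andbT.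
rewrite -(iid_expectZ (normal_prob 0 1))//.
- by apply: (eq_iid_expect (normal_prob 0 1)) => zs _; rewrite Fh10 -EFinM.
- by move=> zs; rewrite lee_fin /Fh g0.
- have := measurable_tail_cons (F := fun l : seq (mR R) =>
      (gr (upd s (exceed (reals s 0) (lin_tuple mu (A i) k'.+1 l))))%:E) z (Fm s).
    by apply: eq_measurable_fun => zs _; rewrite Fh10.
Qed.

(* Branch [i] is selected with probability proportional to its tail, by
   successive biased coins. *)
Fixpoint choose_branch (i0 : 'I_m.+1) (l : seq 'I_m.+1) : cmd :=
  if l is i :: l' then
    Seq (Gauss 9) (IfLe (signed_Phi (Reg 9))
      (Div (e_tail i0) (sum_expr [seq e_tail j | j <- i0 :: l])) (branch i0) (choose_branch i l'))
  else branch i0.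

(** The coin for [i0] has bias its tail over the sum of the tails still in play. The tail of the
    selected branch cancels the normalisation of its conditional law, which leaves one common
    denominator. *)
Lemma expect_choose_branch (gr : state -> R) (K : R) i0 l s :
  depends_only live gr -> (forall s, 0 <= gr s) -> (forall s, gr s <= K) ->
  expect (choose_branch i0 l) (fun s => (gr s)%:E) s =
  ((\sum_(i <- i0 :: l) \sum_(v < m.+2) gr (upd s v) * joint i (reals s 0) v)
   / \sum_(i <- i0 :: l) tl i (reals s 0))%:E.
Proof.
move=> gD g0 gK.
have inv s0 i z n : \sum_(v < m.+2) gr (upd (tick n (tick 1 (set_real s0 9 z))) v) * joint i (reals s0 0) v
    = \sum_(v < m.+2) gr (upd s0 v) * joint i (reals s0 0) v.
  apply: eq_bigr => v _; congr (_ * _); apply: gD; apply: agree_upd => j j5 /=.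
  by rewrite (live_neq j5).
elim: l i0 s => [|i l IH] i0 s.
  by rewrite (expect_branch _ _ gD g0 gK) !big_seq1.
rewrite [choose_branch i0 (i :: l)]/=.
set T := \sum_(i <- i :: l) tl i (reals s 0).
have T0 : 0 < T.
  rewrite /T big_cons ltr_pwDl ?tl_gt0// big_seq sumr_ge0// => j _; exact: ltW (tl_gt0 _ _).
have t0 := tl_gt0 i0 (reals s 0).
rewrite (expect_bernoulli (p := tl i0 (reals s 0) / (tl i0 (reals s 0) + T))
  (x := (\sum_(v < m.+2) gr (upd s v) * joint i0 (reals s 0) v) / tl i0 (reals s 0))
  (y := (\sum_(i <- i :: l) \sum_(v < m.+2) gr (upd s v) * joint i (reals s 0) v) / T)).
- rewrite !(big_cons _ _ i0) -/T; congr EFin; field.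
  by rewrite !gt_eqF// addr_gt0.
- have tT : 0 < tl i0 (reals s 0) + T by exact: addr_gt0.
  by apply/andP; split; [exact: divr_gt0|rewrite ler_pdivrMr// mul1r lerDl ltW].
- by apply: divr_ge0; [apply: sumr_ge0 => v _; rewrite mulr_ge0// joint_ge0|exact: ltW].
- apply: divr_ge0; [|exact: ltW]; apply: sumr_ge0 => j _; apply: sumr_ge0 => v _.
  by rewrite mulr_ge0// joint_ge0.
- move=> z; set s1 := tick 1 _.
  transitivity (eval s1 (e_tail i0) / eval s1 (sum_expr [seq e_tail j | j <- [:: i0, i & l]])).
    by [].
  rewrite eval_tail eval_sum_expr big_map big_cons eval_tail; congr (_ / (_ + _)).
  by apply: eq_bigr => j _; rewrite eval_tail.
- by move=> z n _; rewrite (expect_branch _ _ gD g0 gK) /= inv.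
- move=> z n; rewrite IH /=; congr (_ / _)%:E.
  by apply: eq_bigr => j _; rewrite inv.
Qed.

End Main.

(** * The loop over the replications *)

Section Replications.
Context {R : realType} {m : nat} (mu : 'I_m.+1 -> R) (C : 'M[R]_m.+1).
Local Notation state := (@Defs.state R m).
Local Notation expect := (@Defs.expect R m mu C).
Local Notation eval := (@Defs.eval R m mu C).
Local Notation expr := (Defs.expr m.+1).
Local Notation cmd := (Defs.cmd m.+1).
Local Notation Lit := Defs.Lit.

Variables (k' : nat) (sg : 'I_m.+1 -> R) (se : 'I_m.+1 -> expr).
Variables (A : 'I_m.+1 -> 'I_m.+1 -> nat -> R) (ae : 'I_m.+1 -> 'I_m.+1 -> nat -> expr).
Hypothesis sgE : forall i s, eval s (se i) = sg i.
Hypothesis aeE : forall i j l s, (l < k'.+1)%N -> eval s (ae i j l) = A i j l.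

Local Notation tail := (tl mu sg).
Local Notation jnt := (joint mu k' sg A).

Definition tail_sum (b : R) : R := \sum_i tail i b.

Lemma tail_sum_gt0 b : 0 < tail_sum b.
Proof.
by rewrite /tail_sum big_ord_recl ltr_pwDl ?tl_gt0// sumr_ge0// => j _; exact: ltW (tl_gt0 _ _ _ _).
Qed.

(* The probability that a replication has exactly [v] coordinates above [b]. *)
Definition count_law (b : R) (v : 'I_m.+2) : R := (\sum_i jnt i b v) / tail_sum b.

Lemma count_law_ge0 b v : 0 <= count_law b v.
Proof.
by apply: divr_ge0; [apply: sumr_ge0 => i _; exact: joint_ge0|exact: ltW (tail_sum_gt0 b)].
Qed.

Lemma sum_count_law b : \sum_v count_law b v = 1.
Proof.
rewrite -mulr_suml exchange_big/= (eq_bigr (fun i => tail i b)); last first.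
  by move=> i _; rewrite sum_joint1.
by rewrite divff// gt_eqF// tail_sum_gt0.
Qed.

Definition replication : cmd :=
  choose_branch k' se ae ord0 [seq lift ord0 i | i <- enum 'I_m].

Lemma expect_replication (gr : state -> R) (K : R) s :
  depends_only live gr -> (forall s, 0 <= gr s) -> (forall s, gr s <= K) ->
  expect replication (fun s => (gr s)%:E) s =
  (\sum_v count_law (reals s 0) v * gr (upd s v))%:E.
Proof.
move=> gD g0 gK; rewrite (expect_choose_branch sgE aeE _ _ _ gD g0 gK) -enum_ordSl !big_enum /=.
congr EFin; rewrite exchange_big/= mulr_suml; apply: eq_bigr => v _.
by rewrite -mulr_sumr /count_law -!mulrA mulrC -mulrA.
Qed.

Definition loop : cmd := WhileLe (Add (Reg 4) (Lit 1)) (Reg 1) replication.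

Fixpoint loop_mean (gr : state -> R) (k : nat) (s : state) : R :=
  if k is k1.+1 then \sum_v count_law (reals s 0) v * loop_mean gr k1 (upd s v) else gr s.

Section LoopMean.
Variables (gr : state -> R) (K : R).
Hypotheses (gD : depends_only live gr) (g0 : forall s, 0 <= gr s) (gK : forall s, gr s <= K).

Lemma loop_mean_ge0 k s : 0 <= loop_mean gr k s.
Proof.
elim: k s => [//|k IH] s /=; apply: sumr_ge0 => v _.
by apply: mulr_ge0 => //; exact: count_law_ge0.
Qed.

Lemma loop_mean_le k s : loop_mean gr k s <= K.
Proof.
elim: k s => [//|k IH] s /=.
apply: (@le_trans _ _ (\sum_v count_law (reals s 0) v * K)).
  by apply: ler_sum => v _; rewrite ler_wpM2l// count_law_ge0.
by rewrite -mulr_suml sum_count_law mul1r.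
Qed.

Lemma loop_mean_live k : depends_only live (loop_mean gr k).
Proof.
elim: k => [//|k IH] s s' ss /=; apply: eq_bigr => v _; rewrite (ss 0%N)//.
by congr (_ * _); apply: IH; exact: agree_upd.
Qed.

(** Counters are stored as reals, so the number of turns left is read off by truncation. It is
    deterministic, hence the supremum of the unfoldings is attained. *)
Lemma expect_loop s :
  expect loop (fun s => (gr s)%:E) s = (loop_mean gr (Num.truncn (reals s 1 - reals s 4)) s)%:E.
Proof.
have K0 : 0 <= K := le_trans (g0 s) (gK s).
pose r (s : state) := Num.truncn (reals s 1 - reals s 4).
pose U (h : state -> \bar R) (s0 : state) :=
  if reals s0 4 + 1 <= reals s0 1 then expect replication h (tick 2 s0) else (gr (tick 2 s0))%:E.
have rS s0 v : (0 < r s0)%N -> r (upd s0 v) = (r s0).-1.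
  rewrite /r /= truncn_gt0 => h.
  have [h1 h2] := andP (truncn_itv (le_trans ler01 h)).
    move: h; rewrite -truncn_gt0; move: h1 h2; case: (Num.truncn _) => // n h1 h2 _.
    by apply: truncn_def; move: h1 h2; rewrite -!natr1; lra.
(* With fewer unfoldings than turns no run terminates and the value is 0; from then on it is the
   full mean. *)
have UE k s0 : iter k.+1 U (fun=> 0%E) s0 = ((r s0 <= k)%N%:R * loop_mean gr (r s0) s0)%:E.
  elim: k s0 => [|k IH] s0.
    rewrite /= /U -lerBrDl -truncn_gt0 -/(r s0) lt0n leqn0; case: eqP => [->|_] /=.
      by rewrite mul1r; congr EFin; apply: gD.
    by rewrite expect0 mul0r.
  rewrite iterS; move: (iter k.+1 U (fun=> 0%E)) IH => W IH.
  rewrite /U -lerBrDl -truncn_gt0 -/(r s0); case: ifPn => h; last first.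
    move: h; rewrite -eqn0Ngt => /eqP ->; rewrite mul1r /=.
    by congr EFin; apply: gD.
  rewrite (_ : W = fun s => ((r s <= k)%N%:R * loop_mean gr (r s) s)%:E); last exact/funext.
  rewrite (expect_replication (K := K)); first last.
  - move=> s1; apply: (le_trans _ (loop_mean_le (r s1) s1)).
    by rewrite ler_piMl ?loop_mean_ge0//; case: (_ <= _)%N.
  - by move=> s1; rewrite mulr_ge0// loop_mean_ge0.
  - move=> s1 s2 ss; have rr : r s1 = r s2 by rewrite /r !ss.
    by rewrite rr; congr (_ * _); exact: loop_mean_live.
  move: h (fun v => rS s0 v); case: (r s0) => // l _ rE.
  rewrite /= mulr_sumr; congr EFin; apply: eq_bigr => v _.
  have -> : upd (tick 2 s0) v = tick 2 (upd s0 v) by [].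
  have -> : r (tick 2 (upd s0 v)) = l by exact: rE.
  rewrite ltnS mulrCA; congr (_ * (_ * _)); exact: loop_mean_live.
transitivity (ereal_sup (range (fun k => iter k U (fun=> 0%E) s))); first by [].
apply/eqP; rewrite eq_le; apply/andP; split.
  apply: ge_ereal_sup => _ [[|k] _ <-]; first by rewrite lee_fin loop_mean_ge0.
  by rewrite UE lee_fin ler_piMl ?loop_mean_ge0//; case: (_ <= _)%N.
by apply: ereal_sup_ubound; exists (r s).+1 => //; rewrite UE leqnn mul1r.
Qed.

End LoopMean.

Lemma loop_mean_dexp (gr : state -> R) (F : R -> R) k s :
  (forall s', reals s' 0 = reals s 0 -> reals s' 1 = reals s 1 -> reals s' 2 = reals s 2 ->
     gr s' = F (reals s' 3)) ->
  loop_mean gr k s =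
  dexp (count_law (reals s 0)) (fun v : 'I_m.+2 => reals s 2 / v%:R) k F (reals s 3).
Proof.
elim: k s => [|k IH] s gF /=; first exact: gF.
by apply: eq_bigr => v _; rewrite IH.
Qed.

(** The counter ends at [n] with probability one, which is what bounds the cost from below. *)
Lemma loop_mean_counter (n k : nat) (s : state) : reals s 4 + k%:R = n%:R ->
  loop_mean (fun s => if reals s 4 == n%:R then n%:R else 0) k s = n%:R.
Proof.
elim: k s => [|k IH] s /=; first by rewrite addr0 => ->; rewrite eqxx.
move=> sn; rewrite (eq_bigr (fun v => count_law (reals s 0) v * n%:R)).
  by rewrite -mulr_suml sum_count_law mul1r.
by move=> v _; rewrite IH//= -addrA nat1r.
Qed.

Definition main : cmd :=
  Seq (Assign 2 (sum_expr [seq e_tail se j | j <- enum 'I_m.+1]))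
    (Seq loop (Assign 0 (Div (Reg 3) (Reg 1)))).

Lemma output_law_main (b : R) (n : nat) (B : set R) :
  output_law mu C main b n B =
  (dexp (count_law b) (fun v : 'I_m.+2 => tail_sum b / v%:R) n (fun y => \1_B (y / n%:R)) 0)%:E.
Proof.
pose s0 : state := init_state b n.
pose e := sum_expr [seq e_tail se j | j <- enum 'I_m.+1].
pose s1 := tick (ops e) (set_real s0 2 (eval s0 e)).
pose gr (s : state) : R := \1_B (reals s 3 / reals s 1).
transitivity (expect loop (fun s => (gr s)%:E) s1); first by [].
rewrite (expect_loop (K := 1)); first last.
- by move=> s; rewrite /gr indicE lern1 leq_b1.
- by move=> s; rewrite /gr indicE.
- by move=> s s' ss; rewrite /gr !ss.
have -> : Num.truncn (reals s1 1 - reals s1 4) = n by rewrite /= subr0 natrK.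
rewrite (loop_mean_dexp (F := fun y => \1_B (y / n%:R))); last first.
  by move=> s' _ E1 _; rewrite /gr E1.
have -> // : reals s1 2 = tail_sum b.
rewrite -[LHS]/(eval s0 e) eval_sum_expr big_map big_enum; apply: eq_bigr => j _.
exact: eval_tail.
Qed.

End Replications.

(** * The procedure as a discrete law *)

Section FieldVector.
Context {d : measure_display} {Omega : measurableType d} {R : realType}.
Context (P : probability Omega R) {m : nat} (f : 'I_m.+1 -> {RV P >-> R}).
Local Notation X := (field_vector f).

Lemma measurable_field_vector :
  measurable_fun setT (X : Omega -> m.+1.-tuple (mR R)).
Proof.
apply/measurable_fun_tnthP => i /=.
rewrite (_ : _ \o _ = f i); first exact: (measurable_funPT (f i)).
by apply/funext => t /=; rewrite tnth_mktuple.
Qed.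

Lemma measurable_vec_preimage (B : set (m.+1.-tuple (mR R))) :
  measurable B -> measurable (X @^-1` B).
Proof. by move=> mB; rewrite -[_ @^-1` _]setTI; exact: measurable_field_vector. Qed.

Lemma measurable_exceed_at (i : 'I_m.+1) (b : R) :
  measurable [set x : m.+1.-tuple (mR R) | b < tnth x i].
Proof.
have := @measurable_tnth _ (mR R) m.+1 i measurableT _ (measurable_gt b).
by rewrite setTI.
Qed.

Lemma exceed_setE i b : [set omega | b < f i omega] = X @^-1` [set x | b < tnth x i].
Proof. by apply/seteqP; split => w /=; rewrite tnth_mktuple. Qed.

Lemma measurable_field_gt i b : measurable [set omega | b < f i omega].
Proof.
by rewrite exceed_setE; apply: measurable_vec_preimage; exact: measurable_exceed_at.
Qed.

Lemma field_max_gt b omega : (b < field_max f omega) = (0 < exceed b (X omega))%N.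
Proof.
apply/idP/idP => [|]; last first.
  rewrite /exceed lt0n sum_nat_eq0 negb_forall => /existsP[i].
  rewrite tnth_mktuple eqb0 negbK => /lt_le_trans; apply.
  exact: le_bigmax.
apply: contraTT; rewrite -leqNgt leqn0 -leNgt /exceed sum_nat_eq0 => /forallP h.
have hi i : f i omega <= b by move: (h i); rewrite tnth_mktuple eqb0 -leNgt.
by apply/bigmax_leP; split.
Qed.

Section Proposal.
Variable b : R.

Lemma proposal0 : proposal f b set0 = 0%E.
Proof. by rewrite /proposal big1// => i _; rewrite preimage_set0 set0I measure0 mul0r mulr0. Qed.

Lemma tail_prob_ge0 i : 0 <= tail_prob f i b. Proof. exact: fine_ge0. Qed.

Lemma mix_weight_ge0 i : 0 <= mix_weight f i b.
Proof. by apply: divr_ge0; [|apply: sumr_ge0 => j _]; exact: tail_prob_ge0. Qed.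

Lemma proposal_ge0 B : (0 <= proposal f b B)%E.
Proof.
rewrite lee_fin; apply: sumr_ge0 => i _; apply: mulr_ge0; first exact: mix_weight_ge0.
by apply: divr_ge0; [exact: fine_ge0|exact: tail_prob_ge0].
Qed.

(** [proposal] is a finite combination of restrictions of [P]. It is turned into a measure so that
    the integration lemmas apply to [iid_expect (proposal f b)]. *)
Lemma proposal_sigma_additive : semi_sigma_additive (proposal f b).
Proof.
move=> F mF tF mUF.
pose G i B := fine (P (X @^-1` B `&` [set omega | b < f i omega])).
have cG i : (\sum_(0 <= j < n) G i (F j)) @[n --> \oo] --> G i (\bigcup_j F j).
  have mG B : measurable B -> measurable (X @^-1` B `&` [set omega | b < f i omega]).
    by move=> mB; apply: measurableI; [exact: measurable_vec_preimage|exact: measurable_field_gt].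
  have := @measure_semi_sigma_additive _ _ _ P
    (fun j => X @^-1` F j `&` [set omega | b < f i omega]).
  rewrite -setI_bigcupl -preimage_bigcup => /(_ (fun j => mG _ (mF j))) H.
  have {}H : (\sum_(0 <= j < n) P (X @^-1` F j `&` [set omega | (b < f i omega)%R]) @[n --> \oo] -->
      (G i (\bigcup_j F j))%:E)%E.
    rewrite /G fineK; last by apply: fin_num_measure; exact: mG.
    apply: H; last exact: mG.
    apply/trivIsetP => j1 j2 _ _ j12; apply/seteqP; split => // w /= -[[h1 _] [h2 _]].
    by have /trivIsetP/(_ j1 j2 I I j12)/seteqP[+ _] := tF; apply; split; [exact: h1|exact: h2].
  rewrite (_ : (fun n => _) = fine \o (fun n => \sum_(0 <= j < n)
    P (X @^-1` F j `&` [set omega | (b < f i omega)%R]))%E); first exact: fine_cvg H.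
  by apply/funext => n; rewrite /= -sum_fine// => j _; apply: fin_num_measure; exact: mG.
rewrite /proposal.
rewrite (_ : (fun n => _) = (fun n => (\sum_(i < m.+1) mix_weight f i b *
   ((\sum_(0 <= j < n) G i (F j)) / tail_prob f i b))%:E)); last first.
  apply/funext => n; rewrite sumEFin; congr EFin; rewrite exchange_big; apply: eq_bigr => i _.
  by rewrite mulr_suml mulr_sumr.
apply: cvg_EFin; first by near=> n.
rewrite /comp /=; apply: cvg_big => [|i _]; first exact: add_continuous.
apply: cvgM; first exact: cvg_cst.
by apply: cvgM; [exact: cG|exact: cvg_cst].
Unshelve. all: by end_near. Qed.

HB.instance Definition _ := isMeasure.Build _ _ _ (proposal f b)
  proposal0 proposal_ge0 proposal_sigma_additive.

(* The weights only depend on the number of coordinates exceeding [b]. *)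
Lemma integral_proposal (G : nat -> R) : (forall v, 0 <= G v) ->
  (\int[proposal f b]_x (G (exceed b x))%:E =
   \sum_(v < m.+2) (G v)%:E * proposal f b [set x | exceed b x = v])%E.
Proof.
move=> G0.
have mE v := measurable_exceed (M := m) b v.
transitivity (\int[proposal f b]_x \sum_(v < m.+2) (G v)%:E * (\1_[set x | exceed b x = v] x)%:E)%E.
  apply: eq_integral => x _; rewrite (bigD1 (Ordinal (exceed_le b x)))//= big1 ?adde0.
    by rewrite indicE mem_set// mule1.
  move=> v ve; rewrite indicE memNset ?mule0//= => ev; case/eqP: ve; exact/val_inj/esym.
rewrite ge0_integral_sum//.
- apply: eq_bigr => v _; rewrite ge0_integralZl//.
  + by rewrite integral_indic// setIT.
  + by apply: measurable_EFin_indic.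
  + by rewrite lee_fin.
- by move=> v; apply: emeasurable_funM => //; exact: measurable_EFin_indic.
- by move=> v x _; rewrite mule_ge0// lee_fin.
Qed.

End Proposal.
End FieldVector.

Section Mixture.
Context {d : measure_display} {Omega : measurableType d} {R : realType}.
Context (P : probability Omega R) {m : nat} (f : 'I_m.+1 -> {RV P >-> R}).
Local Notation X := (field_vector f).
Local Notation N01 := (normal_prob 0 1 : set (mR R) -> \bar R).
Variables (mu : 'I_m.+1 -> R) (k' : nat) (sg : 'I_m.+1 -> R).
Variables (A : 'I_m.+1 -> 'I_m.+1 -> nat -> R).
Hypothesis sg0 : forall i, 0 < sg i.
Hypothesis A_head : forall i l, (l < k'.+1)%N -> A i i l = if l == 0%N then sg i else 0.
Hypothesis lawA : forall i (B : set (m.+1.-tuple (mR R))), measurable B ->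
  P (X @^-1` B) = iid_expect N01 k'.+1 (fun z => (\1_B (lin_tuple mu (A i) k'.+1 z))%:E).

Local Notation tail := (tl mu sg).
Local Notation jnt := (joint mu k' sg A).
Local Notation tail_sum := (tail_sum mu sg).
Local Notation count_law := (count_law mu k' sg A).

Lemma lin_head i z : lin (A i) k'.+1 z i = sg i * z`_0.
Proof.
rewrite /lin big_ord_recl A_head//= big1 ?addr0// => l _.
by rewrite A_head ?mul0r// ltnS.
Qed.

Lemma lin_tuple_gt i b z :
  (b < tnth (lin_tuple mu (A i) k'.+1 z) i) = (th mu sg i b < z`_0).
Proof.
by rewrite tnth_mktuple lin_head /th ltr_pdivrMr// ltrBlDl [z`_0 * _]mulrC.
Qed.

Lemma prob_joint i b v :
  P (X @^-1` [set x | exceed b x = v] `&` [set omega | (b < f i omega)%R]) = (jnt i b v)%:E.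
Proof.
rewrite exceed_setE -preimage_setI (lawA i); last first.
  by apply: measurableI; [exact: measurable_exceed|exact: measurable_exceed_at].
rewrite joint_fin; apply: (eq_iid_expect (normal_prob 0 1)) => z _.
rewrite /hit -lin_tuple_gt indicE; congr ((nat_of_bool _)%:R%:E).
apply/idP/idP => [|/andP[h1 /eqP h2]]; first by rewrite inE => -[/= -> ->]; rewrite eqxx.
by apply/mem_set; split.
Qed.

Lemma prob_tail i b : P [set omega | b < f i omega] = (tail i b)%:E.
Proof.
rewrite exceed_setE (lawA i); last exact: measurable_exceed_at.
rewrite -(sum_joint1 mu k' sg A i b).
rewrite (_ : \sum_(v < m.+2) _ = \sum_(v < m.+2) 1 * jnt i b v); last first.
  by apply: eq_bigr => v _; rewrite mul1r.
rewrite (sum_joint mu k' sg A i b (F := fun=> 1))//.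
apply: (eq_iid_expect (normal_prob 0 1)) => z _.
by rewrite -(lin_tuple_gt i b z) mulr1 indicE mem_setE.
Qed.

Lemma tail_probE i b : tail_prob f i b = tail i b.
Proof. by rewrite /tail_prob prob_tail. Qed.

Lemma proposal_count b (v : 'I_m.+2) :
  proposal f b [set x | exceed b x = v] = (count_law b v)%:E.
Proof.
rewrite /proposal /count_law; congr EFin; rewrite mulr_suml; apply: eq_bigr => i _.
rewrite prob_joint /mix_weight tail_probE.
have -> : \sum_(j < m.+1) tail_prob f j b = tail_sum b by apply: eq_bigr => j _; rewrite tail_probE.
rewrite /=; field.
by apply/andP; split; rewrite gt_eqF ?tl_gt0 ?tail_sum_gt0.
Qed.

Lemma iid_expect_proposal b n (F : R -> R) a : (forall y, 0 <= F y) ->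
  (iid_expect (proposal f b) n (fun xs => (F (a + \sum_(x <- xs) weight f b x))%:E) =
   (dexp (count_law b) (fun v : 'I_m.+2 => tail_sum b / v%:R) n F a)%:E)%E.
Proof.
move=> F0; elim: n a => [|n IH] a /=; first by rewrite big_nil addr0.
pose G v := dexp (count_law b) (fun v : 'I_m.+2 => tail_sum b / v%:R) n F (a + tail_sum b / v%:R).
transitivity (\int[proposal f b]_x (G (exceed b x))%:E)%E.
  apply: eq_integral => x _; rewrite /G -IH.
  congr (iid_expect _ _ _); apply/funext => xs; rewrite big_cons addrA.
  congr (F (_ + _ / _ + _))%:E; apply: eq_bigr => j _; exact: tail_probE.
rewrite integral_proposal; last first.
  move=> v; apply: dexp_ge0 => //; first exact: count_law_ge0.
  exact: sum_count_law.
rewrite -sumEFin; apply: eq_bigr => v _.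
by rewrite proposal_count -EFinM mulrC.
Qed.

Lemma Afin_law_dexp b n (B : set R) :
  Afin_law f b n B =
  (dexp (count_law b) (fun v : 'I_m.+2 => tail_sum b / v%:R) n (fun y => \1_B (y / n%:R)) 0)%:E.
Proof.
rewrite -iid_expect_proposal; last by move=> y; rewrite indicE.
by congr (iid_expect _ _ _); apply/funext => xs; rewrite add0r /averaged_estimator mulrC.
Qed.

(** Unbiasedness of the weights: if e > 0 coordinates exceed [b], each of them contributes 1/e and
    together they give 1; if none does, nothing is contributed. Integrating this double sum over
    counts and coordinates yields the joint probabilities. *)
Lemma prob_field_max b : P [set omega | b < field_max f omega] =
  (\sum_(v < m.+2) count_law b v * (tail_sum b / v%:R))%:E.
Proof.
have mE (v : 'I_m.+2) i : measurable (X @^-1` [set x | exceed b x = v] `&` [set omega | b < f i omega]).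
  apply: measurableI; [apply: measurable_vec_preimage; exact: measurable_exceed|exact: measurable_field_gt].
have mM : measurable [set omega | b < field_max f omega].
  rewrite (_ : [set _ | _] = ~` (X @^-1` [set x | exceed b x = 0%N])).
    apply: measurableC; apply: measurable_vec_preimage; exact: measurable_exceed.
  apply/seteqP; split => w /=; rewrite field_max_gt lt0n; first by move/eqP.
  by move=> h; apply/eqP.
pose D (v : 'I_m.+2) i := X @^-1` [set x | exceed b x = v] `&` [set omega | b < f i omega].
have DE (v : 'I_m.+2) i w : \1_(D v i) w = (exceed b (X w) == v)%:R * (b < f i w)%R%:R :> R.
  rewrite indicE -natrM mulnb; congr ((nat_of_bool _)%:R); apply/idP/idP => [|/andP[/eqP h1 h2]].
    by rewrite inE => -[/= -> ->]; rewrite eqxx.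
  by apply/mem_set; split.
transitivity (\int[P]_w \sum_(p : 'I_m.+2 * 'I_m.+1) (p.1%:R^-1)%:E * (\1_(D p.1 p.2) w)%:E)%E.
  rewrite -[LHS]/(P [set omega | b < field_max f omega]) -[X in P X]setIT -integral_indic//.
  apply: eq_integral => w _; rewrite indicE.
  have -> : (w \in [set omega | b < field_max f omega]) = (0 < exceed b (X w))%N.
    by rewrite -field_max_gt; apply/idP/idP; rewrite inE.
  rewrite (eq_bigr (fun p : 'I_m.+2 * 'I_m.+1 => (p.1%:R^-1 * ((exceed b (X w) == p.1)%:R * (b < f p.2 w)%R%:R))%:E)).
    rewrite sumEFin; congr EFin.
    rewrite -(pair_bigA _ (fun (v : 'I_m.+2) i => v%:R^-1 * ((exceed b (X w) == v)%:R * (b < f i w)%R%:R)))/=.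
    rewrite (bigD1 (Ordinal (exceed_le b (X w))))//= [X in _ + X]big1 ?addr0.
      rewrite -mulr_sumr eqxx; under eq_bigr do rewrite mul1r.
      rewrite -natr_sum (_ : (\sum_(i < m.+1) (b < f i w)%R)%N = exceed b (X w)); last first.
        by apply: eq_bigr => i _; rewrite tnth_mktuple.
      by case: (exceed b (X w)) => [|e]; rewrite ?mulr0// mulVf// pnatr_eq0.
    move=> v ve; rewrite big1// => i _; rewrite (_ : (exceed _ _ == v :> nat) = false) ?mul0r ?mulr0//.
    by apply/eqP => ev; case/eqP: ve; exact: val_inj.
  by move=> p _; rewrite -EFinM DE.
rewrite ge0_integral_sum//; first last.
- move=> p; apply: emeasurable_funM; first exact: measurable_cst.
  by apply: measurable_EFin_indic; exact: mE.
rewrite (eq_bigr (fun p : 'I_m.+2 * 'I_m.+1 => (p.1%:R^-1 * jnt p.2 b p.1)%:E)); last first.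
  move=> p _; rewrite ge0_integralZl ?lee_fin//; last by apply: measurable_EFin_indic; exact: mE.
  have -> : (\int[P]_x (\1_(D p.1 p.2) x)%:E = (jnt p.2 b p.1)%:E)%E.
    by rewrite integral_indic ?setIT//; [exact: prob_joint|exact: mE].
  by rewrite -EFinM.
rewrite sumEFin -(pair_bigA _ (fun (v : 'I_m.+2) i => v%:R^-1 * jnt i b v))/=; congr EFin.
apply: eq_bigr => v _; rewrite -mulr_sumr /count_law [_ / v%:R]mulrC mulrCA; congr (_ * _).
by rewrite divfK// gt_eqF// tail_sum_gt0.
Qed.

Lemma excursion_probE b :
  excursion_prob f b = \sum_(v < m.+2) count_law b v * (tail_sum b / v%:R).
Proof. by rewrite /excursion_prob prob_field_max. Qed.

Lemma weight_le b (v : nat) : 0 <= tail_sum b / v%:R <= tail_sum b.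
Proof.
have S0 := tail_sum_gt0 mu sg b.
(* A count of 0 gives weight 0, as division by 0 is 0, and this respects the bounds. *)
rewrite divr_ge0 ?(ltW S0)//=; case: v => [|v]; first by rewrite invr0 mulr0 ltW.
by rewrite ler_pdivrMr// ler_peMr ?ler1n// ltW.
Qed.

Lemma excursion_prob_le b : excursion_prob f b <= tail_sum b.
Proof.
rewrite excursion_probE; apply: (@le_trans _ _ (\sum_(v < m.+2) count_law b v * tail_sum b)).
  apply: ler_sum => v _; rewrite ler_wpM2l ?count_law_ge0//.
  by have /andP[] := weight_le b v.
by rewrite -mulr_suml sum_count_law mul1r.
Qed.

Lemma tail_sum_le b : tail_sum b <= m.+1%:R * excursion_prob f b.
Proof.
rewrite -[m.+1]card_ord mulr_natl -sumr_const; apply: ler_sum => i _.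
rewrite -lee_fin -prob_tail /excursion_prob fineK; last by rewrite prob_field_max.
apply: le_measure; rewrite ?inE; first exact: measurable_field_gt.
  rewrite (_ : [set _ | _] = ~` (X @^-1` [set x | exceed b x = 0%N])).
    apply: measurableC; apply: measurable_vec_preimage; exact: measurable_exceed.
  apply/seteqP; split => w /=; rewrite field_max_gt lt0n; first by move/eqP.
  by move=> h; apply/eqP.
by move=> w /= h; apply: lt_le_trans h _; exact: le_bigmax.
Qed.

Lemma excursion_prob_gt0 b : 0 < excursion_prob f b.
Proof.
by have := lt_le_trans (tail_sum_gt0 mu sg b) (tail_sum_le b); rewrite pmulr_rgt0.
Qed.

Lemma excursion_prob_cvg0 : excursion_prob f b @[b --> +oo] --> 0.
Proof.
apply: (@squeeze_cvgr _ _ _ _ (fun=> 0) tail_sum).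
- by near=> b; rewrite ltW ?excursion_prob_gt0//= excursion_prob_le.
- exact: cvg_cst.
rewrite (_ : 0 = \sum_(i < m.+1) (0 : R)); last by rewrite big1.
apply: cvg_big => [|i _]; first exact: add_continuous.
rewrite -(subrr 1); apply: cvgB; first exact: cvg_cst.
apply: (cvg_comp _ _ _ normal_cdf_cvg1).
apply/cvgryPge => B; near=> b.
by rewrite /th ler_pdivlMr// lerBrDr; near: b; apply: nbhs_pinfty_ge; exact: num_real.
Unshelve. all: by end_near. Qed.

(* The weights are at most [tail_sum b <= M * w], hence so is their standard deviation. *)
Lemma Afin_accuracy b n (eps delta : R) : (0 < n)%N -> 0 < eps -> 
  m.+1%:R ^+ 2 <= n%:R * eps ^+ 2 * delta ->
  ((1 - delta)%:E <=
    Afin_law f b n [set y | `|y - excursion_prob f b| <= eps * excursion_prob f b]%R)%E.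
Proof.
move=> n0 e0 nM; rewrite Afin_law_dexp lee_fin.
have w0 := excursion_prob_gt0 b; have S0 := tail_sum_gt0 mu sg b.
have q0 := count_law_ge0 mu k' sg A b.
have q1 := sum_count_law mu k' sg A b.
set w := excursion_prob f b; rewrite -/w in w0.
pose val (v : 'I_m.+2) := tail_sum b / v%:R.
have wE : w = \sum_v count_law b v * val v := excursion_probE b.
have := @dexp_chebyshev R 'I_m.+2 (count_law b) val q0 q1 n eps n0 e0.
rewrite -wE => /(_ w0) H; apply: (le_trans (le_trans _ H)); last first.
  apply: dexp_mono => // y; rewrite indicE [y / _]mulrC.
  by case: (boolP (`|n%:R^-1 * y - w| <= eps * w)) => h; [rewrite mem_set|rewrite ler0n].
have V := variance_le q0 q1 (val := val) (K := tail_sum b) (fun v => weight_le b v).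
rewrite -wE in V.
have nR : 0 < n%:R :> R by rewrite ltr0n.
rewrite lerD2l lerN2 ler_pdivrMr; last by rewrite mulr_gt0// exprn_gt0// mulr_gt0.
apply: (le_trans V); apply: (@le_trans _ _ ((m.+1%:R * w) ^+ 2)).
  apply: lerXn2r; rewrite ?nnegrE ?(ltW S0)//; first by rewrite mulr_ge0// ltW.
  exact: tail_sum_le.
have -> : delta * (n%:R * (eps * w) ^+ 2) = (n%:R * eps ^+ 2 * delta) * w ^+ 2 by ring.
by rewrite exprMn ler_wpM2r// sqr_ge0.
Qed.

End Mixture.

(** * Moments of the field *)

Section NormalMoments.
Context {R : realType}.
Local Notation lam := (@lebesgue_measure R).
Local Notation N01 := (normal_prob 0 1 : set (mR R) -> \bar R).

Let g (x : R) : R := expR (- (x ^+ 2 / 2)).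

Let g_is_derive (x : R) : is_derive x (1 : R) (fun x => - g x) (x * g x).
Proof.
have h1 : is_derive x (1 : R) (fun x : R => - (x ^+ 2 / 2)) (- x).
  have h := is_deriveN (is_deriveM (is_deriveX 2 (is_derive_id x (1 : R))) (is_derive_cst (2^-1 : R) x (1 : R))).
  by apply: (is_derive_eq h); rewrite expr1 /= /GRing.scale/=; field.
have h := is_deriveN (@is_derive1_comp R expR (fun x : R => - (x ^+ 2 / 2)) x _ _ (is_derive_expR (- (x ^+ 2 / 2))) h1).
by apply: (is_derive_eq h); rewrite /g /GRing.scale/=; ring.
Qed.

Let g_continuous : continuous g.
Proof.
move=> x; apply: (cvg_comp (fun u : R => - (u ^+ 2 / 2)) expR); last exact: continuous_expR.
by apply: cvgN; apply: cvgM; [exact: exprn_continuous|exact: cvg_cst].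
Qed.

Let g_cvg0 : - g x @[x --> +oo] --> (0 : R).
Proof.
rewrite -oppr0; apply: cvgN.
apply: (cvg_comp (fun u : R => u ^+ 2 / 2) (fun y => expR (- y))); last exact: cvgr_expR.
apply: (@ger_cvgy _ _ _ _ id); last exact: cvg_id.
near=> x; rewrite ler_pdivlMr// expr2 ler_wpM2l//; near: x; apply: nbhs_pinfty_ge; exact: num_real.
Unshelve. all: by end_near. Qed.

Lemma gauss_tail_mean (y : R) : 0 <= y ->
  (\int[lam]_(x in `[y, +oo[) (x * g x)%:E = (g y)%:E)%E.
Proof.
move=> y0; rewrite (@ge0_continuous_FTC2y _ _ (fun x => - g x) y 0).
- by rewrite sub0e EFinN oppeK.
- by move=> x yx; rewrite mulr_ge0 ?expR_ge0// (le_trans y0).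
- by apply: continuous_subspaceT => x; apply: cvgM; [exact: cvg_id|exact: g_continuous].
- exact: g_cvg0.
- by move=> x _; have [] := g_is_derive x.
- by apply: cvg_at_right_filter; apply: cvgN; exact: g_continuous.
- by move=> x _; rewrite derive1E; have := g_is_derive x => h; exact: derive_val.
Qed.

Let pk : R := normal_peak 1.

(** In place of an integration by parts, the order of integration is exchanged: on the half-line the
    second moment is the integral over y of the tail means from y, which [gauss_tail_mean] evaluates
    to the density up to its peak. *)
Lemma normal_sqr : (\int[N01]_x (x ^+ 2)%:E = 1)%E.
Proof.
have pk0 : 0 <= pk by exact: normal_peak_ge0.
have msqr : measurable_fun setT (fun x : mR R => (x ^+ 2)%:E).
  by apply/measurable_EFinP; exact: measurable_funX.
rewrite ge0_integral_normal//; last by move=> x; rewrite lee_fin sqr_ge0.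
have [mg gC] : measurable_fun setT (g : mR R -> mR R) /\ continuous g.
  by split; [exact: continuous_measurable_fun|].
pose h (x : R) := x ^+ 2 * (pk * g x).
transitivity (\int[lam]_x (h x)%:E)%E.
  by apply: eq_integral => x _; rewrite normal_pdf01E -EFinM.
have hC : continuous h.
  move=> x; apply: cvgM; first exact: exprn_continuous.
  by apply: cvgM; [exact: cvg_cst|exact: gC].
have symh : (\int[lam]_x (h x)%:E = 2%:E * \int[lam]_(x in `[0%R, +oo[) (h x)%:E)%E.
  rewrite set_itvcy; apply: ge0_symfun_integralT => //.
  - by move=> x; rewrite mulr_ge0 ?sqr_ge0// mulr_ge0// expR_ge0.
  - by move=> x; rewrite /h /g /= !sqrrN.
have symg : (\int[lam]_x (pk * g x)%:E = 2%:E * \int[lam]_(x in `[0%R, +oo[) (pk * g x)%:E)%E.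
  rewrite set_itvcy; apply: ge0_symfun_integralT => //.
  - by move=> x; rewrite mulr_ge0// expR_ge0.
  - by move=> x; apply: cvgM; [exact: cvg_cst|exact: gC].
  - by move=> x; rewrite /g /= sqrrN.
have <- : (\int[lam]_x (pk * g x)%:E = 1)%E.
  by rewrite -(integral_normal_pdf 0 1); apply: eq_integral => x _; rewrite normal_pdf01E.
rewrite symh symg; congr (_ * _)%E.
pose I (x : R) : R := \1_`[0%R, +oo[ x.
(* One factor x is written as the length of the interval 0 <= y <= x. *)
pose K (p : mR R * mR R) := (pk * (p.1 * g p.1) * (I p.2 * I (p.1 - p.2)))%:E.
have mI : measurable_fun setT (I : mR R -> mR R) by exact: measurable_indic.
have mK : measurable_fun setT K.
  apply/measurable_EFinP; apply: measurable_funM; first apply: measurable_funM => //.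
    apply: measurable_funM => //.
    by apply: (@measurableT_comp _ _ _ _ _ _ (g : mR R -> mR R) _ (fst : mR R * mR R -> mR R)).
  apply: measurable_funM.
    by apply: (@measurableT_comp _ _ _ _ _ _ (I : mR R -> mR R) _ (snd : mR R * mR R -> mR R)).
  apply: (@measurableT_comp _ _ _ _ _ _ (I : mR R -> mR R) _ (fun p : mR R * mR R => p.1 - p.2 : mR R)) => //.
  exact: measurable_funB.
have IE (x y : R) : I y * I (x - y) = \1_`[0, x] y.
  by rewrite /I !indicE !mem_setE !in_itv/= !andbT subr_ge0 -natrM mulnb.
have K0 p : (0 <= K p)%E.
  rewrite lee_fin; have := IE p.1 p.2; rewrite indicE => ->.
  case: (boolP (_ \in _)) => [|_]; rewrite ?mulr0// mulr1.
  rewrite inE /= in_itv/= => /andP[h1 h2].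
  by rewrite !mulr_ge0 ?expR_ge0// (le_trans h1).
transitivity (\int[lam]_x \int[lam]_y K (x, y))%E.
  rewrite integral_mkcond; apply: eq_integral => x _; rewrite patchE.
  transitivity (\int[lam]_y ((pk * (x * g x))%:E * (\1_`[0, x] y)%:E))%E; last first.
    by apply: eq_integral => y _; rewrite /K /= IE EFinM.
  case: ifPn; rewrite mem_setE in_itv/= andbT => x0.
    rewrite ge0_integralZl// ?lee_fin; last 2 first.
    - by apply: measurable_EFin_indic.
    - by rewrite !mulr_ge0// expR_ge0.
    rewrite (_ : (\int[lam]_y (\1_`[0%R, x] y)%:E)%E = lam `[0%R, x]%classic); last first.
      by rewrite integral_indic// setIT.
    rewrite lebesgue_measure_itv/= lte_fin.
    move: x0; rewrite le_eqVlt => /predU1P[<-|x0].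
      by rewrite ltxx mule0 /h expr0n mul0r.
    by rewrite x0 -EFinB -EFinM subr0 /h; congr EFin; ring.
  rewrite integral0_eq// => y _; rewrite indicE memNset ?mule0//= in_itv/= => /andP[h1 h2].
  by move: x0; rewrite (le_trans h1 h2).
rewrite (fubini_tonelli K)// [in RHS]integral_mkcond; apply: eq_integral => y _; rewrite patchE.
transitivity (\int[lam]_x ((I y * pk)%:E * ((x * g x) * I (x - y))%:E))%E.
  by apply: eq_integral => x _; rewrite /K /= -EFinM; congr EFin; ring.
rewrite mem_setE in_itv/= andbT; case: ifPn => y0; last first.
  rewrite integral0_eq// => x _.
  by rewrite /I indicE memNset ?mul0r ?mul0e//= in_itv/= andbT; exact/negP.
rewrite /I indicE mem_set ?mul1r; last by rewrite /= in_itv/= y0.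
rewrite EFinM -gauss_tail_mean// [in RHS]integral_mkcond -ge0_integralZl//.
- apply: eq_integral => x _; congr (_ * _)%E; rewrite patchE mem_setE in_itv/= andbT.
  rewrite indicE mem_setE in_itv/= andbT subr_ge0.
  by case: (_ <= _); rewrite ?mulr1 ?mulr0.
- apply/measurable_restrict => //; rewrite ?setTI; apply: measurable_funTS.
  by apply/measurable_EFinP; exact: measurable_funM.
- move=> x _; rewrite patchE mem_setE in_itv/= andbT; case: ifPn => // yx.
  by rewrite lee_fin mulr_ge0 ?expR_ge0// (le_trans y0).
Qed.

(** The triangular form of a single row has one nonnegative entry, the norm of the row; [1 < k]
    provides the rotation that fixes its sign. *)
Lemma iid_expect_lin k (a : nat -> R) (c : R) (G : mR R -> \bar R) : (1 < k)%N ->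
  measurable_fun setT G -> (forall x, 0 <= G x)%E ->
  iid_expect N01 k (fun z => G (c + \sum_(l < k) a l * z`_l)%R) =
  (\int[N01]_x G (c + Num.sqrt (\sum_(l < k) a l ^+ 2) * x)%R)%E.
Proof.
move=> k1 mG G0.
have [B [lawB gramB B0 Bge]] :=
  gaussian_lq (fun _ : 'I_1 => c) (fun _ => a) (fun=> ord0) k1.
have mPsi : measurable_fun setT (fun x : 1.-tuple (mR R) => G (tnth x ord0)).
  by apply: (@measurableT_comp _ _ _ _ _ _ G _ (fun x : 1.-tuple (mR R) => tnth x ord0 : mR R)) => //; exact: measurable_tnth.
have := lawB _ (fun=> G0 _) mPsi.
have linE (A : 'I_1 -> nat -> R) z : tnth (lin_tuple (fun=> c) A k z) ord0 = c + \sum_(l < k) A ord0 l * z`_l.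
  by rewrite tnth_mktuple.
under eq_iid_expect do rewrite linE.
move=> ->; case: k k1 lawB gramB B0 Bge {mPsi linE} => // k k1 _ gramB B0 Bge.
have Bl (l : 'I_k) : B ord0 (lift ord0 l) = 0.
  by apply: (B0 0%N) => //; rewrite lift0 /= ltnS.
have sB : Num.sqrt (\sum_(l < k.+1) a l ^+ 2) = B ord0 0%N.
  transitivity (Num.sqrt (gram k.+1 B ord0 ord0)).
    by rewrite gramB /gram; congr Num.sqrt; apply: eq_bigr => l _; rewrite expr2.
  rewrite /gram big_ord_recl big1 ?addr0; first by rewrite -expr2 sqrtr_sqr ger0_norm// (Bge 0%N).
  by move=> l _; rewrite Bl mul0r.
rewrite sB /=; apply: eq_integral => x _.
rewrite -[RHS](iid_expect_cst (normal_prob 0 1) k); apply: (eq_iid_expect (normal_prob 0 1)) => z _.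
rewrite tnth_mktuple /lin big_ord_recl big1 ?addr0// => l _.
by rewrite Bl mul0r.
Qed.

End NormalMoments.

Section Moments.
Context {d : measure_display} {Omega : measurableType d} {R : realType}.
Context (P : probability Omega R) {m : nat} (f : 'I_m.+1 -> {RV P >-> R}).
Local Notation X := (field_vector f).
Local Notation N01 := (normal_prob 0 1 : set (mR R) -> \bar R).
Variables (mu : 'I_m.+1 -> R) (k : nat) (A : 'I_m.+1 -> nat -> R).
Hypothesis k1 : (1 < k)%N.
Hypothesis lawX : forall B : set (m.+1.-tuple (mR R)), measurable B ->
  P (X @^-1` B) = iid_expect N01 k (fun z => (\1_B (lin_tuple mu A k z))%:E).

Section Combination.
Variables (i j : 'I_m.+1) (u t : R).

Let Y (w : Omega) : R := u * (f i w - mu i) + t * (f j w - mu j).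
Let s2 : R := \sum_(l < k) (u * A i l + t * A j l) ^+ 2.

Lemma measurable_combination : measurable_fun setT (Y : Omega -> mR R).
Proof.
apply: measurable_funD; (apply: measurable_funM; first exact: measurable_cst);
  (apply: measurable_funB; last exact: measurable_cst).
- exact: (measurable_funPT (f i)).
- exact: (measurable_funPT (f j)).
Qed.

(** Means and covariances only need the laws of combinations of two coordinates, and these are
    one-dimensional by [iid_expect_lin]. *)
Lemma combination_law (B : set (mR R)) : measurable B ->
  P (Y @^-1` B) = (\int[N01]_x (\1_B (Num.sqrt s2 * x)%R)%:E)%E.
Proof.
move=> mB.
pose h (x : m.+1.-tuple (mR R)) : mR R := u * (tnth x i - mu i) + t * (tnth x j - mu j).
have mh : measurable_fun setT h.
  apply: measurable_funD; (apply: measurable_funM; first exact: measurable_cst);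
    by apply: measurable_funB; [exact: measurable_tnth|exact: measurable_cst].
have -> : Y @^-1` B = X @^-1` (h @^-1` B).
  by apply/seteqP; split => w /=; rewrite /h !tnth_mktuple.
rewrite lawX; last by rewrite -[_ @^-1` _]setTI; exact: mh.
transitivity (iid_expect N01 k (fun z =>
    ((fun y => (\1_B y)%:E) (0 + \sum_(l < k) (u * A i l + t * A j l) * z`_l)))%R).
  apply: (eq_iid_expect (normal_prob 0 1)) => z _; rewrite add0r.
  rewrite (_ : \sum_(l < k) _ = h (lin_tuple mu A k z)); first by rewrite !indicE.
  rewrite /h !tnth_mktuple [mu i + _]addrC [mu j + _]addrC !addrK /lin !mulr_sumr -big_split.
  by apply: eq_bigr => l _ /=; ring.
rewrite (iid_expect_lin (fun l => u * A i l + t * A j l) 0 (G := fun y => (\1_B y)%:E) k1)//;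
  last exact: measurable_EFin_indic.
by apply: eq_integral => x _; rewrite add0r.
Qed.

Lemma combination_sqr : (\int[P]_w (Y w ^+ 2)%:E = s2%:E)%E.
Proof.
have mY := measurable_combination.
have msc : measurable_fun setT (fun x : mR R => Num.sqrt s2 * x : mR R) by exact: measurable_funM.
have msqr : measurable_fun setT (fun x : mR R => (x ^+ 2)%:E).
  by apply/measurable_EFinP; exact: measurable_funX.
pose P1 := measure_function_pushforward__canonical__measure_function_Measure P mY.
pose N1 := measure_function_pushforward__canonical__measure_function_Measure
  (normal_prob 0 1 : {measure set (mR R) -> \bar R}) msc.
transitivity (\int[P1]_x (x ^+ 2)%:E)%E.
  by rewrite (ge0_integral_pushforward mY)// => x _; rewrite lee_fin sqr_ge0.
transitivity (\int[N1]_x (x ^+ 2)%:E)%E.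
  apply: eq_measure_integral => B mB _.
  rewrite /P1 /N1 /= /pushforward combination_law//.
  have mB' : measurable ((fun x : mR R => Num.sqrt s2 * x : mR R) @^-1` B).
    by rewrite -[_ @^-1` _]setTI; exact: (msc measurableT).
  by rewrite -(integral_normal_indic mB').
rewrite (ge0_integral_pushforward msc)//; last by move=> x _; rewrite lee_fin sqr_ge0.
transitivity (\int[N01]_x (s2%:E * (x ^+ 2)%:E))%E.
  apply: eq_integral => x _; rewrite /= exprMn sqr_sqrtr ?EFinM//.
  by apply: sumr_ge0 => l _; exact: sqr_ge0.
rewrite ge0_integralZl//; last 2 first.
- by move=> x _; rewrite lee_fin sqr_ge0.
- by rewrite lee_fin; apply: sumr_ge0 => l _; exact: sqr_ge0.
by rewrite normal_sqr mule1.
Qed.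

Lemma combination_sqr_integrable : P.-integrable setT (EFin \o (fun w => Y w ^+ 2)).
Proof.
apply/integrableP; split.
  apply/measurable_EFinP; apply: measurable_funX; exact: measurable_combination.
rewrite (eq_integral (fun w => (Y w ^+ 2)%:E)); first by rewrite combination_sqr ltry.
by move=> w _ /=; rewrite ger0_norm ?sqr_ge0.
Qed.

Lemma combination_integrable : P.-integrable setT (EFin \o Y).
Proof.
have mY := measurable_combination.
apply/integrableP; split; first exact/measurable_EFinP.
apply: (@le_lt_trans _ _ (\int[P]_w (1%:E + (Y w ^+ 2)%:E))%E).
  apply: le_integral_nomeas => w /=; rewrite -EFinD lee_fin.
  rewrite -[Y w ^+ 2]real_normK ?num_real//; have := sqr_ge0 (`|Y w| - 2^-1); lra.
rewrite ge0_integralD//.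
- by rewrite integral_prob_cst combination_sqr -EFinD ltry.
- by move=> w _; rewrite lee_fin sqr_ge0.
- by apply/measurable_EFinP; exact: measurable_funX.
Qed.

End Combination.

(** The variance is even in [u], so [Y 1] and [Y (-1)] have the same law: the centred coordinate has
    a mean equal to its opposite. *)
Lemma field_mean i : mean_fun f i = mu i.
Proof.
pose Y u (w : Omega) : mR R := u * (f i w - mu i) + 0 * (f i w - mu i).
have mY u := measurable_combination i i u 0.
have iY u := combination_integrable i i u 0.
have meanY : (\int[P]_w (Y 1 w)%:E = 0)%E.
  have Hpush u : (\int[pushforward P (Y u)]_(x in [set: mR R]) x%:E = \int[P]_w (Y u w)%:E)%E.
    have mE : measurable_fun setT (fun x : mR R => x%:E) by exact/measurable_EFinP.
    have H := @integral_pushforward _ _ _ _ _ _ (mY u) P setT _ mE (iY u) measurableT.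
    exact: H.
  have : (\int[P]_w (Y 1 w)%:E = \int[P]_w (Y (-1) w)%:E)%E.
    rewrite -!Hpush.
    apply: (@eq_measure_integral _ _ _ _
      (measure_function_pushforward__canonical__measure_function_Measure P (mY (-1)))
      (measure_function_pushforward__canonical__measure_function_Measure P (mY 1))) => B mB _.
    rewrite /= /pushforward !combination_law//; apply: eq_integral => x _.
    congr (\1_B (Num.sqrt _ * x))%:E; apply: eq_bigr => l _; ring.
  have -> : (\int[P]_w (Y (-1) w)%:E = - \int[P]_w (Y 1 w)%:E)%E.
    rewrite -mulN1e -(integralZl measurableT (iY 1) (-1)); apply: eq_integral => w _.
    by rewrite -EFinM; congr EFin; rewrite /Y; ring.
  have fY := integrable_fin_num measurableT (iY 1).
  rewrite -(fineK fY); move: (fine _) => e; rewrite -EFinN => -[] h.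
  by congr EFin; lra.
rewrite /mean_fun expectation.unlock.
transitivity (fine (\int[P]_w ((Y 1 w)%:E + (mu i)%:E))%E).
  by congr fine; apply: eq_integral => w _; rewrite -EFinD; congr EFin; rewrite /Y; ring.
have iC : P.-integrable setT (EFin \o cst (mu i)).
  exact: finite_measure_integrable_cst.
rewrite (integralD_EFin measurableT (iY 1) iC).
transitivity (fine (0 + (mu i)%:E)%E); last by rewrite add0e.
have mC : (\int[P]_x (EFin \o cst (mu i)) x = (mu i)%:E)%E.
  transitivity (\int[P]_x (mu i)%:E)%E; first by [].
  by rewrite integral_prob_cst.
by congr (fine (_ + _)%E); [exact: meanY|exact: mC].
Qed.

(** Polarisation: a product is the difference of the squares of the half sum and the half
    difference. *)
Lemma field_cov i j : cov_mx f i j = gram k A i j.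
Proof.
rewrite mxE covariance.unlock -/(mean_fun f i) -/(mean_fun f j) !field_mean expectation.unlock.
pose Y u t (w : Omega) : R := u * (f i w - mu i) + t * (f j w - mu j).
transitivity (fine (\int[P]_w ((Y 2^-1 2^-1 w ^+ 2)%:E - (Y 2^-1 (- 2^-1) w ^+ 2)%:E))%E).
  congr fine; apply: eq_integral => w _; rewrite -EFinB; congr EFin.
  have -> : ((f i \- cst (mu i)) * (f j \- cst (mu j))) w = (f i w - mu i) * (f j w - mu j).
    by [].
  by rewrite /Y; field.
rewrite integralB_EFin//; [|exact: combination_sqr_integrable..].
rewrite !combination_sqr -EFinB /= -sumrB; by apply: eq_bigr => l _; field.
Qed.

End Moments.

(** * Triangular factors available to the program *)

Section Branches.
Context {d : measure_display} {Omega : measurableType d} {R : realType}.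
Context (P : probability Omega R) {m : nat} (f : 'I_m.+1 -> {RV P >-> R}).
Local Notation N01 := (normal_prob 0 1 : set (mR R) -> \bar R).

(* The coefficient matrix, padded with zero columns, and for each [i] its LQ
   form with row [i] reduced first. *)
Lemma gaussian_branches : gaussian_field f -> cov_mx f \in unitmx ->
  exists (k' : nat) (A : 'I_m.+1 -> 'I_m.+1 -> nat -> R)
    (ae : 'I_m.+1 -> 'I_m.+1 -> nat -> expr m.+1),
  [/\ forall i, 0 < A i i 0%N,
      forall i j l s, (l < k'.+1)%N ->
        Defs.eval (mean_fun f) (cov_mx f) s (ae i j l) = A i j l,
      forall i l, (l < k'.+1)%N -> A i i l = if l == 0%N then A i i 0%N else 0 &
      forall i (B : set (m.+1.-tuple (mR R))), measurable B ->
        P (field_vector f @^-1` B) = iid_expect N01 k'.+1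
          (fun z => (\1_B (lin_tuple (mean_fun f) (A i) k'.+1 z))%:E)].
Proof.
move=> [k0 [A0 [mu law0]]] Cu.
(* The padding makes [k] strictly larger than [m.+1]: all rows are reduced, with a spare column as
   required by [gaussian_lq]. *)
pose k := (k0 + m.+2)%N.
pose A i l : R := if insub l is Some j then A0 i (j : 'I_k0) else 0.
have k1 : (1 < k)%N by rewrite /k addnS ltnS addnS.
have lawA (B : set (m.+1.-tuple (mR R))) : measurable B ->
    P (field_vector f @^-1` B) = iid_expect N01 k (fun z => (\1_B (lin_tuple mu A k z))%:E).
  move=> mB; rewrite law0// -(iid_expect_take (normal_prob 0 1) k0 m.+2).
  apply: (eq_iid_expect (normal_prob 0 1)) => z sz.
  congr (\1_B _)%:E; apply: eq_mktuple => i; congr (_ + _).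
  rewrite /lin big_split_ord /= [X in _ = _ + X]big1 ?addr0.
    apply: eq_bigr => j _; rewrite nth_take//; congr (_ * _).
    by rewrite /A; case: insubP => [j' _ /val_inj ->//|]; rewrite ltn_ord.
  by move=> j _; rewrite /A insubF ?mul0r// ltnNge leq_addr.
have meanE : mean_fun f = mu by apply/funext => i; exact: (field_mean k1 lawA).
have covE i j : \sum_(l < k) A i l * A j l = cov_mx f i j by rewrite (field_cov k1 lawA).
have mk : (m.+1 < k)%N by rewrite /k addnS ltnS leq_addl.
suff /choice[AA /choice[ae h]] : forall i, exists B, exists e : 'I_m.+1 -> nat -> expr m.+1,
    [/\ 0 < B i 0%N, forall l, (0 < l < k)%N -> B i l = 0,
        forall j l s, (l < k)%N -> Defs.eval (mean_fun f) (cov_mx f) s (e j l) = B j l &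
        same_law mu k A B].
  exists (k0 + m.+1)%N, AA, ae; rewrite -addnS -/k; split.
  - by move=> i; have [] := h i.
  - by move=> i j l s lk; have [_ _ -> //] := h i.
  - by move=> i [|l] lk //=; have [_ -> //] := h i.
  - move=> i B mB; have [_ _ _ sl] := h i; rewrite lawA// meanE.
    apply: (sl (fun x => (\1_B x)%:E)) => //.
    by apply/measurable_EFinP; exact: measurable_indic.
move=> i.
(* The order in which rows are reduced, [i] first, so that X_i depends on a single draw. *)
pose s := i :: [seq j <- enum 'I_m.+1 | j != i].
have us : uniq s by rewrite /= mem_filter eqxx /= filter_uniq// enum_uniq.
have ms j : j \in s by rewrite inE mem_filter mem_enum andbT orbN.
have ss : size s = m.+1.
  by rewrite -[RHS]card_ord -(card_uniqP us); apply: eq_card => j; rewrite ms.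
pose o a := nth i s a.
have [B [sl gB B0 Bge]] := gaussian_lq mu A o mk.
have gBC i1 i2 : \sum_(l < k) B i1 l * B i2 l = cov_mx f i1 i2.
  by rewrite -covE; exact: gB.
have oi : {in [pred a | (a < m.+1)%N] &, injective o}.
  by move=> a a'; rewrite !inE => h1 h2 /eqP; rewrite /o nth_uniq ?ss// => /eqP.
have Bgt := lq_diag_gt0 Cu oi gBC B0 Bge.
have os j : exists2 a, (a < m.+1)%N & o a = j.
  by exists (index j s); [have := ms j; rewrite -index_mem ss|exact: nth_index].
have he := cholesky_expressible (mean_fun f) (ltnW mk) os gBC B0 Bgt.
have /choice[e eE] : forall p : 'I_m.+1 * nat, exists e : expr m.+1, forall s,
    (p.2 < k)%N -> Defs.eval (mean_fun f) (cov_mx f) s e = B p.1 p.2.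
  move=> [j l]; case: (ltnP l k) => lk; first by have [e eE] := he j l lk; exists e.
  by exists (Defs.Lit 0).
exists B, (fun j l => e (j, l)); split=> //; first exact: (Bgt 0%N).
  by move=> l lk; exact: (B0 0%N).
by move=> j l s0 lk; rewrite eE.
Qed.

End Branches.

(** * Cost *)

Section Cost.
Context {R : realType} {m : nat} (mu : 'I_m.+1 -> R) (C : 'M[R]_m.+1).
Local Notation state := (@Defs.state R m).
Local Notation expect := (@Defs.expect R m mu C).
Local Notation eval := (@Defs.eval R m mu C).
Local Notation expr := (Defs.expr m.+1).
Local Notation cmd := (Defs.cmd m.+1).
Local Notation Lit := Defs.Lit.
Local Notation Sub := Defs.Sub.

Fixpoint loopfree (c : cmd) : bool :=
  match c with
  | Seq c1 c2 | IfLe _ _ c1 c2 => loopfree c1 && loopfree c2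
  | WhileLe _ _ _ => false
  | _ => true
  end.

Fixpoint static_cost (c : cmd) : nat :=
  match c with
  | Assign _ e => ops e
  | Gauss _ | Unif _ => 1
  | Seq c1 c2 => static_cost c1 + static_cost c2
  | IfLe e1 e2 c1 c2 => (ops e1 + ops e2).+1 + maxn (static_cost c1) (static_cost c2)
  | _ => 0
  end.

(** Without loops the cost grows by at most [static_cost] on every path, so the continuations are
    compared only at states within that bound. *)
Lemma expect_static (I : state -> Prop) c (g h : state -> \bar R) s :
  loopfree c -> preserves mu C I c -> I s ->
  (forall s', I s' -> (cost s' <= cost s + static_cost c)%N -> (g s' <= h s')%E) ->
  (expect c g s <= expect c h s)%E.
Proof.
elim: c g h s => [|k e|k p|k|k|c1 IH1 c2 IH2|e1 e2 c1 IH1 c2 IH2|//] g h s /=.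
- by move=> _ _ Is gh; apply: gh; rewrite ?addn0.
- by move=> _ Ic Is gh; apply: gh; [exact: Ic|].
- by move=> _ Ic Is gh; apply: gh; [exact: Ic|rewrite addn0].
- by move=> _ Ic Is gh; apply: le_integral_nomeas => z; apply: gh; [exact: Ic|].
- move=> _ Ic Is gh; apply: lee_sum => t _; apply: lee_wpmul2l; first by rewrite lee_fin invr_ge0.
  by apply: gh; [exact: Ic|].
- move=> /andP[l1 l2] [I1 I2] Is gh; apply: IH1 => // s1 Is1 c1s.
  apply: IH2 => // s2 Is2 c2s; apply: gh => //.
  by apply: leq_trans c2s _; rewrite addnA leq_add2r.
- move=> /andP[l1 l2] [It I1 I2] Is gh; case: ifP => _.
    apply: IH1 => //; first exact: It.
    move=> s1 Is1 c1s; apply: gh => //; apply: leq_trans c1s _ => /=.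
    by rewrite -addnA leq_add2l leq_add2l leq_maxl.
  apply: IH2 => //; first exact: It.
  move=> s1 Is1 c1s; apply: gh => //; apply: leq_trans c1s _ => /=.
  by rewrite -addnA leq_add2l leq_add2l leq_maxr.
Qed.

Fixpoint frame (D : pred nat) (c : cmd) : bool :=
  match c with
  | Assign k _ | Gauss k => ~~ D k
  | Seq c1 c2 | IfLe _ _ c1 c2 => frame D c1 && frame D c2
  | WhileLe _ _ c1 => frame D c1
  | _ => true
  end.

Lemma preserves_frame (D : pred nat) (I : state -> Prop) c :
  (forall s s', I s -> agree D s s' -> (cost s <= cost s')%N -> I s') ->
  frame D c -> preserves mu C I c.
Proof.
move=> ID; elim: c => //= [k e Dk s Is|k p _ s Is|k Dk s z Is|k _ s t Is|c1 IH1 c2 IH2|e1 e2 c1 IH1 c2 IH2|e1 e2 c1 IH1].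
- apply: (ID s) => //=; last exact: leq_addr.
  by move=> j Dj /=; case: eqP => // jk; rewrite -jk Dj in Dk.
- by apply: (ID s).
- apply: (ID s) => //=; last by rewrite addn1.
  by move=> j Dj /=; case: eqP => // jk; rewrite -jk Dj in Dk.
- by apply: (ID s) => //=; rewrite addn1.
- by move=> /andP[/IH1 ? /IH2 ?].
- move=> /andP[/IH1 ? /IH2 ?]; split=> // s Is.
  by apply: (ID s) => //=; exact: leq_addr.
- move=> /IH1 ?; split=> // s Is.
  by apply: (ID s) => //=; exact: leq_addr.
Qed.

Lemma preserves_agree D s c : frame D c -> preserves mu C (agree D s) c.
Proof.
by apply: preserves_frame => s1 s2 h1 h2 _ j Dj; rewrite h1// h2.
Qed.

Lemma preserves_True c : preserves mu C (fun=> True) c.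
Proof. by elim: c => //=. Qed.

(* [J] holds at every final state reached from [I]: expectations only see [J]. *)
Definition triple (I : state -> Prop) (c : cmd) (J : state -> Prop) : Prop :=
  forall (g h : state -> \bar R), (forall s, J s -> (g s <= h s)%E) ->
  forall s, I s -> (expect c g s <= expect c h s)%E.

Lemma triple_seq I J L c1 c2 : triple I c1 J -> triple J c2 L -> triple I (Seq c1 c2) L.
Proof. by move=> t1 t2 g h gh s Is /=; apply: t1 => // s1 Js1; exact: t2. Qed.

Lemma triple_preserves I c : preserves mu C I c -> triple I c I.
Proof. by move=> Ic g h gh s Is; exact: (expect_mono Ic). Qed.

Lemma triple_if I J e1 e2 c1 c2 : (forall s n, I s -> I (tick n s)) ->
  triple I c1 J -> triple I c2 J -> triple I (IfLe e1 e2 c1 c2) J.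
Proof.
by move=> It t1 t2 g h gh s Is /=; case: ifP => _; [apply: t1|apply: t2] => //; exact: It.
Qed.

(* The slack [r] lets the bounds of successive commands be chained. *)
Definition cheap (c : cmd) : Prop := exists2 B : R, 0 <= B &
  forall (r : R) (s : state), 0 <= r ->
    (expect c (fun s' => ((cost s')%:R + r)%:E) s <= ((cost s)%:R + r + B)%:E)%E.

(** An inequality only, since runs that do not terminate contribute 0. *)
Lemma expect_cst_le c (x : R) s : 0 <= x -> (expect c (fun=> x%:E) s <= x%:E)%E.
Proof.
move=> x0; elim: c s => //= [k s|k s|c1 IH1 c2 IH2 s|e1 e2 c1 IH1 c2 IH2 s|e1 e2 c1 IH1 s].
- by rewrite integral_prob_cst.
- under eq_bigr do rewrite -EFinM.
  rewrite sumEFin lee_fin sumr_const card_ord -[leLHS]mulr_natl mulrA divff ?mul1r//.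
- apply: le_trans (IH1 s); apply: (expect_mono (preserves_True c1)) => // s1 _; exact: IH2.
- by case: ifP => _; [exact: IH1|exact: IH2].
- apply: ge_ereal_sup => _ [k _ <-]; elim: k s => [|k IH] s /=; first by rewrite lee_fin.
  case: ifP => // _; apply: le_trans (IH1 _).
  apply: (expect_mono (preserves_True c1)) => // s1 _; exact: IH.
Qed.

Lemma cheap_loopfree c : loopfree c -> cheap c.
Proof.
move=> lc; exists (static_cost c)%:R => // r s r0.
apply: (@le_trans _ _ (expect c (fun=> ((cost s)%:R + r + (static_cost c)%:R)%:E) s)).
  apply: (expect_static lc (preserves_True c)) => // s' _ h.
  by rewrite lee_fin addrAC lerD2r -natrD ler_nat.
by apply: expect_cst_le; rewrite !addr_ge0.
Qed.

Lemma cheap_seq c1 c2 : cheap c1 -> cheap c2 -> cheap (Seq c1 c2).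
Proof.
move=> [B1 B10 h1] [B2 B20 h2]; exists (B1 + B2); first exact: addr_ge0.
move=> r s r0 /=.
apply: (@le_trans _ _ (expect c1 (fun s' => ((cost s')%:R + (r + B2))%:E) s)).
  apply: (expect_mono (preserves_True c1)) => // s' _.
  by rewrite addrA; exact: h2.
apply: le_trans (h1 _ _ _) _; first exact: addr_ge0.
by rewrite lee_fin; lra.
Qed.

Lemma cheap_if e1 e2 c1 c2 : cheap c1 -> cheap c2 -> cheap (IfLe e1 e2 c1 c2).
Proof.
move=> [B1 B10 h1] [B2 B20 h2]; exists ((ops e1 + ops e2).+1%:R + B1 + B2).
  by rewrite !addr_ge0.
move=> r s r0 /=; case: ifP => _.
  by apply: le_trans (h1 _ _ r0) _; rewrite lee_fin /= natrD; lra.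
by apply: le_trans (h2 _ _ r0) _; rewrite lee_fin /= natrD; lra.
Qed.

(** A supersolution of the cost recursion bounds every unfolding of the loop. The body is replaced
    by its largest cost, so that only the outcome of the trial remains random. *)
Lemma expect_reject_cost (Bd : cmd) (s : state) (p r : R) :
  loopfree Bd -> frame live Bd -> 0 < p <= 1 -> 0 <= r ->
  (forall x y s', 0 <= x -> 0 <= y -> agree live s s' -> reals s' 5 <= 0 ->
    expect Bd (fun s2 => if (reals s2 5 <= 0)%R then y%:E else x%:E) s' =
    (p * x + (1 - p) * y)%:E) ->
  reals s 5 <= 0 ->
  (expect (WhileLe (Reg 5) (Lit 0) Bd) (fun s' => ((cost s')%:R + r)%:E) s
   <= ((cost s)%:R + r + ((static_cost Bd)%:R + 2) / p)%:E)%E.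
Proof.
move=> lB fB /andP[p0 p1] r0 HB s5.
(* A turn costs 1 for the test and at most [N] for the body, and success is followed by one last
   test: 1 + N + p + (1 - p) Kl <= Kl is required, and p <= 1. *)
set N := static_cost Bd; set Kl := (N%:R + 2) / p.
have Kl0 : 0 <= Kl by rewrite divr_ge0 ?(ltW p0)// addr_ge0.
have pKl : p * Kl = N%:R + 2 by rewrite mulrC divfK// gt_eqF.
apply: ge_ereal_sup => _ [k _ <-]; set U := (X in iter k X).
suff H s' : agree live s s' ->
    (iter k U (fun=> 0%E) s' <= ((cost s')%:R + r + (if reals s' 5 <= 0 then Kl else 1))%:E)%E.
  by have := H s (fun _ _ => erefl); rewrite s5.
elim: k s' => [|k IH] s' ss; first by rewrite /= lee_fin !addr_ge0//; case: ifP.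
rewrite iterS; move: (iter k _ _) IH => W IH; rewrite /U /=.
case: ifPn => s'5; last by rewrite lee_fin /= natrD; lra.
apply: (@le_trans _ _ (expect Bd (fun s2 => if (reals s2 5 <= 0)%R
    then ((cost s')%:R + 1 + N%:R + r + Kl)%:E else ((cost s')%:R + 1 + N%:R + r + 1)%:E) (tick 1 s'))).
  apply: (expect_static lB (preserves_agree s fB)) => // s2 ss2 c2.
  apply: le_trans (IH _ ss2) _.
  have c2R : (cost s2)%:R <= (cost s')%:R + 1 + N%:R :> R by rewrite natr1 -natrD ler_nat -addn1; exact: c2.
  by case: ifP => _; rewrite lee_fin; lra.
rewrite HB//; first by rewrite lee_fin; nra.
- by rewrite !addr_ge0.
- by rewrite !addr_ge0.
Qed.

Section SamplerCost.
Variables (thr : expr) (th : R -> R).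
Hypothesis thrE : forall s, eval s thr = th (reals s 0).

Lemma tail_mean_cst (x : R) (s : state) : 0 <= x ->
  tail_mean th (fun=> x) s = x * (1 - normal_cdf (th (reals s 0))).
Proof.
move=> x0; apply: EFin_inj; rewrite (tail_meanE th s (fun=> x0) (fun=> lexx x)).
rewrite ge0_integralZr//; last by apply: measurable_EFin_indic.
by rewrite integral_normal_indic// normal_ray -EFinM mulrC.
Qed.

(** The bound must hold for all thresholds at once, as the threshold grows with the level. *)
Lemma cheap_sampler : cheap (sampler thr).
Proof.
have [p0 p00 accept] := marsaglia_accept R.
(* A lower bound for both acceptance rates: [p0] for thresholds from 1 on, the tail beyond 1 for the
   others. *)
pose pm := Num.min p0 (1 - normal_cdf 1).
have pm0 : 0 < pm by rewrite lt_min p00 subr_gt0 normal_cdf_lt1.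
pose N1 := static_cost (marsaglia_step thr); pose N2 := static_cost (plain_step thr).
pose n0 := (ops thr).+1.
exists (n0%:R + (N1%:R + 2) / pm + (N2%:R + 2) / pm).
  by rewrite !addr_ge0 ?divr_ge0 ?addr_ge0// ltW.
move=> r s r0.
have q1 : 0 <= (N1%:R + 2) / pm by apply: divr_ge0; [rewrite addr_ge0|exact: ltW].
have q2 : 0 <= (N2%:R + 2) / pm by apply: divr_ge0; [rewrite addr_ge0|exact: ltW].
pose s1 : state := tick n0 (tick 0 (set_real s 5 0)).
have -> : expect (sampler thr) (fun s' => ((cost s')%:R + r)%:E) s =
    if 1 <= eval (tick 0 (set_real s 5 0)) thr
    then expect (WhileLe (Reg 5) (Lit 0) (marsaglia_step thr)) (fun s => ((cost s)%:R + r)%:E) s1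
    else expect (WhileLe (Reg 5) (Lit 0) (plain_step thr)) (fun s => ((cost s)%:R + r)%:E) s1 by [].
rewrite thrE [reals _ _]/= -[reals s 0]/(reals s1 0).
have c1 : (cost s1)%:R = (cost s)%:R + n0%:R :> R by rewrite -natrD /= addn0.
have mc (x : R) : measurable_fun setT (fun z : mR R => x : mR R) by exact: measurable_cst.
case: ifPn => t1.
  have t0 : 0 < th (reals s1 0) by exact: lt_le_trans t1.
  (* Applied to the zero function only to name the acceptance probability, which is later identified
     with that of other continuations through its integral. *)
  have [p pE [p01 _]] := expect_marsaglia_step thrE (gr := fun=> 0) (fun _ _ _ => erefl)
    (fun=> lexx 0) (fun=> lexx 0) (mc 0) t0.
  have pmp : pm <= p by rewrite ge_min -lee_fin pE accept.
  apply: le_trans (expect_reject_cost (p := p) _ _ p01 r0 _ _) _ => //.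
    move=> x y s' x0 y0 ss s'5.
    have [p' p'E [_ H]] := expect_marsaglia_step thrE (gr := fun=> x) (fun _ _ _ => erefl)
      (fun=> x0) (fun=> lexx x) (mc x) t0.
    have -> : p = p' by apply: EFin_inj; rewrite pE p'E.
    rewrite (H y s' y0 ss s'5) tail_mean_cst// mulfK//.
    by rewrite subr_eq0 gt_eqF// normal_cdf_lt1.
  rewrite lee_fin c1 -/N1; case/andP: p01 => p0' _.
  have : (N1%:R + 2) / p <= (N1%:R + 2) / pm.
    by apply: ler_wpM2l; [rewrite addr_ge0|rewrite lef_pV2 ?posrE].
  by lra.
pose p := 1 - normal_cdf (th (reals s1 0)).
have p0' : 0 < p by rewrite subr_gt0 normal_cdf_lt1.
have p01 : 0 < p <= 1 by rewrite p0' gerBl normal_cdf_ge0.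
have pmp : pm <= p.
  have t1' : th (reals s1 0) <= 1 by rewrite ltW// ltNge.
  by rewrite /p ge_min lerD2l lerN2 normal_cdf_le t1' orbT.
apply: le_trans (expect_reject_cost (p := p) _ _ p01 r0 _ _) _ => //.
  move=> x y s' x0 y0 ss s'5.
  rewrite (expect_plain_step thrE (gr := fun=> x) (fun _ _ _ => erefl)
      (fun=> x0) (fun=> lexx x) (mc x) y0 ss s'5) tail_mean_cst//.
  by congr EFin; rewrite /p; ring.
rewrite lee_fin c1 -/N2.
have : (N2%:R + 2) / p <= (N2%:R + 2) / pm.
  by apply: ler_wpM2l; [rewrite addr_ge0|rewrite lef_pV2 ?posrE].
by lra.
Qed.

End SamplerCost.
End Cost.

Section ProgramCost.
Context {R : realType} {m : nat} (mu : 'I_m.+1 -> R) (C : 'M[R]_m.+1).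
Local Notation state := (@Defs.state R m).
Local Notation expect := (@Defs.expect R m mu C).
Local Notation eval := (@Defs.eval R m mu C).
Local Notation expr := (Defs.expr m.+1).
Local Notation cmd := (Defs.cmd m.+1).
Local Notation Lit := Defs.Lit.

Variables (k' : nat) (sg : 'I_m.+1 -> R) (se : 'I_m.+1 -> expr).
Variables (A : 'I_m.+1 -> 'I_m.+1 -> nat -> R) (ae : 'I_m.+1 -> 'I_m.+1 -> nat -> expr).
Hypothesis sgE : forall i s, eval s (se i) = sg i.
Hypothesis aeE : forall i j l s, (l < k'.+1)%N -> eval s (ae i j l) = A i j l.

Lemma loopfree_draws off n : loopfree (draws off n : cmd).
Proof. by elim: n off => //= n IH off; exact: IH. Qed.

Lemma loopfree_count i js : loopfree (count_all k' (ae i) js).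
Proof. by elim: js. Qed.

Lemma loopfree_after_head i : loopfree (after_head k' (ae i)).
Proof. by rewrite /= loopfree_draws loopfree_count. Qed.

Lemma frame_draws off n : (5 <= off)%N -> frame live (draws off n : cmd).
Proof.
elim: n off => //= n IH off o5; rewrite IH ?leqW// andbT /live -leqNgt.
exact: o5.
Qed.

Lemma frame_count i js : frame live (count_all k' (ae i) js).
Proof. by elim: js. Qed.

Lemma cheap_branch i : cheap mu C (branch k' se ae i).
Proof.
apply: cheap_seq; first exact: (cheap_sampler (eval_thr sgE i)).
by apply: cheap_loopfree; exact: loopfree_after_head.
Qed.

Lemma cheap_choose_branch i0 l : cheap mu C (choose_branch k' se ae i0 l).
Proof.
elim: l i0 => [|i l IH] i0; first exact: cheap_branch.
apply: cheap_seq; first exact: cheap_loopfree.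
by apply: cheap_if; [exact: cheap_branch|exact: IH].
Qed.

Definition stepped (s s' : state) : Prop :=
  reals s' 1 = reals s 1 /\ reals s' 4 = reals s 4 + 1.

Lemma triple_branch i s : triple mu C (agree live s) (branch k' se ae i) (stepped s).
Proof.
apply: (@triple_seq _ _ _ _ _ (agree live s)).
  by apply: triple_preserves; exact: preserves_agree.
apply: (@triple_seq _ _ _ _ _ (agree live s)).
  by apply: triple_preserves; apply: preserves_agree; exact: frame_draws.
apply: (@triple_seq _ _ _ _ _ (agree live s)).
  by apply: triple_preserves; exact: preserves_agree.
apply: (@triple_seq _ _ _ _ _ (agree live s)).
  by apply: triple_preserves; apply: preserves_agree; exact: frame_count.
move=> g h gh s' ss /=; apply: gh; split=> /=.
  by rewrite -ss.
by rewrite -ss.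
Qed.

Lemma triple_choose_branch i0 l s :
  triple mu C (agree live s) (choose_branch k' se ae i0 l) (stepped s).
Proof.
elim: l i0 => [|i l IH] i0; first exact: triple_branch.
apply: (@triple_seq _ _ _ _ _ (agree live s)).
  by apply: triple_preserves; exact: preserves_agree.
by apply: triple_if; [|exact: triple_branch|exact: IH].
Qed.

Lemma expected_cost_le : exists2 K : R, 0 < K &
  forall b n, (0 < n)%N -> (expected_cost mu C (main k' se ae) b n <= (K * n%:R)%:E)%E.
Proof.
have [B B0 HB] := cheap_choose_branch ord0 [seq lift ord0 i | i <- enum 'I_m].
pose e := sum_expr [seq e_tail se j | j <- enum 'I_m.+1].
(* The initial sum of tails costs [ops e]; a replication costs at most [B] on average, and its loop
   test 2; the 3 is the last test and the final division. *)
exists ((ops e)%:R + 3 + (B + 2)).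
  by rewrite ltr_pwDr ?addr_ge0// ltr_wpDl.
move=> b n n0; pose s0 : state := init_state b n.
pose s1 := tick (ops e) (set_real s0 2 (eval s0 e)).
pose g (s : state) : \bar R := ((cost s)%:R + 1)%:E.
have -> : expected_cost mu C (main k' se ae) b n = expect (loop k' se ae) g s1.
  rewrite -[LHS]/(expect (loop k' se ae) (expect (Assign 0 (Div (Reg 3) (Reg 1)))
    (fun s => (cost s)%:R%:E)) s1).
  congr (Defs.expect mu C _ _ s1); apply/funext => s.
  by rewrite -[LHS]/(((cost s + 1)%N)%:R%:E) natrD.
suff H k j (s : state) : reals s 1 - reals s 4 = j%:R ->
    (iter k (fun (h : state -> \bar R) (s0 : state) =>
      if (reals s0 4 + 1 <= reals s0 1)%R then expect (replication k' se ae) h (tick 2 s0)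
      else g (tick 2 s0)) (fun=> 0%E) s <= ((cost s)%:R + (3 + j%:R * (B + 2)))%:E)%E.
  apply: ge_ereal_sup => _ [k _ <-]; apply: le_trans (H k n s1 _) _.
    by rewrite /= subr0.
  have n1 : 1 <= n%:R :> R by rewrite ler1n.
  have -> : cost s1 = ops e by [].
  rewrite lee_fin; have o0 : 0 <= (ops e)%:R :> R by [].
  by nra.
elim: k j s => [|k IH] j s sj.
  by rewrite lee_fin !addr_ge0// mulr_ge0// addr_ge0.
rewrite iterS; move: (iter k _ _) IH => W IH.
rewrite -lerBrDl sj ler1n; case: j sj => [|j] sj.
  by rewrite ltnn lee_fin /= natrD mul0r addr0; lra.
rewrite ltnS leq0n.
apply: (@le_trans _ _ (expect (replication k' se ae)
    (fun s' => ((cost s')%:R + (3 + j%:R * (B + 2)))%:E) (tick 2 s))).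
  have T : triple mu C (agree live s) (replication k' se ae) (stepped s).
    exact: triple_choose_branch.
  apply: T => // s' [E1 E4]; apply: IH.
  by rewrite E1 E4 opprD addrA sj -natr1 addrK.
apply: le_trans (HB _ _ _) _; first by rewrite !addr_ge0// mulr_ge0// addr_ge0.
by rewrite lee_fin /= natrD -natr1; nra.
Qed.

(** Incrementing register 4 is itself an addition, so the counter never overtakes the cost. *)
Lemma preserves_counter_branch i : preserves mu C (fun s => reals s 4 <= (cost s)%:R) (branch k' se ae i).
Proof.
have fr c : frame live c -> preserves mu C (fun s => reals s 4 <= (cost s)%:R) c.
  apply: preserves_frame => s s' Is ss cs; rewrite -(ss 4%N)//.
  by apply: le_trans Is _; rewrite ler_nat.
split; first exact: fr.
split; first by apply: fr; exact: frame_draws.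
split; first exact: fr.
split; first by apply: fr; exact: frame_count.
split=> s Is /=.
  by apply: le_trans Is _; rewrite ler_nat leq_addr.
by rewrite natrD lerD2r.
Qed.

(** The cost dominates the counter at all times, and [loop_mean_counter] gives the final value of
    the counter. *)
Lemma expected_cost_ge b n : (n%:R%:E <= expected_cost mu C (main k' se ae) b n)%E.
Proof.
pose I (s : state) : Prop := reals s 4 <= (cost s)%:R.
have It (s : state) j : I s -> I (tick j s).
  by move=> Is; apply: le_trans Is _; rewrite ler_nat leq_addr.
have fr c : frame live c -> preserves mu C I c.
  apply: preserves_frame => s s' Is ss cs; rewrite /I -(ss 4%N)//.
  by apply: le_trans Is _; rewrite ler_nat.
have Irep : preserves mu C I (replication k' se ae).
  rewrite /replication; move: ord0 (map _ _) => i0 l; elim: l i0 => [|i l IH] i0.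
    exact: preserves_counter_branch.
  split; first exact: fr.
  split; [by move=> s; exact: It|exact: preserves_counter_branch|exact: IH].
have Imain : preserves mu C I (main k' se ae).
  split; first by move=> s Is; exact: It.
  split; first by split=> // s Is; exact: It.
  by move=> s Is; exact: It.
pose gr (s : state) : R := if reals s 4 == n%:R then n%:R else 0.
apply: (@le_trans _ _ (expect (main k' se ae) (fun s => (gr s)%:E) (init_state b n))); last first.
  apply: (expect_mono Imain) => [s Is|]; last by rewrite /I /=.
  by rewrite lee_fin /gr; case: eqP => [<-|_].
pose e := sum_expr [seq e_tail se j | j <- enum 'I_m.+1].
pose s0 : state := init_state b n.
pose s1 := tick (ops e) (set_real s0 2 (eval s0 e)).
have -> : expect (main k' se ae) (fun s => (gr s)%:E) (init_state b n) =
    expect (loop k' se ae) (fun s => (gr s)%:E) s1 by [].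
rewrite (expect_loop sgE aeE (gr := gr) (K := n%:R)).
- have -> : Num.truncn (reals s1 1 - reals s1 4) = n by rewrite /= subr0 natrK.
  by rewrite loop_mean_counter// /= add0r.
- by move=> s s' ss; rewrite /gr (ss 4%N).
- by move=> s; rewrite /gr; case: ifP.
- by move=> s; rewrite /gr; case: ifP.
Qed.

End ProgramCost.

(** * The approximation scheme *)

Theorem theorem3p2 (R : realType) (d : measure_display)
    (Omega : measurableType d) (P : probability Omega R) (m : nat)
    (f : 'I_m.+1 -> {RV P >-> R}) (b0 : R) :
  gaussian_field f ->
  cov_mx f \in unitmx ->
  exists (n : R -> R -> nat) (c : cmd m.+1),
    [/\ forall eps delta : R, (0 < n eps delta)%N,
        implements_Afin f b0 c &
        is_fpras 0 b0 (excursion_prob f)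
          (fun b eps delta =>
             output_law (mean_fun f) (cov_mx f) c b (n eps delta))
          (fun b eps delta =>
             expected_cost (mean_fun f) (cov_mx f) c b (n eps delta))].
Proof.
move=> gf Cu; have [k' [A [ae [A0 aeE Ah lawA]]]] := gaussian_branches gf Cu.
pose sg i := A i i 0%N; pose se i := ae i i 0%N.
have sgE i s : Defs.eval (mean_fun f) (cov_mx f) s (se i) = sg i by exact: aeE.
pose N : R := m.+1%:R ^+ 2.
have N0 : 0 < N by rewrite exprn_gt0.
(* The successor of the integer part is positive and exceeds the number asked for by Chebyshev's
   inequality. It does not depend on the level, whence [q = 0]. *)
pose rep (eps delta : R) : nat := (Num.truncn (N * (eps ^- 2 * delta^-1))).+1.
have outE b n B : output_law (mean_fun f) (cov_mx f) (main k' se ae) b n B = Afin_law f b n B.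
  by rewrite (output_law_main sgE aeE) (Afin_law_dexp A0 Ah lawA).
exists rep, (main k' se ae); split.
- by [].
- by move=> b n B _ _ _; exact: outE.
split.
- exact: lexx.
- by move=> b _; exact: (excursion_prob_gt0 A0 Ah lawA).
- exact: (excursion_prob_cvg0 A0 Ah lawA).
exists 2, 1; split=> //.
- move=> b eps delta _ e0 /andP[d0 d1]; rewrite outE.
  apply: (Afin_accuracy A0 Ah lawA) => //.
  have e2 : 0 < eps ^+ 2 by rewrite exprn_gt0.
  have := ltW (truncnS_gt (N * (eps ^- 2 * delta^-1))); rewrite -/(rep eps delta).
  move: (rep eps delta)%:R => r h.
  have NE : N = N * (eps ^- 2 * delta^-1) * (eps ^+ 2 * delta).
    by field; rewrite !gt_eqF.
  by rewrite -/N NE -[r * _ * _]mulrA ler_wpM2r// mulr_ge0// ltW.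
move=> eps1 e10; have [K K0 HK] := expected_cost_le k' ae sgE.
(* The successor in [rep] adds one replication, which [eps1 ^+ 2] absorbs: for eps <= eps1 and delta
   < 1, eps1^2 eps^-2 delta^-1 is at least 1. *)
exists N, (K * (N + eps1 ^+ 2)); split=> //.
  by rewrite mulr_gt0// addr_gt0// exprn_gt0.
move=> b eps delta _ /andP[e0 e1] /andP[d0 d1] /=.
rewrite powRr0 mulr1 !powRN powR_mulrn ?(ltW e0)// powRr1 ?(ltW d0)//.
set x := eps ^- 2 * delta^-1.
have x0 : 0 < x by rewrite mulr_gt0// invr_gt0// exprn_gt0.
have nx : N * x <= (rep eps delta)%:R by exact: ltW (truncnS_gt _).
apply/andP; split.
  by apply: le_trans (expected_cost_ge sgE aeE _ _); rewrite lee_fin.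
apply: (le_trans (HK _ _ _)) => //; rewrite lee_fin -mulrA ler_pM2l// mulrDl.
rewrite /rep -natr1 lerD//.
  by rewrite truncn_le// mulr_ge0// ltW.
rewrite /x mulrA -[leLHS]mulr1 ler_pM// ?invf_ge1//; last exact: ltW.
by rewrite ler_pdivlMr ?exprn_gt0// mul1r ler_sqr ?nnegrE// ltW.
Qed.
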